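(* Let $k$ be a field, $n\ge1$, $V=k^n$, $N\ge 2$ and let $E:V^{\otimes N}\to k$ be a left and right non-degenerate linear map. Let $SL(E)$ be the universal algebra with generators $(a_{ij})_{1\le i,j\le n}$ and relations $$\sum_{j_1,\ldots,j_N}E(j_1,\ldots,j_N)\,a_{j_1i_1}\cdots a_{j_Ni_N}=E(i_1,\ldots,i_N)1,\qquad 1\le i_1,\ldots,i_N\le n,$$ $$\sum_{j_1,\ldots,j_N}E(j_1,\ldots,j_N)\,a_{i_1j_1}\cdots a_{i_Nj_N}=E(i_1,\ldots,i_N)1,\qquad 1\le i_1,\ldots,i_N\le n.$$ i) Then $SL(E)$ is a Hopf algebra with bijective antipode. ii) Assume that there are invertible scalars $(\beta_i)_{1\le i\le n}$ such that $E(j_1,\ldots,j_{N-1},i)=\beta_iE(i,j_1,\ldots,j_{N-1})$ for all $i,j_1,\ldots,j_{N-1}$. Then there is a sovereign character $\Phi_\beta$ on $SL(E)$ such that $\Phi_\beta(a_{ij})=\delta_{ij}\beta_i$. iii) If $k$ is a field of characteristic zero and if the field $\mathbb Q\big(E(j_1,\ldots,j_N)\,;\,1\le j_1,\ldots,j_N\le n\big)$ can be ordered, then $SL(E)$ is cosemisimple. iv) If $k=\mathbb C$ and $E(j_1,\ldots,j_N)\in\mathbb R$ for all $j_1,\ldots,j_N$, then $SL(E)$ admits a $CQG$ algebra structure.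
   Context: Let $e_1,\ldots,e_n$ be the canonical basis of $V=k^n$, with dual basis $e_1^*,\ldots,e_n^*$, and write $E(i_1,\ldots,i_N)=E(e_{i_1}\otimes\cdots\otimes e_{i_N})$. $E$ is left non-degenerate if the linear map $V^{\otimes N-1}\to V^*$, $e_{i_1}\otimes\cdots\otimes e_{i_{N-1}}\mapsto\sum_kE(i_1,\ldots,i_{N-1},k)e_k^*$ is surjective, and right non-degenerate if the linear map $V^{\otimes N-1}\to V^*$, $e_{i_1}\otimes\cdots\otimes e_{i_{N-1}}\mapsto\sum_kE(k,i_1,\ldots,i_{N-1})e_k^*$ is surjective. The coalgebra structure considered on $SL(E)$ is the one for which $\Delta(a_{ij})=\sum_ka_{ik}\otimes a_{kj}$ and $\varepsilon(a_{ij})=\delta_{ij}$ ($\Delta$ and $\varepsilon$ being algebra morphisms). For a Hopf algebra $A$ with bijective antipode $S$, a sovereign character is a character (unital algebra morphism) $\Phi:A\to k$ with $S^{-1}=\Phi*S*\Phi^{-1}$ ($*$ convolution, $\Phi^{-1}$ the convolution inverse). A Hopf $*$-algebra is a complex Hopf algebra which is a $*$-algebra and whose coproduct is a $*$-homomorphism. A $CQG$ algebra is a Hopf $*$-algebra $A$ such that every finite-dimensional $A$-comodule is unitarizable: for every matrix $a=(a_{ij})\in M_n(A)$ with $\Delta(a_{ij})=\sum_ka_{ik}\otimes a_{kj}$ and $\varepsilon(a_{ij})=\delta_{ij}$ there is $F\in GL_n(\mathbb C)$ such that $FaF^{-1}$ is unitary (where, for a matrix $b=(b_{ij})$ over $A$,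 $b^*$ is the matrix with $(i,j)$ entry $b_{ji}^*$). A complex Hopf algebra admits a $CQG$ algebra structure if it has a $*$-structure making it a $CQG$ algebra. *)

(* Defs.v *)
From HB Require Import structures.
From mathcomp Require Import all_boot all_order all_algebra.
From mathcomp Require Import generic_quotient sesquilinear complex.
From mathcomp Require Import boolp reals.

Set Implicit Arguments.
Unset Strict Implicit.
Unset Printing Implicit Defensive.

Import Order.TTheory GRing.Theory Num.Theory.
Local Open Scope ring_scope.
Local Open Scope quotient_scope.

Notation bilin f := (bilinear_for *:%R *:%R f).

Section Tensor.
Variables (k : fieldType) (A B : lmodType k).

(* A list [:: (x_1, y_1); ...; (x_r, y_r)] stands for x_1 (x) y_1 + ... +
   x_r (x) y_r; two such formal sums are equal as tensors when no bilinear map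
   separates them, which is the universal property of the tensor product. *)
Definition tsum_eq (s t : seq (A * B)) : bool :=
  `[< forall (W : lmodType k) (f : A -> B -> W), bilin f ->
        \sum_(p <- s) f p.1 p.2 = \sum_(p <- t) f p.1 p.2 >].

Lemma tsum_eq_refl : reflexive tsum_eq.
Proof. by move=> s; apply/asboolP. Qed.

Lemma tsum_eq_sym : symmetric tsum_eq.
Proof.
by move=> s t; apply/asboolP/asboolP => h W f bf; rewrite (h W f bf).
Qed.

Lemma tsum_eq_trans : transitive tsum_eq.
Proof.
move=> t s u /asboolP h1 /asboolP h2; apply/asboolP => W f bf.
by rewrite (h1 W f bf) (h2 W f bf).
Qed.

Canonical tsum_equiv := EquivRel tsum_eq tsum_eq_refl tsum_eq_sym tsum_eq_trans.

Definition tens := {eq_quot tsum_equiv}.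
HB.instance Definition _ := Choice.on tens.
HB.instance Definition _ := EqQuotient.on tens.

Definition tpure (x : A) (y : B) : tens := \pi_tens [:: (x, y)].

(* For bilinear f, the linear map on the tensor product with
   x (x) y |-> f x y; it does not depend on the representative by [tlift_pi],
   and is not meaningful when f is not bilinear. *)
Definition tlift (W : lmodType k) (f : A -> B -> W) (t : tens) : W :=
  \sum_(p <- repr t) f p.1 p.2.

Lemma tlift_pi (W : lmodType k) (f : A -> B -> W) s :
  bilin f -> tlift f (\pi_tens s) = \sum_(p <- s) f p.1 p.2.
Proof.
move=> bf; rewrite /tlift.
have /eqmodP/asboolP : repr (\pi_tens s) = s %[mod tens] by rewrite reprK.
exact.
Qed.

Lemma tensP (s t : tens) :
  (forall (W : lmodType k) (f : A -> B -> W), bilin f ->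
     tlift f s = tlift f t) -> s = t.
Proof.
move=> h; rewrite -[s]reprK -[t]reprK; apply/eqmodP/asboolP => W f bf.
exact: h.
Qed.

Definition tadd (s t : tens) : tens := \pi_tens (repr s ++ repr t).
Definition tscale (c : k) (t : tens) : tens :=
  \pi_tens [seq (c *: p.1, p.2) | p <- repr t].

Lemma bilinDl (W : lmodType k) (f : A -> B -> W) : bilin f ->
  forall x x' y, f (x + x') y = f x y + f x' y.
Proof. by move=> bf x x' y; have := bf.1 y 1 x x'; rewrite /= !scale1r. Qed.

Lemma bilinDr (W : lmodType k) (f : A -> B -> W) : bilin f ->
  forall x y y', f x (y + y') = f x y + f x y'.
Proof. by move=> bf x y y'; have := bf.2 x 1 y y'; rewrite /= !scale1r. Qed.

Lemma bilin0l (W : lmodType k) (f : A -> B -> W) : bilin f ->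
  forall y, f 0 y = 0.
Proof.
by move=> bf y; apply: (@addrI _ (f 0 y)); rewrite -bilinDl // !addr0.
Qed.

Lemma bilin0r (W : lmodType k) (f : A -> B -> W) : bilin f ->
  forall x, f x 0 = 0.
Proof.
by move=> bf x; apply: (@addrI _ (f x 0)); rewrite -bilinDr // !addr0.
Qed.

Lemma bilinZl (W : lmodType k) (f : A -> B -> W) : bilin f ->
  forall c x y, f (c *: x) y = c *: f x y.
Proof.
move=> bf c x y; have := bf.1 y c x 0.
by rewrite /= /applyr addr0 (bilin0l bf) addr0.
Qed.

Lemma bilinZr (W : lmodType k) (f : A -> B -> W) : bilin f ->
  forall c x y, f x (c *: y) = c *: f x y.
Proof.
by move=> bf c x y; have := bf.2 x c y 0; rewrite addr0 (bilin0r bf) addr0.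
Qed.

Section Lift.
Variables (W : lmodType k) (f : A -> B -> W).
Hypothesis bf : bilin f.

Lemma tlift_add s t : tlift f (tadd s t) = tlift f s + tlift f t.
Proof. by rewrite /tadd tlift_pi // big_cat. Qed.

Lemma tlift_scale c t : tlift f (tscale c t) = c *: tlift f t.
Proof.
rewrite /tscale tlift_pi // big_map scaler_sumr.
by apply: eq_bigr => p _; rewrite /= bilinZl.
Qed.

Lemma tlift_pure x y : tlift f (tpure x y) = f x y.
Proof. by rewrite /tpure tlift_pi // big_seq1. Qed.

Lemma tlift_nil : tlift f (\pi_tens [::]) = 0.
Proof. by rewrite tlift_pi // big_nil. Qed.

End Lift.

Lemma taddA : associative tadd.
Proof. by move=> s t u; apply: tensP => W f bf; rewrite !tlift_add // addrA. Qed.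
Lemma taddC : commutative tadd.
Proof. by move=> s t; apply: tensP => W f bf; rewrite !tlift_add // addrC. Qed.
Lemma tadd0 : left_id (\pi_tens [::]) tadd.
Proof.
by move=> t; apply: tensP => W f bf; rewrite tlift_add // tlift_nil // add0r.
Qed.
Lemma taddN : left_inverse (\pi_tens [::]) (tscale (- 1)) tadd.
Proof.
move=> t; apply: tensP => W f bf.
by rewrite tlift_add // tlift_scale // tlift_nil // scaleN1r addNr.
Qed.

HB.instance Definition _ := GRing.isZmodule.Build tens taddA taddC tadd0 taddN.

Lemma tliftD (W : lmodType k) (f : A -> B -> W) : bilin f ->
  forall s t : tens, tlift f (s + t) = tlift f s + tlift f t.
Proof. by move=> bf s t; exact: tlift_add. Qed.

Lemma tscaleA a b t : tscale a (tscale b t) = tscale (a * b) t.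
Proof. by apply: tensP => W f bf; rewrite !tlift_scale // scalerA. Qed.
Lemma tscale1 : left_id 1 tscale.
Proof. by move=> t; apply: tensP => W f bf; rewrite tlift_scale // scale1r. Qed.
Lemma tscaleDr : right_distributive tscale +%R.
Proof.
move=> c s t; apply: tensP => W f bf.
by rewrite tlift_scale // !tliftD // !tlift_scale // scalerDr.
Qed.
Lemma tscaleDl t : {morph tscale^~ t : a b / a + b}.
Proof.
move=> a b; apply: tensP => W f bf.
by rewrite tliftD // !tlift_scale // scalerDl.
Qed.

HB.instance Definition _ :=
  GRing.Zmodule_isLmodule.Build k tens tscaleA tscale1 tscaleDr tscaleDl.

Lemma tlift_linear (W : lmodType k) (f : A -> B -> W) :
  bilin f -> linear (tlift f : tens -> W).
Proof. by move=> bf c s t; rewrite tliftD // tlift_scale. Qed.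

Lemma tpure_bilin : bilin tpure.
Proof.
split=> [y c x x' | x c y y'] /=; apply: tensP => W f bf;
  rewrite tlift_linear // !tlift_pure //.
- by rewrite bilinDl // bilinZl.
- by rewrite bilinDr // bilinZr.
Qed.

Lemma tens_sum (t : tens) : t = \sum_(p <- repr t) tpure p.1 p.2.
Proof.
apply: tensP => W f bf; rewrite {1}/tlift.
elim: (repr t) => [|p s ih]; first by rewrite !big_nil tlift_nil.
by rewrite !big_cons tliftD // tlift_pure // ih.
Qed.

End Tensor.

Arguments tlift {k A B W} f t.
Notation "x ⊗ y" := (tpure x y) (at level 40, left associativity) : ring_scope.

Section TensorAlgebra.
Variables (k : fieldType) (A B : algType k).
Implicit Types s t u : tens A B.

Definition tone : tens A B := 1 ⊗ 1.
Definition tmul s t : tens A B :=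
  tlift (fun x y => tlift (fun x' y' => (x * x') ⊗ (y * y')) t) s.

Lemma mul_bilinr (W : lmodType k) (f : A -> B -> W) x y :
  bilin f -> bilin (fun x' y' => f (x * x') (y * y')).
Proof.
move=> bf; split=> [y' c x1 x2 | x' c y1 y2] /=; rewrite mulrDr -scalerAr.
- by rewrite bilinDl // bilinZl.
- by rewrite bilinDr // bilinZr.
Qed.

Lemma mul_bilinl (W : lmodType k) (f : A -> B -> W) t :
  bilin f ->
  bilin (fun x y => tlift (fun x' y' => f (x * x') (y * y')) t).
Proof.
move=> bf; split=> [y c x1 x2 | x c y1 y2] /=;
  rewrite /applyr /tlift scaler_sumr -big_split; apply: eq_bigr => p _ /=;
  rewrite mulrDl -scalerAl.
- by rewrite bilinDl // bilinZl.
- by rewrite bilinDr // bilinZr.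
Qed.

Lemma tlift_sum (W : lmodType k) (f : A -> B -> W) (I : Type) (r : seq I)
    (g : I -> tens A B) : bilin f ->
  tlift f (\sum_(i <- r) g i) = \sum_(i <- r) tlift f (g i).
Proof.
move=> bf; elim: r => [|i r ih]; first by rewrite !big_nil [LHS]tlift_nil.
by rewrite !big_cons tliftD // ih.
Qed.

Lemma tlift_mul (W : lmodType k) (f : A -> B -> W) s t : bilin f ->
  tlift f (tmul s t) =
  tlift (fun x y => tlift (fun x' y' => f (x * x') (y * y')) t) s.
Proof.
move=> bf; rewrite /tmul {1}[in LHS]/tlift; rewrite [LHS]tlift_sum //.
apply: eq_bigr => p _; rewrite tlift_sum //.
by apply: eq_bigr => q _; rewrite tlift_pure.
Qed.

Lemma tmulA : associative tmul.
Proof.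
move=> s t u; apply: tensP => W f bf.
rewrite tlift_mul // (tlift_mul _ _ bf) (tlift_mul _ _ (mul_bilinl u bf)).
apply: eq_bigr => p _; rewrite tlift_mul; last exact: mul_bilinr.
apply: eq_bigr => q _; apply: eq_bigr => r _; by rewrite !mulrA.
Qed.

Lemma tmul1 : left_id tone tmul.
Proof.
move=> t; apply: tensP => W f bf.
rewrite tlift_mul // (tlift_pure (mul_bilinl t bf)).
by apply: eq_bigr => p _; rewrite !mul1r.
Qed.

Lemma tmulr1 : right_id tone tmul.
Proof.
move=> t; apply: tensP => W f bf; rewrite tlift_mul //.
by apply: eq_bigr => p _; rewrite (tlift_pure (mul_bilinr _ _ bf)) !mulr1.
Qed.

Lemma tmulDl : left_distributive tmul +%R.
Proof.
move=> s t u; apply: tensP => W f bf.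
by rewrite tliftD // !tlift_mul // (tliftD (mul_bilinl u bf)).
Qed.

Lemma tmulDr : right_distributive tmul +%R.
Proof.
move=> s t u; apply: tensP => W f bf.
rewrite tliftD // !tlift_mul // -big_split; apply: eq_bigr => p _ /=.
by rewrite (tliftD (mul_bilinr _ _ bf)).
Qed.

HB.instance Definition _ :=
  GRing.Zmodule_isPzRing.Build (tens A B) tmulA tmul1 tmulr1 tmulDl tmulDr.

Lemma tpureM (x x' : A) (y y' : B) :
  (x ⊗ y) * (x' ⊗ y') = (x * x') ⊗ (y * y').
Proof.
apply: tensP => W f bf; rewrite tlift_mul // (tlift_pure (mul_bilinl _ bf)).
by rewrite (tlift_pure (mul_bilinr _ _ bf)) tlift_pure.
Qed.

End TensorAlgebra.

Section TensorMaps.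
Variable k : fieldType.

Definition tmap (A A' B B' : lmodType k) (f : A -> A') (g : B -> B')
  (t : tens A B) : tens A' B' := tlift (fun x y => f x ⊗ g y) t.

Definition tassoc (A B C : lmodType k) (t : tens (tens A B) C) :
    tens A (tens B C) :=
  tlift (fun u z => tlift (fun x y => x ⊗ (y ⊗ z)) u) t.

End TensorMaps.

Record hopfAlgebra (k : fieldType) (A : algType k) := HopfAlgebra {
  comul : {linear A -> tens A A};
  counit : {lrmorphism A -> k^o};
  antipode : {linear A -> A};
  comul_mul : monoid_morphism comul;
  comulA : forall x, tassoc (tmap comul idfun (comul x))
                     = tmap idfun comul (comul x);
  comul_counitl : forall x, tlift (fun y z => counit y *: z) (comul x) = x;
  comul_counitr : forall x, tlift (fun y z => counit z *: y) (comul x) = x;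
  antipodel : forall x, tlift (fun y z => antipode y * z) (comul x)
                        = (counit x)%:A;
  antipoder : forall x, tlift (fun y z => y * antipode z) (comul x)
                        = (counit x)%:A
}.

Section Hopf.
Variables (k : fieldType) (A : algType k) (H : hopfAlgebra A).

Definition conv (B : algType k) (f g : A -> B) (x : A) : B :=
  tlift (fun y z => f y * g z) (comul H x).

(* The scalar-valued maps of the convolution product are composed with the
   unit k -> A. *)
Definition is_sovereign (Phi : {lrmorphism A -> k^o}) : Prop :=
  exists (Sinv : A -> A) (Psi : {linear A -> k^o}),
    [/\ cancel (antipode H) Sinv /\ cancel Sinv (antipode H),
        conv Phi Psi =1 counit H,
        conv Psi Phi =1 counit H &
        Sinv =1 conv (conv (fun x => (Phi x)%:A) (antipode H))
                     (fun x => (Psi x)%:A)].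

Definition subcoalgebra (D : {pred A}) : Prop :=
  submod_closed D /\
  forall x, x \in D -> exists2 s : seq (A * A),
    all (fun p => (p.1 \in D) && (p.2 \in D)) s
    & comul H x = \sum_(p <- s) p.1 ⊗ p.2.

Definition nonzero_space (D : {pred A}) : Prop := exists2 x, x \in D & x != 0.

Definition simple_subcoalgebra (D : {pred A}) : Prop :=
  [/\ subcoalgebra D, nonzero_space D &
      forall D' : {pred A}, subcoalgebra D' -> nonzero_space D' ->
        {subset D' <= D} -> D' =i D].

Definition direct_sum (I : eqType) (D : I -> {pred A}) : Prop :=
  (forall x, exists (s : seq I) (y : I -> A),
     (forall i, i \in s -> y i \in D i) /\ x = \sum_(i <- s) y i) /\
  (forall (s : seq I) (y : I -> A), uniq s ->
     (forall i, i \in s -> y i \in D i) -> \sum_(i <- s) y i = 0 ->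
     forall i, i \in s -> y i = 0).

Definition cosemisimple : Prop :=
  exists (I : eqType) (D : I -> {pred A}),
    (forall i, simple_subcoalgebra (D i)) /\ direct_sum D.

Definition multiplicative_matrix (m : nat) (a : 'M[A]_m) : Prop :=
  forall i j, comul H (a i j) = \sum_l a i l ⊗ a l j /\
              counit H (a i j) = (i == j)%:R.

End Hopf.

Section CQG.
Variables (R : realType) (A : algType R[i]) (H : hopfAlgebra A).

(* The last condition says that comul is a *-homomorphism for
   (x (x) y)^* = x^* (x) y^*. *)
Definition hopf_star (star : A -> A) : Prop :=
  [/\ forall (c : R[i]) x y, star (c *: x + y) = c^* *: star x + star y,
      forall x y, star (x * y) = star y * star x,
      involutive star &
      forall x (s : seq (A * A)), comul H x = \sum_(p <- s) p.1 ⊗ p.2 ->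
        comul H (star x) = \sum_(p <- s) star p.1 ⊗ star p.2].

Definition star_mx (star : A -> A) (m : nat) (b : 'M[A]_m) : 'M[A]_m :=
  \matrix_(i, j) star (b j i).

Definition unitary (star : A -> A) (m : nat) (b : 'M[A]_m) : Prop :=
  b *m star_mx star b = 1%:M /\ star_mx star b *m b = 1%:M.

Definition scal_mx (m : nat) (F : 'M[R[i]]_m) : 'M[A]_m :=
  map_mx (fun c => c%:A) F.

Definition unitarizable (star : A -> A) (m : nat) (a : 'M[A]_m) : Prop :=
  exists2 F : 'M[R[i]]_m, F \in unitmx &
    unitary star (scal_mx F *m a *m scal_mx (invmx F)).

Definition is_CQG (star : A -> A) : Prop :=
  hopf_star star /\
  forall (m : nat) (a : 'M[A]_m), multiplicative_matrix H a ->
    unitarizable star a.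

Definition admits_CQG : Prop := exists star : A -> A, is_CQG star.

End CQG.

(* A linear form E on V^{(x) N}, V = k^n, is given by its values
   E(i_1, ..., i_N) on the canonical basis; V^* is identified with 'rV_n through
   the dual basis, and V^{(x) N} with {ffun N.-tuple 'I_n -> k}. *)
Section Form.
Variables (k : fieldType) (n m : nat) (E : m.+1.-tuple 'I_n -> k).

Definition left_map (x : {ffun m.-tuple 'I_n -> k}) : 'rV[k]_n :=
  \row_c \sum_(i : m.-tuple 'I_n) x i * E [tuple of rcons i c].

Definition right_map (x : {ffun m.-tuple 'I_n -> k}) : 'rV[k]_n :=
  \row_c \sum_(i : m.-tuple 'I_n) x i * E [tuple of c :: i].

Definition left_nondegenerate := forall v, exists x, left_map x = v.
Definition right_nondegenerate := forall v, exists x, right_map x = v.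

End Form.

Section SL.
Variables (k : fieldType) (n N : nat) (E : N.-tuple 'I_n -> k).

Definition SL_rel (A : algType k) (a : 'M[A]_n) : Prop :=
  (forall i : N.-tuple 'I_n,
     \sum_(j : N.-tuple 'I_n)
        E j *: \prod_(l < N) a (tnth j l) (tnth i l) = E i *: 1) /\
  (forall i : N.-tuple 'I_n,
     \sum_(j : N.-tuple 'I_n)
        E j *: \prod_(l < N) a (tnth i l) (tnth j l) = E i *: 1).

(* Noncommutative polynomials in the generators, as lists of monomials
   (coefficient, word). *)
Definition ncpoly := seq (k * seq ('I_n * 'I_n)).

Definition nceval (A : algType k) (a : 'M[A]_n) (p : ncpoly) : A :=
  \sum_(t <- p) t.1 *: \prod_(g <- t.2) a g.1 g.2.

(* Two polynomials are equal in SL(E) when they agree on every matrix satisfying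
   the relations, i.e. when their equality is a consequence of the relations;
   see [SL_gen_rel] and [SL_universal]. *)
Definition SL_eq (p q : ncpoly) : bool :=
  `[< forall (A : algType k) (a : 'M[A]_n), SL_rel a ->
        nceval a p = nceval a q >].

Lemma SL_eq_refl : reflexive SL_eq.
Proof. by move=> p; apply/asboolP. Qed.

Lemma SL_eq_sym : symmetric SL_eq.
Proof. by move=> p q; apply/asboolP/asboolP => h A a ra; rewrite h. Qed.

Lemma SL_eq_trans : transitive SL_eq.
Proof.
move=> q p r /asboolP h1 /asboolP h2; apply/asboolP => A a ra.
by rewrite h1 // h2.
Qed.

Canonical SL_equiv := EquivRel SL_eq SL_eq_refl SL_eq_sym SL_eq_trans.

Definition SL := {eq_quot SL_equiv}.
HB.instance Definition _ := Choice.on SL.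
HB.instance Definition _ := EqQuotient.on SL.

Definition SL_eval (A : algType k) (a : 'M[A]_n) (x : SL) : A :=
  nceval a (repr x).

Lemma SL_eval_pi (A : algType k) (a : 'M[A]_n) p :
  SL_rel a -> SL_eval a (\pi_SL p) = nceval a p.
Proof.
move=> ra; rewrite /SL_eval.
have /eqmodP/asboolP : repr (\pi_SL p) = p %[mod SL] by rewrite reprK.
exact.
Qed.

Lemma SLP (x y : SL) :
  (forall (A : algType k) (a : 'M[A]_n), SL_rel a ->
     SL_eval a x = SL_eval a y) -> x = y.
Proof.
move=> h; rewrite -[x]reprK -[y]reprK; apply/eqmodP/asboolP => A a ra.
exact: h.
Qed.

Definition SL_zero : SL := \pi_SL [::].
Definition SL_add (x y : SL) : SL := \pi_SL (repr x ++ repr y).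
Definition SL_scale (c : k) (x : SL) : SL :=
  \pi_SL [seq (c * t.1, t.2) | t <- repr x].
Definition SL_one : SL := \pi_SL [:: (1, [::])].
Definition SL_mul (x y : SL) : SL :=
  \pi_SL [seq (t.1 * u.1, t.2 ++ u.2) | t <- repr x, u <- repr y].
Definition SL_gen (i j : 'I_n) : SL := \pi_SL [:: (1, [:: (i, j)])].

Section Eval.
Variables (A : algType k) (a : 'M[A]_n).
Hypothesis ra : SL_rel a.

Lemma SL_eval0 : SL_eval a SL_zero = 0.
Proof. by rewrite SL_eval_pi // /nceval big_nil. Qed.

Lemma SL_eval_add x y : SL_eval a (SL_add x y) = SL_eval a x + SL_eval a y.
Proof. by rewrite SL_eval_pi // /nceval big_cat. Qed.

Lemma SL_eval_scale c x : SL_eval a (SL_scale c x) = c *: SL_eval a x.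
Proof.
rewrite SL_eval_pi // /SL_eval /nceval big_map scaler_sumr.
by apply: eq_bigr => t _; rewrite scalerA.
Qed.

Lemma SL_eval1 : SL_eval a SL_one = 1.
Proof. by rewrite SL_eval_pi // /nceval big_seq1 big_nil scale1r. Qed.

Lemma SL_eval_mul x y : SL_eval a (SL_mul x y) = SL_eval a x * SL_eval a y.
Proof.
rewrite SL_eval_pi // /SL_eval /nceval big_allpairs_dep mulr_suml.
apply: eq_bigr => t _; rewrite mulr_sumr; apply: eq_bigr => u _ /=.
by rewrite big_cat -scalerAl -scalerAr scalerA.
Qed.

Lemma SL_eval_gen i j : SL_eval a (SL_gen i j) = a i j.
Proof. by rewrite SL_eval_pi // /nceval big_seq1 big_seq1 scale1r. Qed.

End Eval.

Lemma SL_addA : associative SL_add.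
Proof. by move=> x y z; apply: SLP => A a ra; rewrite !SL_eval_add // addrA. Qed.
Lemma SL_addC : commutative SL_add.
Proof. by move=> x y; apply: SLP => A a ra; rewrite !SL_eval_add // addrC. Qed.
Lemma SL_add0 : left_id SL_zero SL_add.
Proof.
by move=> x; apply: SLP => A a ra; rewrite SL_eval_add // SL_eval0 // add0r.
Qed.
Lemma SL_addN : left_inverse SL_zero (SL_scale (- 1)) SL_add.
Proof.
move=> x; apply: SLP => A a ra.
by rewrite SL_eval_add // SL_eval_scale // SL_eval0 // scaleN1r addNr.
Qed.

HB.instance Definition _ :=
  GRing.isZmodule.Build SL SL_addA SL_addC SL_add0 SL_addN.

Lemma SL_evalD (A : algType k) (a : 'M[A]_n) : SL_rel a ->
  forall x y : SL, SL_eval a (x + y) = SL_eval a x + SL_eval a y.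
Proof. by move=> ra x y; exact: SL_eval_add. Qed.

Lemma SL_mulA : associative SL_mul.
Proof. by move=> x y z; apply: SLP => A a ra; rewrite !SL_eval_mul // mulrA. Qed.
Lemma SL_mul1 : left_id SL_one SL_mul.
Proof.
by move=> x; apply: SLP => A a ra; rewrite SL_eval_mul // SL_eval1 // mul1r.
Qed.
Lemma SL_mulr1 : right_id SL_one SL_mul.
Proof.
by move=> x; apply: SLP => A a ra; rewrite SL_eval_mul // SL_eval1 // mulr1.
Qed.
Lemma SL_mulDl : left_distributive SL_mul +%R.
Proof.
move=> x y z; apply: SLP => A a ra.
by rewrite SL_evalD // !SL_eval_mul // SL_evalD // mulrDl.
Qed.
Lemma SL_mulDr : right_distributive SL_mul +%R.
Proof.
move=> x y z; apply: SLP => A a ra.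
by rewrite SL_evalD // !SL_eval_mul // SL_evalD // mulrDr.
Qed.

(* The identity matrix satisfies the relations, so SL(E) is not zero. *)
Lemma SL_rel_id : SL_rel (1%:M : 'M[k^o]_n).
Proof.
have h (i j : N.-tuple 'I_n) :
    \prod_(l < N) (1%:M : 'M[k^o]_n) (tnth j l) (tnth i l) = (j == i)%:R.
  have [->|neq] := eqVneq j i.
    by rewrite big1 // => l _; rewrite mxE eqxx.
  have [l hl] : exists l, tnth j l != tnth i l.
    apply/existsP; apply: contraNT neq; rewrite negb_exists => /forallP e.
    by apply/eqP/eq_from_tnth => l; apply/eqP; have := e l; rewrite negbK.
  by rewrite (bigD1 l) //= mxE (negPf hl) mul0r.
split=> i; rewrite (bigD1 i) //= h eqxx big1 ?addr0 // => j neq; rewrite h.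
- by rewrite (negPf neq) scaler0.
- by rewrite eq_sym (negPf neq) scaler0.
Qed.

Lemma SL_one_neq0 : SL_one != 0 :> SL.
Proof.
apply/eqP => /(congr1 (SL_eval (1%:M : 'M[k^o]_n))).
rewrite SL_eval1; last exact: SL_rel_id.
rewrite [RHS]SL_eval0; last exact: SL_rel_id.
by move/eqP; rewrite oner_eq0.
Qed.

HB.instance Definition _ := GRing.Zmodule_isNzRing.Build SL
  SL_mulA SL_mul1 SL_mulr1 SL_mulDl SL_mulDr SL_one_neq0.

Lemma SL_scaleA c d x : SL_scale c (SL_scale d x) = SL_scale (c * d) x.
Proof. by apply: SLP => A a ra; rewrite !SL_eval_scale // scalerA. Qed.
Lemma SL_scale1 : left_id 1 SL_scale.
Proof. by move=> x; apply: SLP => A a ra; rewrite SL_eval_scale // scale1r. Qed.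
Lemma SL_scaleDr : right_distributive SL_scale +%R.
Proof.
move=> c x y; apply: SLP => A a ra.
by rewrite SL_eval_scale // !SL_evalD // !SL_eval_scale // scalerDr.
Qed.
Lemma SL_scaleDl x : {morph SL_scale^~ x : c d / c + d}.
Proof.
move=> c d; apply: SLP => A a ra.
by rewrite SL_evalD // !SL_eval_scale // scalerDl.
Qed.

HB.instance Definition _ :=
  GRing.Zmodule_isLmodule.Build k SL SL_scaleA SL_scale1 SL_scaleDr SL_scaleDl.

Lemma SL_scaleAl (c : k) (x y : SL) : c *: (x * y) = (c *: x) * y.
Proof.
apply: SLP => A a ra.
by rewrite SL_eval_scale // !SL_eval_mul // SL_eval_scale // scalerAl.
Qed.
Lemma SL_scaleAr (c : k) (x y : SL) : c *: (x * y) = x * (c *: y).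
Proof.
apply: SLP => A a ra.
by rewrite SL_eval_scale // !SL_eval_mul // SL_eval_scale // scalerAr.
Qed.

HB.instance Definition _ := GRing.Lmodule_isLalgebra.Build k SL SL_scaleAl.
HB.instance Definition _ := GRing.Lalgebra_isAlgebra.Build k SL SL_scaleAr.

Definition SL_mx : 'M[SL]_n := \matrix_(i, j) SL_gen i j.

Section EvalMorphism.
Variables (A : algType k) (a : 'M[A]_n) (ra : SL_rel a).

Definition SL_ext of SL_rel a := SL_eval a : SL -> A.

Lemma SL_ext_linear : linear (SL_ext ra).
Proof. by move=> c x y; rewrite /SL_ext SL_evalD // SL_eval_scale. Qed.
Lemma SL_ext_monoid : monoid_morphism (SL_ext ra).
Proof. by split=> [|x y]; [exact: SL_eval1 | exact: SL_eval_mul]. Qed.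

HB.instance Definition _ :=
  GRing.isLinear.Build k SL A *:%R (SL_ext ra) SL_ext_linear.
HB.instance Definition _ :=
  GRing.isMonoidMorphism.Build SL A (SL_ext ra) SL_ext_monoid.

End EvalMorphism.

Lemma SL_gen_rel : SL_rel SL_mx.
Proof.
split=> i; apply: SLP => A a ra; rewrite -!/(SL_ext ra _) raddf_sum linearZ;
  rewrite rmorph1 /=; [rewrite -[RHS](ra.1 i) | rewrite -[RHS](ra.2 i)];
  apply: eq_bigr => j _; rewrite linearZ rmorph_prod; congr (_ *: _);
  by apply: eq_bigr => l _; rewrite mxE; exact: SL_eval_gen.
Qed.

Lemma SL_span (p : ncpoly) : \pi_SL p = nceval SL_mx p.
Proof.
apply: SLP => A a ra; rewrite SL_eval_pi // -/(SL_ext ra _) /nceval raddf_sum.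
apply: eq_bigr => t _; rewrite /= linearZ rmorph_prod; congr (_ *: _).
by apply: eq_bigr => g _; rewrite mxE; symmetry; exact: SL_eval_gen.
Qed.

Lemma SL_universal (A : algType k) (a : 'M[A]_n) : SL_rel a ->
  (exists f : {lrmorphism SL -> A}, forall i j, f (SL_mx i j) = a i j) /\
  (forall f g : {lrmorphism SL -> A},
     (forall i j, f (SL_mx i j) = g (SL_mx i j)) -> f =1 g).
Proof.
move=> ra; split.
  exists (SL_ext ra : {lrmorphism SL -> A}) => i j.
  by rewrite mxE; exact: SL_eval_gen.
move=> f g fg x; rewrite -[x]reprK SL_span /nceval !raddf_sum.
apply: eq_bigr => t _; rewrite /= !linearZ !rmorph_prod; congr (_ *: _).
by apply: eq_bigr => l _; exact: fg.
Qed.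

(* x lies in the subfield generated by the coefficients of E; divring_closed
   sets are exactly the subfields of k since k is a field. *)
Definition in_coef_field (x : k) : Prop :=
  forall S : {pred k}, divring_closed S -> (forall j, E j \in S) -> x \in S.

Definition coef_field_orderable : Prop :=
  exists (F : realFieldType) (iota : {rmorphism F -> k}),
    forall x, (exists y, iota y = x) <-> in_coef_field x.

Definition SL_hopf (H : hopfAlgebra SL) : Prop :=
  multiplicative_matrix H SL_mx.

End SL.

Arguments SL_mx {k n N} E.

(* Main.v *)
(* The relations say that E is an invariant form, and contracting them with a
   dual family of E produces explicit inverses of the generic matrix a and of
   its transpose.  The inverse matrices satisfy the relations in the opposite
   algebra, which gives the antipode and its inverse; when E is cyclic up to
   beta the two explicit formulas differ by conjugation by diag(beta).

   The relations are exchanged by a |-> a^T.  Hence, for the comodule with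
   matrix u made of direct sums of tensor powers of a, the algebra B of the
   matrices f(u), f a linear functional, is stable under transposition.  If E
   has coefficients in an ordered field F, then B is spanned by matrices over F,
   on which tr(x y^T) is positive definite; dual bases for this form give a
   separability idempotent of B, and Maschke averaging splits every
   subcoalgebra off the coefficients of u.

   Over the complex numbers x |-> S(conj(x^T)) is the involution.  A comodule
   with matrix v whose coefficients are among those of u is made unitary by the
   form sum_s f_s(v)^* f_s(v), where the f_s(u) are an orthonormal basis of B. *)

From HB Require Import structures.
Require Import Defs.
From mathcomp Require Import all_boot all_order all_algebra complex reals.
From mathcomp Require Import boolp classical_sets generic_quotient.

Set Implicit Arguments.
Unset Strict Implicit.
Unset Printing Implicit Defensive.

Import Order.TTheory GRing.Theory Num.Theory.
Local Open Scope ring_scope.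

(** * Linear functionals *)

(** Tensors are classes of formal sums, without coordinates, so linear functionals carry the
    coalgebra arguments: they separate tensors, and a subcoalgebra is a subspace stable under the
    two commuting actions of the dual algebra. [SL E] may be infinite-dimensional, so complements
    come from Zorn's lemma.

    The obstacle to cosemisimplicity is that tr(x y^T) is positive over F only, while k (the complex
    numbers, say) need not be orderable. Descent to F works because each entry of a tensorial
    comodule u is 0 or a product of generators, without scalars: a ring morphism known on the
    generators is known on u, even if it is only semilinear. In particular a |-> 1 (x) a extends to
    SL(E) -> k (x)_F SL(E), and composing it with k-linear extensions of F-linear functionals makes
    B stable under every F-linear map k -> F applied entrywise. This is why B is spanned by its
    matrices over F.

    The Casimir element of a pair of dual bases of B need not be 1; positivity serves a second time
    to invert it, and its inverse normalises the separability idempotent. *)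

Section MkLinear.
Variables (k : fieldType) (U V : lmodType k) (f : U -> V) (hf : linear f).
(** The proof argument keys the linear structure, so that any function proved linear can be packed
    as a [{linear _ -> _}]. *)
Definition mk_linear of linear f := f.
HB.instance Definition _ := GRing.isLinear.Build k U V *:%R (mk_linear hf) hf.
End MkLinear.

Section Projection.
Variables (k : fieldType) (A : lmodType k).

(** A subspace M maximal among those containing Q and meeting P only in 0 is a complement of P; p is
    the projection onto P along M. *)
Lemma ex_projection (P Q : {pred A}) : submod_closed P -> submod_closed Q ->
  (forall x, x \in P -> x \in Q -> x = 0) ->
  exists p : {linear A -> A},
    [/\ forall x, p x \in P, {in P, p =1 id} & {in Q, forall x, p x = 0}].
Proof.
move=> [P0 Pl] [Q0 Ql] PQ.
pose good (S : set A) := [/\ S 0, forall a x y, S x -> S y -> S (a *: x + y),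
  forall x, x \in Q -> S x & forall x, x \in P -> S x -> x = 0].
(* The empty chain has union [set0], which is not a subspace; hence the extra disjunct. *)
have [|M [Mgood Mmax]] := @Zorn_bigcup A (fun S => S = set0 \/ good S).
  move=> F Fgood Ftot.
  have [[X [FX gX]]|nogood] := pselect (exists X, F X /\ good X); last first.
    left; apply/seteqP; split=> // x [X FX Xx].
    have [X0|gX] := Fgood X FX; first by rewrite X0 in Xx.
    by case: nogood; exists X.
  have gF Y y : F Y -> Y y -> good Y.
    by move=> FY Yy; case: (Fgood Y FY) => // Y0; rewrite Y0 in Yy.
  right; split.
  - by exists X => //; case: gX.
  - move=> a x y [Y FY Yx] [Z FZ Zy].
    have [YZ|ZY] := Ftot Y Z FY FZ.
      by exists Z => //; case: (gF Z y FZ Zy) => _ lZ _ _; apply: lZ => //; exact: YZ.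
    by exists Y => //; case: (gF Y x FY Yx) => _ lY _ _; apply: lY => //; exact: ZY.
  - by move=> x Qx; exists X => //; case: gX => _ _ h _; exact: h.
  - move=> x Px [Y FY Yx]; case: (gF Y x FY Yx) => _ _ _ h; exact: h.
have {Mgood} [M0 Ml MQ MP] : good M.
  case: Mgood => // M0; case: (Mmax (fun x => x \in Q)); last first.
    by right; split=> // x Px /= Qx; exact: PQ.
  split=> [x|/(_ 0)]; first by rewrite M0.
  by rewrite M0 => h; apply: h.
have MB x y : M x -> M y -> M (x - y).
  by move=> Mx My; rewrite addrC -scaleN1r; apply: Ml.
(* If x were outside P + M, then kx + M would still meet P trivially, against maximality: a vector c
   x + m of P with c != 0 puts x in P + M. *)
have dec x : exists a, a \in P /\ M (x - a).
  have [Mx|nMx] := pselect (M x); first by exists 0; rewrite subr0.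
  pose M' : set A := fun y => exists c m, M m /\ y = c *: x + m.
  have : ~ (M' = set0 \/ good M').
    apply: Mmax; split=> [m Mm|].
      by exists 0, m; rewrite scale0r add0r.
    move=> h; apply: nMx; apply: h; exists 1, 0; split => //.
    by rewrite scale1r addr0.
  have M'M m : M m -> M' m by exists 0, m; rewrite scale0r add0r.
  move=> h; apply: contrapT => nP; apply: h; right; split.
  - exact: M'M.
  - move=> a _ _ [c [m [Mm ->]]] [d [n [Mn ->]]].
    exists (a * c + d), (a *: m + n); split; first exact: Ml.
    by rewrite scalerDr scalerA scalerDl -!addrA; congr (_ + _); rewrite addrCA.
  - by move=> y Qy; apply: M'M; exact: MQ.
  - move=> y Py [c [m [Mm yE]]].
    have [c0|c0] := eqVneq c 0.
      by apply: MP => //; rewrite yE c0 scale0r add0r.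
    case: nP; exists (c^-1 *: y); split.
      by rewrite -[_ *: y]addr0; apply: Pl.
    rewrite yE scalerDr scalerA mulVf // scale1r opprD addrA subrr add0r.
    by rewrite -scaleNr -[_ *: m]addr0; apply: Ml.
have uniqP x a b : a \in P -> M (x - a) -> b \in P -> M (x - b) -> a = b.
  move=> Pa Ma Pb Mb; apply/eqP; rewrite -subr_eq0; apply/eqP; apply: MP.
    by rewrite addrC -scaleN1r; apply: Pl.
  have -> : a - b = (x - b) - (x - a) by rewrite opprB [RHS]addrC addrA addrNK.
  exact: MB.
have [p pE] := boolp.choice dec.
have plin : linear p.
  move=> c x y; have [Px Mx] := pE x; have [Py My] := pE y.
  have [Pxy Mxy] := pE (c *: x + y); apply: (uniqP (c *: x + y)) => //.
    exact: Pl.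
  have -> : c *: x + y - (c *: p x + p y) = c *: (x - p x) + (y - p y).
    by rewrite scalerBr opprD addrACA.
  exact: Ml.
exists (mk_linear plin : {linear A -> A}); split=> x; rewrite /mk_linear.
- by case: (pE x).
- move=> Px; have [Ppx Mpx] := pE x; apply: (uniqP x) => //.
  by rewrite subrr.
- move=> Qx; have [Ppx Mpx] := pE x; apply: (uniqP x) => //.
  by rewrite subr0; exact: MQ.
Qed.

Lemma submod_closed0 : submod_closed (pred1 (0 : A)).
Proof.
by split=> [|c u v]; rewrite !inE // => /eqP-> /eqP->; rewrite scaler0 addr0.
Qed.

Definition line (x : A) : {pred A} := [pred y | `[< exists c, y = c *: x >]].

Lemma line_submod x : submod_closed (line x).
Proof.
split; first by apply/asboolP; exists 0; rewrite scale0r.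
move=> a _ _ /asboolP[c ->] /asboolP[d ->]; apply/asboolP.
by exists (a * c + d); rewrite scalerA scalerDl.
Qed.

(** Project onto the line through x along a complement containing D, and read off the coordinate. *)
Lemma ex_functional (D : {pred A}) (x : A) : submod_closed D -> x \notin D ->
  exists f : {linear A -> k^o}, f x = 1 /\ {in D, forall y, f y = 0}.
Proof.
move=> Dsub Dx.
have x0 : x != 0 by apply: contraNneq Dx => ->; case: Dsub.
have [|p [pP pid pD]] := ex_projection (line_submod x) Dsub.
  move=> _ /asboolP[c ->] Dcx; have [->|c0] := eqVneq c 0; first by rewrite scale0r.
  case/negP: Dx; case: Dsub => D0 Dl; have := Dl c^-1 (c *: x) 0 Dcx D0.
  by rewrite addr0 scalerA mulVf // scale1r.
have [f fE] := boolp.choice (fun y => asboolW (pP y)).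
have inj c d : c *: x = d *: x -> c = d.
  move/eqP; rewrite -subr_eq0 -scalerBl scaler_eq0 (negPf x0) orbF subr_eq0.
  by move/eqP.
have flin : linear (f : A -> k^o).
  move=> c y z; apply: inj; rewrite -fE linearP !fE /= scalerDl.
  by rewrite scalerA.
exists (mk_linear flin : {linear A -> k^o}); rewrite /mk_linear; split.
  apply: inj; rewrite -fE scale1r pid //.
  by apply/asboolP; exists 1; rewrite scale1r.
by move=> y Dy; apply: inj; rewrite -fE scale0r pD.
Qed.

Lemma ex_functional1 (x : A) : x != 0 -> exists f : {linear A -> k^o}, f x = 1.
Proof. by move=> /(ex_functional submod_closed0)[f [f1 _]]; exists f. Qed.

Lemma ex_retraction (D : {pred A}) : submod_closed D ->
  exists p : {linear A -> A}, (forall x, p x \in D) /\ {in D, p =1 id}.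
Proof.
move=> Dsub; have [|p [pD pid _]] := ex_projection Dsub submod_closed0.
  by move=> x _; rewrite inE => /eqP.
by exists p.
Qed.

Lemma functional_inj (x y : A) :
  (forall f : {linear A -> k^o}, f x = f y) -> x = y.
Proof.
move=> h; apply/eqP; rewrite -subr_eq0; apply: contraT => xy0.
have [f f1] := ex_functional1 xy0.
by have := oner_neq0 k; rewrite -f1 linearB /= h subrr eqxx.
Qed.

End Projection.

(** * Tensor products *)

Section TensorFacts.
Variables (k : fieldType) (A B : lmodType k).

Lemma bilinI (W : lmodType k) (f : A -> B -> W) :
  (forall y, linear (f^~ y)) -> (forall x, linear (f x)) -> bilin f.
Proof.
by move=> hl hr; split=> [y c x x'|x c y y'] /=; [exact: hl|exact: hr].
Qed.

Lemma tliftZ (W : lmodType k) (f : A -> B -> W) c (t : tens A B) :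
  bilin f -> tlift f (c *: t) = c *: tlift f t.
Proof. by move=> bf; exact: tlift_scale. Qed.

Lemma tlift_bigsum (W : lmodType k) (f : A -> B -> W) (I : Type) (r : seq I)
    (P : pred I) (g : I -> tens A B) : bilin f ->
  tlift f (\sum_(i <- r | P i) g i) = \sum_(i <- r | P i) tlift f (g i).
Proof.
move=> bf; elim/big_rec2: _ => [|i x y _ <-]; first by rewrite [LHS]tlift_nil.
by rewrite tliftD.
Qed.

Lemma tlift_comp (W W' : lmodType k) (f : A -> B -> W) (g : {linear W -> W'}) t :
  g (tlift f t) = tlift (fun x y => g (f x y)) t.
Proof. exact: linear_sum. Qed.

Lemma eq_tlift (W : lmodType k) (f g : A -> B -> W) t :
  f =2 g -> tlift f t = tlift g t.
Proof. by move=> fg; apply: eq_bigr => p _; exact: fg. Qed.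

Lemma bilin_scal (f : {linear A -> k^o}) : bilin (fun x (y : B) => f x *: y).
Proof.
apply: bilinI => [y|x] c u v /=; first by rewrite linearP scalerDl scalerA.
by rewrite scalerDr !scalerA mulrC.
Qed.

Lemma bilin_scalr (f : {linear B -> k^o}) : bilin (fun (x : A) y => f y *: x).
Proof.
apply: bilinI => [y|x] c u v /=; last by rewrite linearP scalerDl scalerA.
by rewrite scalerDr !scalerA mulrC.
Qed.

Lemma tpure0l (y : B) : (0 : A) ⊗ y = 0.
Proof. exact: (bilin0l (tpure_bilin A B)). Qed.

Lemma tpure0r (x : A) : x ⊗ (0 : B) = 0.
Proof. exact: (bilin0r (tpure_bilin A B)). Qed.

Lemma tpureZl c (x : A) (y : B) : (c *: x) ⊗ y = c *: (x ⊗ y).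
Proof. exact: (bilinZl (tpure_bilin A B)). Qed.

Lemma tpureZr c (x : A) (y : B) : x ⊗ (c *: y) = c *: (x ⊗ y).
Proof. exact: (bilinZr (tpure_bilin A B)). Qed.

Lemma tpureDl (x x' : A) (y : B) : (x + x') ⊗ y = x ⊗ y + x' ⊗ y.
Proof. exact: (bilinDl (tpure_bilin A B)). Qed.

Lemma tpureDr (x : A) (y y' : B) : x ⊗ (y + y') = x ⊗ y + x ⊗ y'.
Proof. exact: (bilinDr (tpure_bilin A B)). Qed.

Lemma tpure_suml (I : finType) (F : I -> A) (y : B) :
  (\sum_i F i) ⊗ y = \sum_i F i ⊗ y.
Proof.
elim/big_rec2: _ => [|i u v _ <-]; first exact: tpure0l.
exact: tpureDl.
Qed.

Lemma tpure_sumr (I : finType) (x : A) (F : I -> B) :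
  x ⊗ (\sum_i F i) = \sum_i x ⊗ F i.
Proof.
elim/big_rec2: _ => [|i u v _ <-]; first exact: tpure0r.
exact: tpureDr.
Qed.

(** Functionals on the first factor alone separate tensors; the induction is on the length of a
    formal sum representing s - t. *)
Lemma tens_inj (s t : tens A B) :
  (forall f : {linear A -> k^o}, tlift (fun x y => f x *: y) s =
                                 tlift (fun x y => f x *: y) t) -> s = t.
Proof.
suff h (r : seq (A * B)) : (forall f : {linear A -> k^o},
      \sum_(p <- r) f p.1 *: p.2 = 0) -> \sum_(p <- r) p.1 ⊗ p.2 = 0.
  move=> st; apply/eqP; rewrite -subr_eq0; apply/eqP.
  rewrite [s - t]tens_sum; apply: h => f; rewrite -/(tlift (fun x y => f x *: y) (s - t)).
  rewrite tliftD; last exact: bilin_scal.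
  by rewrite -scaleN1r tliftZ ?st ?scaleN1r ?subrr //; exact: bilin_scal.
have [m] := ubnP (size r); elim: m r => // m ih [|[a b] r] /=.
  by rewrite big_nil.
rewrite ltnS => rm hr; have [a0|a0] := eqVneq a 0.
  rewrite big_cons /= a0 tpure0l add0r; apply: ih => // f.
  by have := hr f; rewrite big_cons /= a0 linear0 scale0r add0r.
have [f f1] := ex_functional1 a0.
have bE : b = - \sum_(p <- r) f p.1 *: p.2.
  by have := hr f; rewrite big_cons /= f1 scale1r => /addr0_eq <-; rewrite opprK.
(* The hypothesis at f expresses b through the tail; substituting it absorbs the head a (x) b into
   the tail, which leaves a shorter sum. *)
pose r' := [seq (p.1 - f p.1 *: a, p.2) | p <- r].
have := ih r'; rewrite size_map => /(_ rm); rewrite !big_map /= => ihr.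
rewrite big_cons /= bE -scaleN1r tpureZr.
have -> : a ⊗ (\sum_(p <- r) f p.1 *: p.2) = \sum_(p <- r) (f p.1 : k) *: (a ⊗ p.2).
  elim: (r) => [|p l il]; first by rewrite !big_nil tpure0r.
  by rewrite !big_cons tpureDr il tpureZr.
rewrite scaler_sumr -big_split /= -[RHS]ihr => [|g].
  by apply: eq_bigr => p _; rewrite tpureDl -scaleN1r !tpureZl addrC.
have := hr g; rewrite big_map big_cons /= bE => hg; rewrite -[RHS]hg.
rewrite scalerN scaler_sumr addrC -sumrN -big_split; apply: eq_bigr => p _ /=.
by rewrite linearB linearZ /= scalerBl scalerA mulrC.
Qed.

End TensorFacts.

Section TensorLift.
Variables (k : fieldType) (A B : lmodType k).

Lemma tlift_mull (W : algType k) (w : W) (f : A -> B -> W) t :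
  w * tlift f t = tlift (fun x y => w * f x y) t.
Proof. exact: mulr_sumr. Qed.

Lemma tlift_sumf (W : lmodType k) (I : finType) (f : I -> A -> B -> W) t :
  \sum_i tlift (f i) t = tlift (fun x y => \sum_i f i x y) t.
Proof. exact: exchange_big. Qed.

End TensorLift.

Lemma bilin_comp (k : fieldType) (A A' B B' W : lmodType k) (f : A' -> B' -> W)
    (g : {linear A -> A'}) (h : {linear B -> B'}) :
  bilin f -> bilin (fun x y => f (g x) (h y)).
Proof.
move=> bf; apply: bilinI => [y|x] c u v /=; rewrite linearP.
- by rewrite bilinDl // bilinZl.
- by rewrite bilinDr // bilinZr.
Qed.

Section TensorAlg.
Variables (k : fieldType) (A B : algType k).

(** An [algType] is a nonzero ring, so this is what lets the tensor square be the target of the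
    universal property of [SL E]. *)
Lemma tens_one_neq0 : (1 : tens A B) != 0.
Proof.
have [f f1] := ex_functional1 (oner_neq0 A).
apply/eqP => /(congr1 (tlift (fun x (y : B) => f x *: y))).
rewrite tlift_pure ?f1; last exact: bilin_scal.
rewrite [RHS]tlift_nil ?scale1r; last exact: bilin_scal.
by move/eqP; rewrite oner_eq0.
Qed.

HB.instance Definition _ :=
  GRing.PzSemiRing_isNonZero.Build (tens A B) tens_one_neq0.

Lemma tens_scaleAl (c : k) (s t : tens A B) : c *: (s * t) = (c *: s) * t.
Proof.
apply: tensP => W f bf; rewrite tliftZ // !tlift_mul // tliftZ //.
exact: mul_bilinl.
Qed.

HB.instance Definition _ :=
  GRing.Lmodule_isLalgebra.Build k (tens A B) tens_scaleAl.

Lemma tens_scaleAr (c : k) (s t : tens A B) : c *: (s * t) = s * (c *: t).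
Proof.
apply: tensP => W f bf; rewrite tliftZ // !tlift_mul //.
rewrite [LHS]scaler_sumr; apply: eq_bigr => p _.
by rewrite tliftZ //; exact: mul_bilinr.
Qed.

HB.instance Definition _ :=
  GRing.Lalgebra_isAlgebra.Build k (tens A B) tens_scaleAr.

Lemma tlift_pureM (W : lmodType k) (f : A -> B -> W) a b t : bilin f ->
  tlift f (a ⊗ b * t) = tlift (fun x y => f (a * x) (b * y)) t.
Proof.
by move=> bf; rewrite tlift_mul // (tlift_pure (mul_bilinl t bf)).
Qed.

Lemma tpureX_prod (I : Type) (r : seq I) (F : I -> A) (G : I -> B) :
  \prod_(i <- r) (F i ⊗ G i) = (\prod_(i <- r) F i) ⊗ (\prod_(i <- r) G i).
Proof.
elim: r => [|i r ih]; first by rewrite !big_nil.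
by rewrite !big_cons ih tpureM.
Qed.

End TensorAlg.

(** * Opposite algebras and restriction of scalars *)

Section Converse.
Variables (k : fieldType) (A : algType k).

(** With the opposite ring made a k-algebra, the universal property of [SL E] also produces
    antimorphisms, such as the antipode. *)
HB.instance Definition _ := GRing.Lmodule.copy A^c A.

Let cmul (x y : A^c) : A^c := x * y.

Lemma converse_scaleAl (c : k) (x y : A^c) : c *: cmul x y = cmul (c *: x) y.
Proof. exact: (@scalerAr _ A c y x). Qed.
Lemma converse_scaleAr (c : k) (x y : A^c) : c *: cmul x y = cmul x (c *: y).
Proof. exact: (@scalerAl _ A c y x). Qed.

HB.instance Definition _ := GRing.Lmodule_isLalgebra.Build k A^c converse_scaleAl.
HB.instance Definition _ := GRing.Lalgebra_isAlgebra.Build k A^c converse_scaleAr.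

End Converse.

(* T with scalars restricted along iota; when iota is the complex conjugation,
   the linear maps into [restr iota A] are the antilinear maps into A. *)
Definition restr (F k : fieldType) (iota : {rmorphism F -> k}) (T : Type) := T.

Section Restriction.
Variables (F k : fieldType) (iota : {rmorphism F -> k}).

HB.instance Definition _ (A : lmodType k) :=
  GRing.Zmodule.copy (restr iota A) A.
HB.instance Definition _ (A : algType k) :=
  GRing.NzRing.copy (restr iota A) A.

Section Lmod.
Variable A : lmodType k.
Definition restr_scale (c : F) (x : restr iota A) : restr iota A :=
  iota c *: (x : A).
Lemma restr_scaleA a b v :
  restr_scale a (restr_scale b v) = restr_scale (a * b) v.
Proof. by rewrite /restr_scale scalerA rmorphM. Qed.
Lemma restr_scale1 : left_id 1 restr_scale.
Proof. by move=> x; rewrite /restr_scale rmorph1 scale1r. Qed.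
Lemma restr_scaleDr : right_distributive restr_scale +%R.
Proof. by move=> c x y; rewrite /restr_scale scalerDr. Qed.
Lemma restr_scaleDl v : {morph restr_scale^~ v : a b / a + b}.
Proof. by move=> a b; rewrite /restr_scale rmorphD scalerDl. Qed.
HB.instance Definition _ := GRing.Zmodule_isLmodule.Build F (restr iota A)
  restr_scaleA restr_scale1 restr_scaleDr restr_scaleDl.
Lemma restrE c (x : restr iota A) : c *: x = (iota c *: (x : A)) :> A.
Proof. by []. Qed.
End Lmod.

Section Alg.
Variable A : algType k.
Lemma restr_scaleAl (c : F) (x y : restr iota A) : c *: (x * y) = (c *: x) * y.
Proof. exact: (@scalerAl _ A (iota c) x y). Qed.
HB.instance Definition _ :=
  GRing.Lmodule_isLalgebra.Build F (restr iota A) restr_scaleAl.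
Lemma restr_scaleAr (c : F) (x y : restr iota A) : c *: (x * y) = x * (c *: y).
Proof. exact: (@scalerAr _ A (iota c) x y). Qed.
HB.instance Definition _ :=
  GRing.Lalgebra_isAlgebra.Build F (restr iota A) restr_scaleAr.
End Alg.
End Restriction.

(** * Actions of functionals on a Hopf algebra *)

Lemma tlift_compf (k : fieldType) (A B W W' : lmodType k) (f : A -> B -> W)
    (g : W -> W') (t : tens A B) : linear g ->
  g (tlift f t) = tlift (fun x y => g (f x y)) t.
Proof. by move=> lg; exact: (tlift_comp f (mk_linear lg)). Qed.

Lemma tassoc_bilin (k : fieldType) (A B C : lmodType k) :
  bilin (fun (t : tens A B) (z : C) => tlift (fun x y => x ⊗ (y ⊗ z)) t).
Proof.
have b1 (z : C) : bilin (fun (x : A) (y : B) => x ⊗ (y ⊗ z)).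
  by apply: bilinI => [y|x] c u v /=;
    rewrite ?(tpureDl, tpureZl, tpureDr, tpureZr).
apply: bilinI => [z|t]; first exact: (tlift_linear (b1 z)).
move=> c x x'; rewrite /tlift scaler_sumr -big_split; apply: eq_bigr => p _ /=.
by rewrite !(tpureDr, tpureZr).
Qed.

Definition trilinear (k : fieldType) (A B C W : lmodType k) (f : A -> B -> C -> W) :=
  [/\ forall y z, linear (fun x => f x y z), forall x z, linear (f x ^~ z) &
      forall x y, linear (f x y)].

Section HopfTheory.
Variables (k : fieldType) (A : algType k) (H : hopfAlgebra A).
Local Notation Delta := (comul H).
Local Notation "A ^*" := {linear A -> k^o} : type_scope.
Implicit Types (f g : A^*) (x y : A).

(** Sweedler form of coassociativity: a trilinear f factors through the triple tensor product, where
    [comulA] applies. *)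
Lemma coassoc (W : lmodType k) (f : A -> A -> A -> W) a : trilinear f ->
  tlift (fun u z => tlift (fun x y => f x y z) (Delta u)) (Delta a) =
  tlift (fun x u => tlift (f x) (Delta u)) (Delta a).
Proof.
move=> [f1 f2 f3].
have b12 z : bilin (fun x y => f x y z) by apply: bilinI => [y|x]; auto.
have b23 x : bilin (f x) by apply: bilinI => [z|y]; [exact: f2|exact: f3].
have bF : bilin (fun x (t : tens A A) => tlift (f x) t).
  apply: bilinI => [t|x]; last exact: (tlift_linear (b23 x)).
  move=> c x x'; rewrite /tlift scaler_sumr -big_split; apply: eq_bigr => p _ /=.
  exact: f1.
have b2 := @tassoc_bilin k A A A.
have lF := tlift_linear bF; have l2 := tlift_linear b2.
have := congr1 (tlift (fun x t => tlift (f x) t)) (comulA H a).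
rewrite /tassoc /tmap (tlift_compf _ _ l2) !(tlift_compf _ _ lF) => e.
transitivity (tlift (fun x y => tlift (fun x (t : tens A A) => tlift (f x) t)
    (tlift (fun u z => tlift (fun x0 y0 : A => x0 ⊗ (y0 ⊗ z)) u)
        (comul H x ⊗ idfun y))) (comul H a)).
  apply: eq_tlift => u z; rewrite (tlift_pure b2) (tlift_compf _ _ lF).
  by apply: eq_tlift => x y; rewrite (tlift_pure bF) (tlift_pure (b23 x)).
rewrite e; apply: eq_tlift => x u; exact: (tlift_pure bF).
Qed.

(** The two actions of the dual algebra, f(x1) x2 and x1 f(x2) in Sweedler notation. For convolution
    [hitr] is a left action and [hitl] a right one. *)
Definition hitl f x : A := tlift (fun y z => f y *: z) (Delta x).
Definition hitr f x : A := tlift (fun y z => f z *: y) (Delta x).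

Lemma hitl_linear f : linear (hitl f).
Proof.
by move=> c x y; rewrite /hitl linearP (tlift_linear (bilin_scal A f)).
Qed.

Lemma hitr_linear f : linear (hitr f).
Proof.
by move=> c x y; rewrite /hitr linearP (tlift_linear (bilin_scalr A f)).
Qed.

HB.instance Definition _ f :=
  GRing.isLinear.Build k A A *:%R (hitl f) (hitl_linear f).
HB.instance Definition _ f :=
  GRing.isLinear.Build k A A *:%R (hitr f) (hitr_linear f).

Lemma mul_bilin (B : algType k) (f g : {linear A -> B}) :
  bilin (fun x y => f x * g y).
Proof.
apply: bilinI => [y|x] c u v /=; rewrite linearP.
- by rewrite mulrDl scalerAl.
- by rewrite mulrDr scalerAr.
Qed.

Lemma conv_linear (B : algType k) (f g : {linear A -> B}) : linear (conv H f g).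
Proof.
by move=> c x y; rewrite /conv linearP (tlift_linear (mul_bilin f g)).
Qed.

HB.instance Definition _ (B : algType k) (f g : {linear A -> B}) :=
  GRing.isLinear.Build k A B *:%R (conv H f g) (conv_linear f g).

Lemma conv_hitr f g x : conv H f g x = f (hitr g x).
Proof.
rewrite /hitr tlift_comp; apply: eq_tlift => y z.
by rewrite linearZ /= mulrC.
Qed.

Lemma conv_hitl f g x : conv H f g x = g (hitl f x).
Proof. by rewrite /hitl tlift_comp; apply: eq_tlift => y z; rewrite linearZ. Qed.

Lemma convA (B : algType k) (f g h : {linear A -> B}) x :
  conv H (conv H f g) h x = conv H f (conv H g h) x.
Proof.
pose F (x y z : A) := f x * g y * h z.
transitivity (tlift (fun u z => tlift (fun x y => F x y z) (Delta u)) (Delta x)).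
  by apply: eq_tlift => u z; rewrite [LHS]mulr_suml.
rewrite coassoc.
  apply: eq_tlift => y u; rewrite [RHS]mulr_sumr.
  by apply: eq_bigr => p _; rewrite /F mulrA.
by split=> [y z|y z|y z] c u v; rewrite /F linearP ?mulrDl ?mulrDr ?mulrDl
  -?scalerAr -?scalerAl.
Qed.

Lemma hitr_hitr f g x : hitr f (hitr g x) = hitr (conv H f g) x.
Proof.
pose F (x y z : A) := (f y * g z : k) *: x.
transitivity (tlift (fun u z => tlift (fun x y => F x y z) (Delta u)) (Delta x)).
  rewrite {2}/hitr tlift_comp; apply: eq_tlift => u z.
  rewrite linearZ /hitr /= [LHS]scaler_sumr; apply: eq_bigr => p _.
  by rewrite scalerA mulrC.
rewrite coassoc.
  by apply: eq_tlift => y u; rewrite [RHS]scaler_suml.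
split=> [y z|y z|y z] c u v; rewrite /F ?linearP /=.
- by [].
- by rewrite mulrDl scalerDl scalerA mulrA.
- by rewrite mulrDr scalerDl scalerA mulrCA.
Qed.

Lemma hitl_hitl f g x : hitl f (hitl g x) = hitl (conv H g f) x.
Proof.
pose F (x y z : A) := (g x * f y : k) *: z.
transitivity (tlift (fun x u => tlift (fun y z => F x y z) (Delta u)) (Delta x)).
  rewrite {2}/hitl tlift_comp; apply: eq_tlift => u z.
  rewrite linearZ /hitl /= [LHS]scaler_sumr; apply: eq_bigr => p _.
  by rewrite scalerA.
rewrite -coassoc.
  by apply: eq_tlift => y u; rewrite [RHS]scaler_suml.
split=> [y z|y z|y z] c u v; rewrite /F ?linearP /=.
- by rewrite mulrDl scalerDl scalerA mulrA.
- by rewrite mulrDr scalerDl scalerA mulrCA.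
- by [].
Qed.

Lemma hitl_hitr f g x : hitl f (hitr g x) = hitr g (hitl f x).
Proof.
pose F (x y z : A) := (f x * g z : k) *: y.
transitivity (tlift (fun u z => tlift (fun x y => F x y z) (Delta u)) (Delta x)).
  rewrite /hitr tlift_comp; apply: eq_tlift => u z.
  rewrite linearZ /hitl /= [LHS]scaler_sumr; apply: eq_bigr => p _.
  by rewrite scalerA mulrC.
rewrite coassoc.
  rewrite /hitl tlift_comp; apply: eq_tlift => u z.
  rewrite linearZ /hitr /= [RHS]scaler_sumr; apply: eq_bigr => p _.
  by rewrite scalerA.
split=> [y z|y z|y z] c u v; rewrite /F ?linearP /=.
- by rewrite mulrDl scalerDl scalerA mulrA.
- by [].
- by rewrite mulrDr scalerDl scalerA mulrCA.
Qed.

Lemma hitr_counit x : hitr (counit H) x = x.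
Proof. exact: comul_counitr. Qed.

Lemma hitl_counit x : hitl (counit H) x = x.
Proof. exact: comul_counitl. Qed.

Section SubCoalg.
Variable D : {pred A}.
Hypothesis Dsub : submod_closed D.

Lemma submod_sum (I : Type) (r : seq I) (P : pred I) (F : I -> A) :
  (forall i, P i -> F i \in D) -> \sum_(i <- r | P i) F i \in D.
Proof.
move=> h; elim/big_rec: _ => [|i x Pi Dx]; first by case: Dsub.
by rewrite -[F i]scale1r; case: Dsub => _; apply => //; exact: h.
Qed.

Lemma submodZ c x : x \in D -> c *: x \in D.
Proof. by move=> Dx; rewrite -[_ *: x]addr0; case: Dsub => D0; apply. Qed.

Lemma submodD x y : x \in D -> y \in D -> x + y \in D.
Proof. by move=> Dx Dy; rewrite -[x]scale1r; case: Dsub => D0; apply. Qed.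

Lemma submodB x y : x \in D -> y \in D -> x - y \in D.
Proof. by move=> Dx Dy; rewrite -scaleN1r; apply: submodD => //; exact: submodZ. Qed.

(** For the converse, take a linear retraction p onto D: stability under both actions gives Delta x
    = (p (x) p)(Delta x), a formal sum with all its terms in D. *)
Lemma subcoalgebraP : subcoalgebra H D <->
  (forall f x, x \in D -> hitl f x \in D /\ hitr f x \in D).
Proof.
split=> [[_ h] f x Dx|h].
  have [s /allP sD] := h x Dx; rewrite /hitl /hitr => ->.
  split; (rewrite tlift_bigsum; last by [exact: bilin_scal|exact: bilin_scalr]);
    rewrite big_seq; apply: submod_sum => p /sD /andP[D1 D2];
    (rewrite tlift_pure; last by [exact: bilin_scal|exact: bilin_scalr]); exact: submodZ.
split=> // x Dx.
have [p [pD pid]] := ex_retraction Dsub.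
exists [seq (p q.1, p q.2) | q <- repr (Delta x)].
  by rewrite all_map; apply/allP => q _ /=; rewrite !pD.
rewrite big_map /=.
have bp := tpure_bilin A A.
have b1 := bilin_comp (idfun : {linear A -> A}) p bp.
have E1 : Delta x = tlift (fun y z => y ⊗ p z) (Delta x).
  apply: tens_inj => f; rewrite (tlift_compf _ _ (tlift_linear (bilin_scal A f))).
  rewrite -/(hitl f x) -[LHS]pid; last by case: (h f x Dx).
  rewrite /hitl tlift_comp; apply: eq_tlift => y z.
  by rewrite (tlift_pure (bilin_scal A f)) linearZ.
rewrite {1}E1 -/(tlift (fun y z => p y ⊗ p z) _).
apply: tens_inj => f; rewrite !(tlift_compf _ _ (tlift_linear (bilin_scal A f))).
pose fp : A^* := f \o p.
(* Testing against g exchanges the actions: g(hitl f x) = f(hitr g x), and hitr g x lies in D, where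
   p is the identity. *)
have E2 : hitl f x = hitl fp x.
  apply: functional_inj => g; rewrite -!conv_hitl !conv_hitr /fp /=.
  by rewrite pid //; case: (h g x Dx).
transitivity (p (hitl f x)); last rewrite E2; rewrite /hitl tlift_comp;
  by apply: eq_tlift => y z; rewrite (tlift_pure (bilin_scal A f)) linearZ.
Qed.

End SubCoalg.

Lemma comul_decomp (D : {pred A}) : subcoalgebra H D -> forall x f, x \in D ->
  hitl f x \in D /\ hitr f x \in D.
Proof. by move=> hD x f; have [/(_ hD) h _] := subcoalgebraP hD.1; exact: h. Qed.

End HopfTheory.

(** * Simple subcoalgebras and Maschke averaging *)

(** Take M of maximal rank with row space inside S; a vector of S outside that row space would raise
    the rank. *)
Lemma ex_rowspace (k : fieldType) (d : nat) (S : {pred 'rV[k]_d}) :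
  submod_closed S -> exists M : 'M[k]_d, forall v, (v <= M)%MS = (v \in S).
Proof.
move=> [S0 Sl].
pose P r := `[< exists2 M : 'M[k]_d, \rank M = r &
                 forall v : 'rV_d, (v <= M)%MS -> v \in S >].
have P0 : exists r, P r.
  exists 0; apply/asboolP; exists 0; first by rewrite mxrank0.
  by move=> v; rewrite submx0 => /eqP->.
have Pd r : P r -> (r <= d)%N.
  by move=> /asboolP[M <- _]; exact: rank_leq_row.
case: (ex_maxnP P0 Pd) => r /asboolP[M Mr MS] rmax; exists M => v.
apply/idP/idP => [/MS //|Sv]; apply: contraT => nvM.
have : P (\rank (M + <<v>>)%MS).
  apply/asboolP; exists (M + <<v>>)%MS => // w /sub_addsmxP[[a b] /= ->].
  have /submxP[c ->] : (b *m <<v>> <= v)%MS by rewrite -(genmxE v) submxMl.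
  rewrite addrC [c]mx11_scalar mul_scalar_mx; apply: Sl => //; apply: MS.
  exact: submxMl.
move/rmax; rewrite -Mr leqNgt => /negP[]; apply: rank_ltmx.
rewrite /ltmx addsmxSl; apply: contra nvM => /(submx_trans _); apply.
by rewrite (submx_trans _ (addsmxSr _ _)) // genmxE.
Qed.

Section Cosemisimple.
Variables (k : fieldType) (A : algType k) (H : hopfAlgebra A).
Local Notation "A ^*" := {linear A -> k^o} : type_scope.
Implicit Types (f g : A^*) (x y : A).
Local Notation simple := (simple_subcoalgebra H).

(** The decomposition is indexed by all simple subcoalgebras; boolean functions make coextensive
    ones equal as indices. *)
Definition simples : Type := {D : A -> bool | simple D}.
Definition simples_eq (i j : simples) : bool := `[< i = j >].
Lemma simples_eqP : Equality.axiom simples_eq.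
Proof. by move=> i j; exact: asboolP. Qed.
HB.instance Definition _ := hasDecEq.Build simples simples_eqP.

Local Notation I := (simples : eqType).
Definition Dof (i : simples) : {pred A} := sval i.

Lemma Dof_simple i : simple (Dof i). Proof. exact: svalP. Qed.

Lemma Dof_sub i : submod_closed (Dof i).
Proof. by case: (Dof_simple i) => [[]]. Qed.

Lemma Dof_inj (i j : I) : Dof i =i Dof j -> i = j.
Proof.
case: i j => [D hD] [D' hD']; rewrite /Dof /= => DD'.
have {}DD' : D = D' by apply/funext => x; exact: DD'.
by case: _ / DD' hD' => hD'; rewrite (Prop_irrelevance hD hD').
Qed.

Lemma subcoalgebraI (D D' : {pred A}) : subcoalgebra H D -> subcoalgebra H D' ->
  subcoalgebra H [predI D & D'].
Proof.
move=> hD hD'; have sI : submod_closed [predI D & D'].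
  split=> [|c x y /andP[Dx D'x] /andP[Dy D'y]]; rewrite inE.
    by case: hD.1 => -> _; case: hD'.1 => -> _.
  by case: hD.1 => _ ->//; case: hD'.1 => _ ->.
apply/subcoalgebraP => // f x /andP[Dx D'x]; rewrite !inE.
have [-> ->] := comul_decomp hD f Dx.
by have [-> ->] := comul_decomp hD' f D'x.
Qed.

Lemma simple_disjoint (i j : I) x : x \in Dof i -> x \in Dof j -> x != 0 -> i = j.
Proof.
move=> xi xj x0; have [si ni mi] := Dof_simple i; have [sj nj mj] := Dof_simple j.
have sI := subcoalgebraI si sj.
have nI : nonzero_space [predI Dof i & Dof j] by exists x => //; rewrite inE xi.
apply: Dof_inj => y; rewrite -(mi _ sI nI) ?(mj _ sI nI) // => z /andP[] //.
Qed.

(** If y j != 0 for some j in the tail, a functional acting as the identity on [Dof j] and as 0 on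
    the other summands of the tail turns the relation into an expression of y j as an element of
    [Dof i]. Then i = j by disjointness, although i is not in the tail. *)
Lemma simple_direct (s : seq I) (y : I -> A) : uniq s ->
  (forall i, i \in s -> y i \in Dof i) -> \sum_(i <- s) y i = 0 ->
  forall i, i \in s -> y i = 0.
Proof.
elim: s y => // i s ih y /= /andP[nis us] hy; rewrite big_cons => ysum.
have {}hys j : j \in s -> y j \in Dof j by move=> js; apply: hy; rewrite inE js orbT.
suff ys0 j : j \in s -> y j = 0.
  move=> j; rewrite inE => /orP[/eqP->|/ys0 //].
  by move: ysum; rewrite big_seq big1 ?addr0.
move=> js; apply/eqP; apply: contraNT nis => yj0.
suff yji : y j \in Dof i by rewrite (simple_disjoint yji (hys j js) yj0).
pose Q : {pred A} := [pred x | `[< exists2 z : I -> A,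
   (forall l, l \in s -> z l \in Dof l) & x = \sum_(l <- s | l != j) z l >]].
have Qsub : submod_closed Q.
  split; first apply/asboolP.
    by exists (fun=> 0); [move=> l _; case: (Dof_sub l)|rewrite big1].
  move=> c _ _ /asboolP[z hz ->] /asboolP[z' hz' ->]; apply/asboolP.
  exists (fun l => c *: z l + z' l); last by rewrite big_split scaler_sumr.
  by move=> l ls; case: (Dof_sub l) => _; apply; auto.
have [|p [_ pid pQ]] := ex_projection (Dof_sub j) Qsub.
  move=> x xj /asboolP[z hz xE].
  have := ih (fun l => if l == j then - x else z l) us; move=> /(_ _ _ j js).
  rewrite eqxx => h; apply: oppr_inj; rewrite oppr0; apply: h.
    move=> l ls; case: eqP => [->|_]; last exact: hz.
    by rewrite -scaleN1r; exact: (submodZ (Dof_sub j)).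
  rewrite (bigD1_seq j) //= eqxx xE; apply/eqP; rewrite addrC subr_eq0; apply/eqP.
  by apply: eq_bigr => l /negPf->.
(* Each [Dof l] is stable under [hitl], and g(hitr f z) = f(hitl g z) for z in it: this is the
   counit of hitl g z, that is g z, if l = j, and 0 otherwise. *)
pose f : A^* := counit H \o p.
have hitrfE l z : l \in s -> z \in Dof l -> hitr H f z = if l == j then z else 0.
  move=> ls zl; apply: functional_inj => g; rewrite -conv_hitr conv_hitl.
  have [sl _ _] := Dof_simple l; have [hl _] := comul_decomp sl g zl.
  rewrite /f /=; case: eqP => [lj|/eqP lj].
    by rewrite pid -?lj // -(conv_hitl H g) conv_hitr hitr_counit.
  rewrite pQ ?linear0 //; apply/asboolP.
  exists (fun m => if m == l then hitl H g z else 0).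
    by move=> m ms; case: eqP => [->//|_]; case: (Dof_sub m).
  rewrite -big_filter (bigD1_seq l) ?eqxx ?filter_uniq ?mem_filter ?lj //=.
  by rewrite big1 ?addr0 // => m /negPf->.
have -> : y j = hitr H f (- y i).
  have -> : - y i = \sum_(l <- s) y l.
    by move/eqP: ysum; rewrite addrC addr_eq0 => /eqP->.
  rewrite linear_sum (bigD1_seq j) //= (hitrfE j) ?eqxx ?hys // big_seq_cond.
  rewrite big1 ?addr0 // => l /andP[ls /negPf lj]; rewrite (hitrfE l) ?lj //.
  exact: hys.
have [si _ _] := Dof_simple i; apply: (comul_decomp si f _).2.
rewrite -scaleN1r; apply: (submodZ (Dof_sub i)); apply: hy; exact: mem_head.
Qed.

Definition simple_sum : {pred A} := [pred x | `[< exists2 l : seq (I * A),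
  (forall p, p \in l -> p.2 \in Dof p.1) & x = \sum_(p <- l) p.2 >]].

Lemma simple_sum_sub : submod_closed simple_sum.
Proof.
split; first by apply/asboolP; exists [::]; rewrite ?big_nil.
move=> c _ _ /asboolP[l hl ->] /asboolP[l' hl' ->]; apply/asboolP.
exists ([seq (p.1, c *: p.2) | p <- l] ++ l').
  move=> p; rewrite mem_cat => /orP[/mapP[q /hl ql ->]|/hl' //].
  exact: (submodZ (Dof_sub _)).
by rewrite big_cat big_map scaler_sumr.
Qed.

Lemma simple_sum_subcoalgebra : subcoalgebra H simple_sum.
Proof.
apply/subcoalgebraP => [|f _ /asboolP[l hl ->]]; first exact: simple_sum_sub.
rewrite !linear_sum; split; apply/asboolP.
  exists [seq (p.1, hitl H f p.2) | p <- l]; last by rewrite big_map.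
  move=> _ /mapP[q /hl ql ->]; have [si _ _] := Dof_simple q.1.
  by have [] := comul_decomp si f ql.
exists [seq (p.1, hitr H f p.2) | p <- l]; last by rewrite big_map.
move=> _ /mapP[q /hl ql ->]; have [si _ _] := Dof_simple q.1.
by have [] := comul_decomp si f ql.
Qed.

Lemma simple_sub_sum (D : {pred A}) : simple D -> {subset D <= simple_sum}.
Proof.
move=> sD x Dx; apply/asboolP; exists [:: (exist _ D sD : simples, x)].
  by move=> p; rewrite inE => /eqP->.
by rewrite big_seq1.
Qed.

Lemma cosemisimple_simple_sum :
  (forall x, x \in simple_sum) -> cosemisimple H.
Proof.
move=> full; exists I, Dof; split; first exact: Dof_simple.
split; last by move=> s y us hy y0; exact: simple_direct.
move=> x; have /asboolP[l hl ->] := full x.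
exists (undup [seq p.1 | p <- l]), (fun i => \sum_(p <- l | p.1 == i) p.2); split.
  move=> i _; rewrite big_seq_cond; apply: (submod_sum (Dof_sub i)).
  by move=> p /andP[pl /eqP <-]; exact: hl.
rewrite (exchange_big_dep predT) //= big_seq [RHS]big_seq; apply: eq_bigr => p pl.
rewrite [RHS]big_mkcond (bigD1_seq p.1) ?undup_uniq ?mem_undup ?map_f //= eqxx.
by rewrite big1 ?addr0 // => i; rewrite eq_sym => /negPf->.
Qed.

Section Coefficients.
Variables (d : nat) (u : 'M[A]_d).

Definition lincomb (r : 'M[k]_d) : A := \sum_i \sum_j r i j *: u i j.

Lemma lincomb_linear : linear lincomb.
Proof.
move=> c r r'; rewrite /lincomb scaler_sumr -big_split; apply: eq_bigr => i _.
rewrite scaler_sumr -big_split; apply: eq_bigr => j _ /=.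
by rewrite !mxE scalerDl scalerA.
Qed.

HB.instance Definition _ := GRing.isLinear.Build k 'M[k]_d A *:%R lincomb
  lincomb_linear.

Definition coefs : {pred A} := [pred x | `[< exists r, x = lincomb r >]].

Lemma coefs_sub : submod_closed coefs.
Proof.
split; first by apply/asboolP; exists 0; rewrite linear0.
move=> c _ _ /asboolP[r ->] /asboolP[r' ->]; apply/asboolP.
by exists (c *: r + r'); rewrite linearP.
Qed.

Lemma lincomb_delta i j : lincomb (delta_mx i j) = u i j.
Proof.
rewrite /lincomb (bigD1 i) //= (bigD1 j) //= mxE !eqxx scale1r.
rewrite !big1 ?addr0 // => [l|j'] neq.
  by rewrite big1 // => j' _; rewrite mxE (negPf neq) scale0r.
by rewrite mxE (negPf neq) andbF scale0r.
Qed.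

Lemma coefs_mem i j : u i j \in coefs.
Proof. by apply/asboolP; exists (delta_mx i j); rewrite lincomb_delta. Qed.

Lemma coefs_ext (W : lmodType k) (F G : A -> W) : linear F -> linear G ->
  (forall i j, F (u i j) = G (u i j)) -> {in coefs, F =1 G}.
Proof.
move=> lF lG FG _ /asboolP[r ->]; rewrite /lincomb.
rewrite -[F]/(mk_linear lF : _ -> _) -[G]/(mk_linear lG : _ -> _) !linear_sum.
apply: eq_bigr => i _; rewrite !linear_sum; apply: eq_bigr => j _.
by rewrite !linearZ; congr (_ *: _); exact: FG.
Qed.

(** The representation of the dual algebra attached to the comodule with matrix u; see [fmx_conv]
    and [fmx_counit]. *)
Definition fmx (f : A^*) : 'M[k]_d := map_mx f u.

Hypothesis um : multiplicative_matrix H u.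

Lemma hitr_mx f i j : hitr H f (u i j) = \sum_l fmx f l j *: u i l.
Proof.
rewrite /hitr (um i j).1 tlift_bigsum; last exact: bilin_scalr.
by apply: eq_bigr => l _; rewrite tlift_pure ?mxE //; exact: bilin_scalr.
Qed.

Lemma hitl_mx f i j : hitl H f (u i j) = \sum_l fmx f i l *: u l j.
Proof.
rewrite /hitl (um i j).1 tlift_bigsum; last exact: bilin_scal.
by apply: eq_bigr => l _; rewrite tlift_pure ?mxE //; exact: bilin_scal.
Qed.

Lemma fmx_conv f g : fmx (conv H f g) = fmx f *m fmx g.
Proof.
apply/matrixP => i j; rewrite !mxE [LHS]conv_hitl hitl_mx linear_sum.
by apply: eq_bigr => l _; rewrite linearZ !mxE.
Qed.

Lemma fmx_counit : fmx (counit H) = 1%:M.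
Proof. by apply/matrixP => i j; rewrite !mxE; exact: (um i j).2. Qed.

Lemma hitr_coefs f x : x \in coefs -> hitr H f x \in coefs.
Proof.
move=> /asboolP[r ->]; rewrite linear_sum; apply: (submod_sum coefs_sub) => i _.
rewrite linear_sum; apply: (submod_sum coefs_sub) => j _.
rewrite linearZ /= hitr_mx; apply: (submodZ coefs_sub).
by apply: (submod_sum coefs_sub) => l _; apply/(submodZ coefs_sub)/coefs_mem.
Qed.

Lemma hitl_coefs f x : x \in coefs -> hitl H f x \in coefs.
Proof.
move=> /asboolP[r ->]; rewrite linear_sum; apply: (submod_sum coefs_sub) => i _.
rewrite linear_sum; apply: (submod_sum coefs_sub) => j _.
rewrite linearZ /= hitl_mx; apply: (submodZ coefs_sub).
by apply: (submod_sum coefs_sub) => l _; apply/(submodZ coefs_sub)/coefs_mem.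
Qed.

Lemma coefs_subcoalgebra : subcoalgebra H coefs.
Proof.
apply/subcoalgebraP => [|f x ux]; first exact: coefs_sub.
by rewrite hitl_coefs ?hitr_coefs.
Qed.

Section Agree.
Variables (J : finType) (c : J -> k) (f : A^*) (g : J -> A^*).
Hypothesis fg : fmx f = \sum_t c t *: fmx (g t).

(** On [coefs] a functional depends only, and linearly, on its matrix [fmx f]; so do its two
    actions, in the next two lemmas. *)
Lemma fmx_agree x : x \in coefs -> f x = \sum_t c t * g t x.
Proof.
move: x; apply: coefs_ext => [||i j]; first exact: linearP.
  move=> a x y; rewrite scaler_sumr -big_split; apply: eq_bigr => t _ /=.
  by rewrite linearP mulrDr; congr (_ + _); rewrite [LHS]mulrCA.
have /matrixP/(_ i j) := fg; rewrite mxE => ->; rewrite summxE.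
by apply: eq_bigr => t _; rewrite !mxE.
Qed.

Lemma hitr_agree x : x \in coefs -> hitr H f x = \sum_t c t *: hitr H (g t) x.
Proof.
move: x; apply: coefs_ext => [||i j]; first exact: hitr_linear.
  move=> a x y; rewrite scaler_sumr -big_split; apply: eq_bigr => t _ /=.
  by rewrite linearP scalerDr !scalerA mulrC.
rewrite hitr_mx fg; under [RHS]eq_bigr do rewrite hitr_mx scaler_sumr.
rewrite exchange_big.
apply: eq_bigr => l _; rewrite summxE scaler_suml; apply: eq_bigr => t _.
by rewrite !mxE scalerA.
Qed.

Lemma hitl_agree x : x \in coefs -> hitl H f x = \sum_t c t *: hitl H (g t) x.
Proof.
move: x; apply: coefs_ext => [||i j]; first exact: hitl_linear.
  move=> a x y; rewrite scaler_sumr -big_split; apply: eq_bigr => t _ /=.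
  by rewrite linearP scalerDr !scalerA mulrC.
rewrite hitl_mx fg; under [RHS]eq_bigr do rewrite hitl_mx scaler_sumr.
rewrite exchange_big.
apply: eq_bigr => l _; rewrite summxE scaler_suml; apply: eq_bigr => t _.
by rewrite !mxE scalerA.
Qed.

End Agree.

(* A separability idempotent of the algebra of the matrices [fmx f], lifted to
   functionals *)
Definition separability_family (r : nat) (e h : 'I_r -> A^*) : Prop :=
  (forall g, exists M : 'M[k]_r,
     (forall s, fmx (e s) *m fmx g = \sum_t M s t *: fmx (e t)) /\
     (forall t, fmx g *m fmx (h t) = \sum_s M s t *: fmx (h s))) /\
  \sum_s fmx (h s) *m fmx (e s) = 1%:M.

Section Maschke.
Variables (r : nat) (e h : 'I_r -> A^*).
Hypothesis eh : separability_family e h.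
Variable D : {pred A}.
Hypotheses (Dsub : subcoalgebra H D) (Du : {subset D <= coefs}).
Variable p : {linear A -> A}.
Hypotheses (pD : forall x, p x \in D) (pid : {in D, p =1 id}).

(* As in Maschke's theorem, averaging the projection p over the separability
   family makes it commute with the actions of the functionals on both sides. *)
Definition avgr x := \sum_s hitr H (h s) (p (hitr H (e s) x)).
Definition avg x := \sum_s hitl H (e s) (avgr (hitl H (h s) x)).

Lemma avgr_linear : linear avgr.
Proof.
move=> c x y; rewrite /avgr scaler_sumr -big_split; apply: eq_bigr => s _ /=.
by rewrite !linearP.
Qed.
HB.instance Definition _ := GRing.isLinear.Build k A A *:%R avgr avgr_linear.

Lemma avg_linear : linear avg.
Proof.
move=> c x y; rewrite /avg scaler_sumr -big_split; apply: eq_bigr => s _ /=.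
by rewrite !linearP.
Qed.
HB.instance Definition _ := GRing.isLinear.Build k A A *:%R avg avg_linear.

Lemma avgr_mem x : avgr x \in D.
Proof.
by apply: (submod_sum Dsub.1) => s _; apply: (comul_decomp Dsub _ _).2.
Qed.

Lemma avg_mem x : avg x \in D.
Proof.
by apply: (submod_sum Dsub.1) => s _; apply: (comul_decomp Dsub _ _).1; exact: avgr_mem.
Qed.

Lemma sep_counit : fmx (counit H) = \sum_s 1 *: fmx (conv H (h s) (e s)).
Proof.
rewrite fmx_counit -eh.2; apply: eq_bigr => s _.
by rewrite scale1r fmx_conv.
Qed.

Lemma avgr_id x : x \in D -> avgr x = x.
Proof.
move=> Dx; rewrite -[RHS](hitr_counit H) (hitr_agree sep_counit) ?Du //.
apply: eq_bigr => s _; rewrite scale1r pid ?hitr_hitr //.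
exact: (comul_decomp Dsub _ _).2.
Qed.

(** [hitl] reverses convolution, so h s has to act before e s for the composite to be the action of
    the product of h s and e s, whose sum acts as the counit. *)
Lemma avg_id x : x \in D -> avg x = x.
Proof.
move=> Dx; rewrite -[RHS](hitl_counit H) (hitl_agree sep_counit) ?Du //.
apply: eq_bigr => s _; rewrite scale1r avgr_id ?hitl_hitl //.
exact: (comul_decomp Dsub _ _).1.
Qed.

(** One matrix M governs both families, so g passes from the inner action of the e s, across p, to
    the outer action of the h s. *)
Lemma avgr_hitr g x : x \in coefs -> avgr (hitr H g x) = hitr H g (avgr x).
Proof.
move=> ux; have [M [Me Mh]] := eh.1 g.
transitivity (\sum_s \sum_t M s t *: hitr H (h s) (p (hitr H (e t) x))).
  apply: eq_bigr => s _; rewrite hitr_hitr.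
  rewrite (@hitr_agree _ (M s) (conv H (e s) g) e) ?fmx_conv ?Me // !linear_sum.
  by apply: eq_bigr => t _; rewrite !linearZ.
rewrite exchange_big linear_sum; apply: eq_bigr => t _.
by rewrite [RHS]hitr_hitr (@hitr_agree _ (M ^~ t) (conv H g (h t)) h) ?fmx_conv ?Mh // Du.
Qed.

Lemma avg_hitr g x : x \in coefs -> avg (hitr H g x) = hitr H g (avg x).
Proof.
move=> ux; rewrite [RHS]linear_sum; apply: eq_bigr => s _ /=.
by rewrite hitl_hitr avgr_hitr ?hitl_hitr // hitl_coefs.
Qed.

Lemma avg_hitl g x : x \in coefs -> avg (hitl H g x) = hitl H g (avg x).
Proof.
move=> ux; have [M [Me Mh]] := eh.1 g.
transitivity (\sum_t \sum_s M s t *: hitl H (e t) (avgr (hitl H (h s) x))).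
  apply: eq_bigr => t _; rewrite hitl_hitl.
  rewrite (@hitl_agree _ (M ^~ t) (conv H g (h t)) h) ?fmx_conv ?Mh //.
  rewrite [avgr _]linear_sum [LHS]linear_sum; apply: eq_bigr => s _.
  by rewrite -[RHS]linearZ; congr (hitl _ _ _); exact: linearZ.
rewrite exchange_big linear_sum; apply: eq_bigr => s _.
rewrite [RHS]hitl_hitl (@hitl_agree _ (M s) (conv H (e s) g) e) ?fmx_conv ?Me //.
by rewrite Du ?avgr_mem.
Qed.

(** The complement is the kernel of [avg] in [coefs], a subcoalgebra because [avg] commutes with
    both actions. *)
Lemma sep_complement : exists N : {pred A},
  [/\ subcoalgebra H N, {subset N <= coefs}, forall x, x \in N -> x \in D -> x = 0
    & forall x, x \in coefs -> exists2 y, y \in D & x - y \in N].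
Proof.
pose N : {pred A} := [pred x | (x \in coefs) && (avg x == 0)].
have Nsub : submod_closed N.
  split=> [|c x y /andP[ux /eqP Px] /andP[uy /eqP Py]]; apply/andP; split.
  - by case: coefs_sub.
  - by rewrite linear0.
  - by case: coefs_sub => _; apply.
  - by rewrite linearP /= Px Py scaler0 addr0.
exists N; split.
- apply/subcoalgebraP => // f x /andP[ux /eqP Px]; split; apply/andP; split.
  + exact: hitl_coefs.
  + by rewrite avg_hitl // Px linear0.
  + exact: hitr_coefs.
  + by rewrite avg_hitr // Px linear0.
- by move=> x /andP[].
- by move=> x /andP[_ /eqP Px] /avg_id; rewrite Px.
- move=> x ux; exists (avg x); first exact: avg_mem.
  apply/andP; split; last by rewrite linearB /= (avg_id (avg_mem x)) subrr.
  by apply: (submodB coefs_sub) => //; apply: Du; exact: avg_mem.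
Qed.

End Maschke.

(** Descent on the rank of the preimage of N under [lincomb]. That map may have a kernel, but
    subspaces of [coefs] are images of their preimages, so strict inclusions stay strict. *)
Lemma ex_simple (N : {pred A}) : subcoalgebra H N -> nonzero_space N ->
  {subset N <= coefs} -> exists2 D : {pred A}, simple D & {subset D <= N}.
Proof.
pose pre (N : {pred A}) : {pred 'rV[k]_(d * d)} :=
  [pred v | lincomb (vec_mx v) \in N].
have presub (S : {pred A}) : submod_closed S -> submod_closed (pre S).
  move=> [S0 Sl]; split=> [|c v w]; rewrite !inE; first by rewrite !linear0.
  by rewrite !linearP; exact: Sl.
have mxof (S : {pred A}) : subcoalgebra H S -> exists M : 'M_(d * d),
    forall v, (v <= M)%MS = (v \in pre S).
  by move=> [Ss _]; apply: ex_rowspace; exact: presub.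
move=> sN nN Nu; have [M ME] := mxof N sN.
have [m] := ubnP (\rank M); elim: m N M sN nN Nu ME => // m ih N M sN nN Nu ME rM.
have [?|nsN] := pselect (simple N); first by exists N.
have [D' [sD' nD' D'N D'neq]] : exists D' : {pred A}, [/\ subcoalgebra H D',
    nonzero_space D', {subset D' <= N} & ~ (D' =i N)].
  apply: contrapT => h; apply: nsN; split=> // D' sD' nD' D'N.
  by apply: contrapT => D'neq; apply: h; exists D'.
have [M' M'E] := mxof D' sD'.
have lt : (\rank M' < \rank M)%N.
  apply: rank_ltmx; apply/andP; split.
    apply/row_subP => i; rewrite ME; apply: D'N.
    by have := row_sub i M'; rewrite M'E.
  apply/negP => MM'; apply: D'neq => x; apply/idP/idP => [/D'N //|Nx].
  have /asboolP[r xr] := Nu x Nx.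
  have : (mxvec r <= M')%MS by apply: submx_trans MM'; rewrite ME inE mxvecK -xr.
  by rewrite M'E inE mxvecK -xr.
have [||D sD DD'] := ih D' M' sD' nD' _ M'E _.
- by move=> x /D'N /Nu.
- exact: leq_trans lt _.
- by exists D => // x /DD' /D'N.
Qed.

(** Split the intersection of [coefs] and [simple_sum] off [coefs]. A nonzero complement would
    contain a simple subcoalgebra, which lies in both summands. *)
Lemma coefs_simple_sum r (e h : 'I_r -> A^*) : separability_family e h ->
  {subset coefs <= simple_sum}.
Proof.
move=> eh; have sD := subcoalgebraI coefs_subcoalgebra simple_sum_subcoalgebra.
have [p [pD pid]] := ex_retraction sD.1.
have [|N [sN Nu ND Ndec]] := sep_complement eh sD _ pD pid.
  by move=> x /andP[].
move=> x ux; have [y /andP[_ Ty] Nxy] := Ndec x ux.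
have [xy0|xy0] := eqVneq (x - y) 0; first by rewrite (subr0_eq xy0).
have [|D' sD' D'N] := ex_simple sN _ Nu; first by exists (x - y).
have [_ [z Dz z0] _] := sD'; case/eqP: z0; apply: ND; first exact: D'N.
by apply/andP; split; [exact/Nu/D'N|exact: simple_sub_sum Dz].
Qed.

End Coefficients.

End Cosemisimple.

(** * Powers of the generic matrix *)

Section TupleSums.
Variables (R : pzRingType) (n : nat).

Lemma prod_sum_tuple (N : nat) (F : 'I_N -> 'I_n -> R) :
  \prod_(l < N) \sum_(p < n) F l p =
  \sum_(t : N.-tuple 'I_n) \prod_(l < N) F l (tnth t l).
Proof.
rewrite bigA_distr_bigA.
rewrite (reindex (fun t : N.-tuple 'I_n => [ffun l => tnth t l])) /=.
  by apply: eq_bigr => t _; apply: eq_bigr => l _; rewrite ffunE.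
exists (fun f : {ffun 'I_N -> 'I_n} => [tuple f l | l < N]) => [t _|f _].
  by apply: eq_from_tnth => l; rewrite tnth_mktuple ffunE.
by apply/ffunP => l; rewrite ffunE tnth_mktuple.
Qed.

Lemma sum_tuple_rcons (V : nmodType) m (F : m.+1.-tuple 'I_n -> V) :
  \sum_(t : m.+1.-tuple 'I_n) F t =
  \sum_(t : m.-tuple 'I_n) \sum_(c < n) F [tuple of rcons t c].
Proof.
rewrite pair_big (reindex (fun p : m.-tuple 'I_n * 'I_n => [tuple of rcons p.1 p.2])) //.
exists (fun t : m.+1.-tuple 'I_n =>
    ([tuple of belast (thead t) (behead t)], last (thead t) (behead t))) => [[t c] _|t _].
  rewrite /=; congr (_, _); last by case: t => [[|? ?]] //= ?; rewrite last_rcons.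
  by apply: val_inj; case: t => [[|? ?]] //= ?; rewrite belast_rcons.
by apply: val_inj; rewrite /= -lastI; case/tupleP: t => a t.
Qed.

Lemma sum_tuple_cons (V : nmodType) m (F : m.+1.-tuple 'I_n -> V) :
  \sum_(t : m.+1.-tuple 'I_n) F t =
  \sum_(t : m.-tuple 'I_n) \sum_(c < n) F [tuple of c :: t].
Proof.
rewrite pair_big (reindex (fun p : m.-tuple 'I_n * 'I_n => [tuple of p.2 :: p.1])) //.
exists (fun t : m.+1.-tuple 'I_n => ([tuple of behead t], thead t)) => [[t c] _|t _].
  by rewrite /=; congr (_, _); apply: val_inj.
by case/tupleP: t => a t; apply: val_inj.
Qed.

Lemma tnth_rcons_widen m (t : m.-tuple 'I_n) c (l : 'I_m) :
  tnth [tuple of rcons t c] (widen_ord (leqnSn m) l) = tnth t l.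
Proof. by rewrite !(tnth_nth c) /= nth_rcons size_tuple ltn_ord. Qed.

Lemma tnth_rcons_max m (t : m.-tuple 'I_n) c :
  tnth [tuple of rcons t c] ord_max = c.
Proof. by rewrite (tnth_nth c) /= nth_rcons size_tuple ltnn eqxx. Qed.

Lemma tuple_rcons_eq m (t t' : m.-tuple 'I_n) c c' :
  ([tuple of rcons t c] == [tuple of rcons t' c']) = (t == t') && (c == c').
Proof. by rewrite -val_eqE /= eqseq_rcons. Qed.

Lemma tuple_cons_eq m (t t' : m.-tuple 'I_n) c c' :
  ([tuple of c :: t] == [tuple of c' :: t']) = (t == t') && (c == c').
Proof. by rewrite -val_eqE /= eqseq_cons andbC. Qed.

Lemma tuple_lastP m (t : m.+1.-tuple 'I_n) :
  exists (t' : m.-tuple 'I_n) (c : 'I_n), t = [tuple of rcons t' c].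
Proof.
case/tupleP: t => a t; exists [tuple of belast a t], (last a t).
by apply: val_inj; rewrite /= -lastI.
Qed.

End TupleSums.

Section MatrixPowers.
Variables (n : nat) (B : nzRingType) (a b : 'M[B]_n).

(** The entries of the N-th tensor power of x. *)
Definition tpow (R : nzRingType) (x : 'M[R]_n) N (i j : N.-tuple 'I_n) : R :=
  \prod_(l < N) x (tnth i l) (tnth j l).

Lemma tpow_rcons (R : nzRingType) (x : 'M[R]_n) m (i j : m.-tuple 'I_n) c d :
  tpow x [tuple of rcons i c] [tuple of rcons j d] = tpow x i j * x c d.
Proof.
rewrite /tpow big_ord_recr /= !tnth_rcons_max; congr (_ * _).
by apply: eq_bigr => l _; rewrite !tnth_rcons_widen.
Qed.

Lemma tpow_cons (R : nzRingType) (x : 'M[R]_n) m (i j : m.-tuple 'I_n) c d :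
  tpow x [tuple of c :: i] [tuple of d :: j] = x c d * tpow x i j.
Proof.
rewrite /tpow big_ord_recl /= !tnth0; congr (_ * _).
by apply: eq_bigr => l _; rewrite !tnthS.
Qed.

(** The product over b is reversed in the opposite algebra, so the last factors of a and b are
    adjacent and the sum collapses from the inside. In [tpow_mulVr] the first factors are adjacent
    instead. *)
Lemma tpow_mulV N (i k : N.-tuple 'I_n) : a *m b = 1%:M ->
  \sum_(j : N.-tuple 'I_n) tpow a i j * (tpow (b : 'M[B^c]_n) j k : B) = (i == k)%:R.
Proof.
move=> ab; elim: N i k => [|m ih] i k.
  rewrite (big_pred1 [tuple]) => [|j]; last by apply/esym/eqP; exact: tuple0.
  by rewrite /tpow !big_ord0 mul1r (tuple0 i) (tuple0 k) eqxx.
have [i' [c ->]] := tuple_lastP i; have [k' [d ->]] := tuple_lastP k.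
rewrite sum_tuple_rcons tuple_rcons_eq -mulnb natrM -ih mulr_suml.
apply: eq_bigr => j' _; rewrite -mulrA.
transitivity (\sum_e tpow a i' j' * (a c e * b e d) * (tpow (b : 'M[B^c]_n) j' k' : B)).
  apply: eq_bigr => e _; rewrite !tpow_rcons.
  by rewrite [X in _ * X = _](_ : _ = b e d * (tpow (b : 'M[B^c]_n) j' k' : B)) ?mulrA.
rewrite -mulr_suml -mulr_sumr.
have /matrixP/(_ c d) := ab; rewrite !mxE => ->.
by rewrite -!mulrA; congr (_ * _); rewrite -commr_nat.
Qed.

Lemma tpow_mulVr N (i k : N.-tuple 'I_n) : b *m a = 1%:M ->
  \sum_(j : N.-tuple 'I_n) (tpow (b : 'M[B^c]_n) i j : B) * tpow a j k = (i == k)%:R.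
Proof.
move=> ba; elim: N i k => [|m ih] i k.
  rewrite (big_pred1 [tuple]) => [|j]; last by apply/esym/eqP; exact: tuple0.
  by rewrite /tpow !big_ord0 mul1r (tuple0 i) (tuple0 k) eqxx.
case/tupleP: i => c i'; case/tupleP: k => d k'.
rewrite sum_tuple_cons tuple_cons_eq -mulnb natrM -ih mulr_suml.
apply: eq_bigr => j' _; rewrite -mulrA.
transitivity (\sum_e (tpow (b : 'M[B^c]_n) i' j' : B) * (b c e * a e d) * tpow a j' k').
  apply: eq_bigr => e _; rewrite !tpow_cons.
  by rewrite [X in X * _ = _](_ : _ = (tpow (b : 'M[B^c]_n) i' j' : B) * b c e) ?mulrA.
rewrite -mulr_suml -mulr_sumr.
have /matrixP/(_ c d) := ba; rewrite !mxE => ->.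
by rewrite -!mulrA; congr (_ * _); rewrite -commr_nat.
Qed.

End MatrixPowers.

Section Relations.
Variables (k : fieldType) (n N : nat) (E : N.-tuple 'I_n -> k).

Lemma SL_relE (A : algType k) (a : 'M[A]_n) : SL_rel E a <->
  (forall i, \sum_j E j *: tpow a j i = E i *: 1) /\
  (forall i, \sum_j E j *: tpow a i j = E i *: 1).
Proof. by []. Qed.

Lemma SL_rel_tr (A : algType k) (a : 'M[A]_n) : SL_rel E a -> SL_rel E a^T.
Proof.
move=> [r1 r2]; split=> i; [rewrite -r2|rewrite -r1];
  apply: eq_bigr => j _; congr (_ *: _); by apply: eq_bigr => l _; rewrite mxE.
Qed.

(** Expand E by the relations of a, then cancel the tensor power of a against that of b; this
    cancellation forces the reversed order in b. *)
Lemma SL_rel_inv (A : algType k) (a b : 'M[A]_n) : SL_rel E a ->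
  a *m b = 1%:M -> b *m a = 1%:M -> SL_rel E (b : 'M[A^c]_n).
Proof.
move=> /SL_relE[r1 r2] ab ba; apply/SL_relE; split=> i.
  transitivity (\sum_j (\sum_p E p *: tpow a p j) * (tpow (b : 'M[A^c]_n) j i : A)).
    by apply: eq_bigr => j _; rewrite r1 -scalerAl mul1r.
  under eq_bigr do rewrite mulr_suml.
  rewrite exchange_big /= (bigD1 i) //= [X in _ + X]big1 => [|p /negPf pi].
    under eq_bigr do rewrite -scalerAl.
    by rewrite -scaler_sumr (tpow_mulV i i ab) eqxx addr0.
  under eq_bigr do rewrite -scalerAl.
  by rewrite -scaler_sumr (tpow_mulV p i ab) pi scaler0.
transitivity (\sum_j (tpow (b : 'M[A^c]_n) i j : A) * (\sum_p E p *: tpow a j p)).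
  by apply: eq_bigr => j _; rewrite r2 -scalerAr mulr1.
under eq_bigr do rewrite mulr_sumr.
rewrite exchange_big /= (bigD1 i) //= [X in _ + X]big1 => [|p /negPf pi].
  under eq_bigr do rewrite -scalerAr.
  by rewrite -scaler_sumr (tpow_mulVr i i ba) eqxx addr0.
under eq_bigr do rewrite -scalerAr.
by rewrite -scaler_sumr (tpow_mulVr i p ba) eq_sym pi scaler0.
Qed.

End Relations.

(** * The Hopf algebra SL(E) *)

Section Inverses.
Variables (k : fieldType) (n m : nat) (E : m.+1.-tuple 'I_n -> k).
Variables (A : algType k) (a : 'M[A]_n).
Hypothesis ra : SL_rel E a.

Definition left_dual (x : 'I_n -> {ffun m.-tuple 'I_n -> k}) :=
  forall d, left_map E (x d) = delta_mx 0 d.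
Definition right_dual (y : 'I_n -> {ffun m.-tuple 'I_n -> k}) :=
  forall d, right_map E (y d) = delta_mx 0 d.

(* The relations contracted with the dual family x, with their last factor
   removed, read [linv x *m a = 1]; the first factor is removed for [rinv]. *)
Definition linv (x : 'I_n -> {ffun m.-tuple 'I_n -> k}) : 'M[A]_n :=
  \matrix_(d, c) \sum_(i : m.-tuple 'I_n) x d i *:
    \sum_(j : m.-tuple 'I_n) E [tuple of rcons j c] *: tpow a j i.
Definition rinv (y : 'I_n -> {ffun m.-tuple 'I_n -> k}) : 'M[A]_n :=
  \matrix_(c, d) \sum_(i : m.-tuple 'I_n) y d i *:
    \sum_(j : m.-tuple 'I_n) E [tuple of c :: j] *: tpow a i j.

Lemma linvP x : left_dual x -> linv x *m a = 1%:M.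
Proof.
move=> hx; have [r1 _] := (SL_relE E a).1 ra; apply/matrixP => d e; rewrite !mxE.
have /rowP/(_ e) := hx d; rewrite !mxE eqxx /= => xE.
rewrite [RHS](_ : _ = (e == d)%:R *: 1); last first.
  by rewrite eq_sym; case: eqP; rewrite ?scale1r ?scale0r.
rewrite -xE scaler_suml.
under eq_bigr do rewrite mxE mulr_suml.
rewrite exchange_big; apply: eq_bigr => i _.
transitivity (x d i *: \sum_j E j *: tpow a j [tuple of rcons i e]).
  rewrite sum_tuple_rcons exchange_big scaler_sumr; apply: eq_bigr => c _.
  rewrite -scalerAl mulr_suml; congr (_ *: _); apply: eq_bigr => j _.
  by rewrite tpow_rcons scalerAl.
by rewrite r1 scalerA.
Qed.

Lemma rinvP y : right_dual y -> a *m rinv y = 1%:M.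
Proof.
move=> hy; have [_ r2] := (SL_relE E a).1 ra; apply/matrixP => e d; rewrite !mxE.
have /rowP/(_ e) := hy d; rewrite !mxE eqxx /= => yE.
rewrite [RHS](_ : _ = (e == d)%:R *: 1); last first.
  by case: eqP; rewrite ?scale1r ?scale0r.
rewrite -yE scaler_suml.
under eq_bigr do rewrite mxE mulr_sumr.
rewrite exchange_big; apply: eq_bigr => i _.
transitivity (y d i *: \sum_j E j *: tpow a [tuple of e :: i] j).
  rewrite sum_tuple_cons exchange_big scaler_sumr; apply: eq_bigr => c _.
  rewrite -scalerAr mulr_sumr; congr (_ *: _); apply: eq_bigr => j _.
  by rewrite tpow_cons scalerAr.
by rewrite r2 scalerA.
Qed.

(** Left non-degeneracy gives a left inverse and right non-degeneracy a right inverse, so they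
    coincide. *)
Lemma ex_inverse : left_nondegenerate E -> right_nondegenerate E ->
  exists b : 'M[A]_n, a *m b = 1%:M /\ b *m a = 1%:M.
Proof.
move=> lE rE; have [x hx] := boolp.choice (fun d => lE (delta_mx 0 d)).
have [y hy] := boolp.choice (fun d => rE (delta_mx 0 d)).
have xa := linvP hx; have ay := rinvP hy; exists (rinv y); split=> //.
by rewrite -(_ : linv x = rinv y) // -[LHS]mulmx1 -ay mulmxA xa mul1mx.
Qed.

End Inverses.

Section SLtheory.
Variables (k : fieldType) (n N : nat) (E : N.-tuple 'I_n -> k).
Local Notation SLE := (SL E).
Local Notation a := (SL_mx E).

Lemma SL_ind (P : SLE -> Prop) : P 1 -> (forall i j x, P x -> P (a i j * x)) ->
  (forall c x y, P x -> P y -> P (c *: x + y)) -> forall x, P x.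
Proof.
move=> P1 PM PD x.
have P0 : P 0 by rewrite -[0](addNr 1) -scaleN1r; exact: PD.
rewrite -[x]reprK SL_span /nceval; elim: (repr x) => [|[c w] s ih].
  by rewrite big_nil.
rewrite big_cons; apply: PD => //=; elim: w => [|[i j] w ihw].
  by rewrite big_nil.
by rewrite big_cons; exact: PM.
Qed.

(** Meant for identities between linear maps not known to be multiplicative, such as the antipode
    axioms, where agreement on the generators is not enough. *)
Lemma SL_linear_ext (W : lmodType k) (F G : SLE -> W) : linear F -> linear G ->
  F 1 = G 1 -> (forall i j x, F x = G x -> F (a i j * x) = G (a i j * x)) -> F =1 G.
Proof.
move=> lF lG FG1 FGM; apply: SL_ind => // c x y Fx Fy.
by rewrite lF lG Fx Fy.
Qed.

Definition comul_mx : 'M[tens SLE SLE]_n := \matrix_(i, j) \sum_l a i l ⊗ a l j.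

Lemma tpow_comul_mx (i j : N.-tuple 'I_n) :
  tpow comul_mx i j = \sum_(p : N.-tuple 'I_n) tpow a i p ⊗ tpow a p j.
Proof.
rewrite /tpow; under eq_bigr do rewrite mxE.
by rewrite prod_sum_tuple; apply: eq_bigr => p _; rewrite tpureX_prod.
Qed.

(** The tensor power of [comul_mx] is a sum over an intermediate tuple p; the relations of a absorb
    one tensor leg, which leaves E p, and then the other. *)
Lemma comul_mx_rel : SL_rel E comul_mx.
Proof.
have [r1 r2] := (SL_relE E a).1 (SL_gen_rel E).
apply/SL_relE; split=> i; under eq_bigr do rewrite tpow_comul_mx scaler_sumr.
  rewrite exchange_big /=.
  under eq_bigr => p _ do
    [under eq_bigr do rewrite -tpureZl; rewrite -tpure_suml r1 tpureZl -tpureZr].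
  by rewrite -tpure_sumr r1 tpureZr.
rewrite exchange_big /=.
under eq_bigr => p _ do
  [under eq_bigr do rewrite -tpureZr; rewrite -tpure_sumr r2 tpureZr -tpureZl].
by rewrite -tpure_suml r2 tpureZl.
Qed.

Definition SL_comul : SLE -> tens SLE SLE := SL_ext comul_mx_rel.
HB.instance Definition _ := GRing.LRMorphism.on SL_comul.
Definition SL_counit : SLE -> k^o := SL_ext (SL_rel_id E).
HB.instance Definition _ := GRing.LRMorphism.on SL_counit.

Lemma SL_extE (A : algType k) (b : 'M[A]_n) (rb : SL_rel E b) i j :
  SL_ext rb (a i j) = b i j.
Proof. by rewrite mxE; exact: SL_eval_gen. Qed.

Lemma SL_comul_gen i j : SL_comul (a i j) = \sum_l a i l ⊗ a l j.
Proof. by rewrite [LHS]SL_extE mxE. Qed.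

Lemma SL_counit_gen i j : SL_counit (a i j) = (i == j)%:R.
Proof. by rewrite [LHS]SL_extE mxE. Qed.

Lemma tlift_comul_gen (W : lmodType k) (f : SLE -> SLE -> W) i j x : bilin f ->
  tlift f (SL_comul (a i j * x)) =
  \sum_l tlift (fun y z => f (a i l * y) (a l j * z)) (SL_comul x).
Proof.
move=> bf; rewrite rmorphM /= SL_comul_gen mulr_suml tlift_bigsum //.
by apply: eq_bigr => l _; rewrite tlift_pureM.
Qed.

Lemma SL_comulA x : tassoc (tmap SL_comul idfun (SL_comul x))
                     = tmap idfun SL_comul (SL_comul x).
Proof.
have bp (U V : lmodType k) := tpure_bilin U V.
have b1 := @tassoc_bilin k SLE SLE SLE.
have b2 := bilin_comp SL_comul (idfun : {linear SLE -> SLE}) b1.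
have b3 := bilin_comp (idfun : {linear SLE -> SLE}) SL_comul (bp SLE (tens SLE SLE)).
have b4 := bilin_comp SL_comul (idfun : {linear SLE -> SLE}) (bp (tens SLE SLE) SLE).
have b5 (z : SLE) : bilin (fun x y : SLE => x ⊗ (y ⊗ z)).
  by apply: bilinI => [y|u] c v w;
    rewrite /= ?(tpureDl, tpureZl, tpureDr, tpureZr).
transitivity (tlift
    (fun y z => tlift (fun y1 y2 => y1 ⊗ (y2 ⊗ z)) (SL_comul y)) (SL_comul x)).
  rewrite /tassoc /tmap (tlift_compf _ _ (tlift_linear b1)).
  by apply: eq_tlift => y z; rewrite (tlift_pure b1).
move: x; apply: SL_linear_ext.
- by move=> c x y; rewrite linearP (tlift_linear b2).
- by move=> c x y; rewrite linearP [LHS](tlift_linear b3).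
- rewrite rmorph1 /tmap (tlift_pure b2) (tlift_pure b3) /= !rmorph1.
  by rewrite (tlift_pure (b5 _)).
move=> i j x ih; rewrite /tmap (tlift_comul_gen _ _ _ b2) (tlift_comul_gen _ _ _ b3).
transitivity (\sum_l \sum_p a i p ⊗ (a p l ⊗ a l j) *
  tlift (fun y z => tlift (fun y1 y2 => y1 ⊗ (y2 ⊗ z)) (SL_comul y)) (SL_comul x)).
  apply: eq_bigr => l _; under [RHS]eq_bigr do rewrite tlift_mull.
  rewrite tlift_sumf; apply: eq_tlift => y z.
  rewrite (tlift_comul_gen _ _ _ (b5 (a l j * z))); apply: eq_bigr => p _.
  by rewrite tlift_mull; apply: eq_tlift => y1 y2; rewrite !tpureM.
rewrite exchange_big ih; apply: eq_bigr => p _.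
under eq_bigr do rewrite tlift_mull.
rewrite tlift_sumf; apply: eq_tlift => y z.
rewrite /= rmorphM /= SL_comul_gen mulr_suml tpure_sumr.
by apply: eq_bigr => l _; rewrite tpureM.
Qed.

Lemma SL_comul_counitl x : tlift (fun y z => SL_counit y *: z) (SL_comul x) = x.
Proof.
have bf := bilin_scal SLE (SL_counit : {linear SLE -> k^o}).
move: x; apply: SL_linear_ext => //.
- by move=> c x y; rewrite linearP (tlift_linear bf).
- by rewrite rmorph1 (tlift_pure bf) rmorph1 scale1r.
move=> i j x ih; rewrite (tlift_comul_gen _ _ _ bf) (bigD1 i) //=.
rewrite [X in _ + X]big1 ?addr0 => [|l li].
  rewrite -[in RHS]ih [RHS]mulr_sumr; apply: eq_bigr => q _.
  by rewrite rmorphM /= SL_counit_gen eqxx mul1r; exact: scalerAr.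
apply: big1 => q _.
by rewrite rmorphM /= SL_counit_gen eq_sym (negPf li) mul0r scale0r.
Qed.

Lemma SL_comul_counitr x : tlift (fun y z => SL_counit z *: y) (SL_comul x) = x.
Proof.
have bf := bilin_scalr SLE (SL_counit : {linear SLE -> k^o}).
move: x; apply: SL_linear_ext => //.
- by move=> c x y; rewrite linearP (tlift_linear bf).
- by rewrite rmorph1 (tlift_pure bf) rmorph1 scale1r.
move=> i j x ih; rewrite (tlift_comul_gen _ _ _ bf) (bigD1 j) //=.
rewrite [X in _ + X]big1 ?addr0 => [|l lj].
  rewrite -[in RHS]ih [RHS]mulr_sumr; apply: eq_bigr => q _.
  by rewrite rmorphM /= SL_counit_gen eqxx mul1r; exact: scalerAr.
apply: big1 => q _.
by rewrite rmorphM /= SL_counit_gen (negPf lj) mul0r scale0r.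
Qed.

Section Antimorphism.
Variables (b : 'M[SLE^c]_n) (rb : SL_rel E b).

Definition SL_anti : SLE -> SLE^c := SL_ext rb.

Lemma SL_anti_linear : linear (SL_anti : SLE -> SLE).
Proof. exact: (linearP (SL_ext rb)). Qed.

Lemma SL_antiM x y : SL_anti (x * y) = (SL_anti y : SLE) * SL_anti x.
Proof. exact: (rmorphM (SL_ext rb)). Qed.

Lemma SL_anti1 : SL_anti 1 = 1.
Proof. exact: (rmorph1 (SL_ext rb)). Qed.

Lemma SL_anti_gen i j : SL_anti (a i j) = b i j.
Proof. exact: SL_extE. Qed.

Lemma SL_anti_sum (I : finType) (F : I -> SLE) :
  SL_anti (\sum_i F i) = \sum_i (SL_anti (F i) : SLE).
Proof. exact: (linear_sum (mk_linear SL_anti_linear)). Qed.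

Lemma SL_anti_nat m : SL_anti m%:R = m%:R.
Proof. exact: (rmorph_nat (SL_ext rb)). Qed.

End Antimorphism.

Section Antipode.
Variable b : 'M[SLE]_n.
Hypotheses (ab : a *m b = 1%:M) (ba : b *m a = 1%:M).
Let rb := SL_rel_inv (SL_gen_rel E) ab ba.
Local Notation anti := (SL_anti rb).

(** For a word a_ij x, the first sum has b_il a_lj in its middle; the second wraps a_il and b_lj
    around the sum for x, a scalar by induction. Either way the new factors cancel. *)
Lemma SL_anti_conv : 
  (forall x, tlift (fun y z => (anti y : SLE) * z) (SL_comul x) = ((SL_counit x : k)%:A : SLE)) /\
  (forall x, tlift (fun y z => y * (anti z : SLE)) (SL_comul x) = ((SL_counit x : k)%:A : SLE)).
Proof.
pose S := mk_linear (SL_anti_linear rb).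
have bae i j : \sum_l b i l * a l j = (i == j)%:R.
  by have /matrixP/(_ i j) := ba; rewrite mxE [RHS]mxE.
have abe i j : \sum_l a i l * b l j = (i == j)%:R.
  by have /matrixP/(_ i j) := ab; rewrite mxE [RHS]mxE.
have bl : bilin (fun y z : SLE => (anti y : SLE) * z).
  exact: (mul_bilin S (idfun : {linear SLE -> SLE})).
have br : bilin (fun y z : SLE => y * (anti z : SLE)).
  exact: (mul_bilin (idfun : {linear SLE -> SLE}) S).
have lc : linear (fun x : SLE => (SL_counit x : k)%:A : SLE).
  by move=> c x y; rewrite linearP scalerDl scalerA.
split; apply: SL_linear_ext => //.
- by move=> c x y; rewrite linearP (tlift_linear bl).
- by rewrite rmorph1 (tlift_pure bl) [SL_counit 1]rmorph1 scale1r [LHS]mulr1; exact: SL_anti1.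
- move=> i j x ih; rewrite (tlift_comul_gen _ _ _ bl).
  transitivity (\sum_l \sum_(q <- repr (SL_comul x))
      (anti q.1 : SLE) * (b i l * a l j) * q.2).
    apply: eq_bigr => l _; apply: eq_bigr => q _.
    by rewrite SL_antiM SL_anti_gen !mulrA.
  rewrite exchange_big /=; under eq_bigr do rewrite -mulr_suml -mulr_sumr bae.
  rewrite rmorphM /= SL_counit_gen; case: eqP => _ /=.
    by rewrite mul1r -ih; apply: eq_bigr => q _; rewrite mulr1.
  by rewrite mul0r scale0r big1 // => q _; rewrite mulr0 mul0r.
- by move=> c x y; rewrite linearP (tlift_linear br).
- by rewrite rmorph1 (tlift_pure br) [SL_counit 1]rmorph1 scale1r [LHS]mul1r; exact: SL_anti1.
- move=> i j x ih; rewrite (tlift_comul_gen _ _ _ br).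
  transitivity (\sum_l a i l * ((SL_counit x : k)%:A : SLE) * b l j).
    apply: eq_bigr => l _; rewrite -ih [_ * tlift _ _]mulr_sumr mulr_suml.
    by apply: eq_bigr => q _; rewrite SL_antiM SL_anti_gen !mulrA.
  transitivity ((SL_counit x : k) *: (\sum_l a i l * b l j : SLE)).
    rewrite scaler_sumr; apply: eq_bigr => l _.
    by rewrite -scalerAr mulr1 -scalerAl.
  rewrite abe.
  rewrite rmorphM /= SL_counit_gen; case: eqP => _ /=; first by rewrite mul1r.
  by rewrite mul0r scale0r scaler0.
Qed.

Definition SL_hopfAlgebra : hopfAlgebra SLE :=
  @HopfAlgebra k SLE SL_comul SL_counit (mk_linear (SL_anti_linear rb))
    (conj (rmorph1 SL_comul) (rmorphM SL_comul))
    SL_comulA SL_comul_counitl SL_comul_counitr SL_anti_conv.1 SL_anti_conv.2.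

Lemma SL_hopfAlgebraP : SL_hopf SL_hopfAlgebra.
Proof. by move=> i j; split; [exact: SL_comul_gen|exact: SL_counit_gen]. Qed.

End Antipode.

End SLtheory.

Arguments SL_comul {k n N} E _.
Arguments SL_counit {k n N} E _.

(** * The inverse antipode and uniqueness of the Hopf structure *)

Section InverseAntipode.
Variables (k : fieldType) (n N : nat) (E : N.-tuple 'I_n -> k).
Local Notation SLE := (SL E).
Local Notation a := (SL_mx E).
Variables b c : 'M[SLE]_n.
Hypotheses (ab : a *m b = 1%:M) (ba : b *m a = 1%:M).
Hypotheses (ac : a^T *m c = 1%:M) (ca : c *m a^T = 1%:M).

Lemma SL_rel_anti : SL_rel E (b : 'M[SLE^c]_n).
Proof. exact: SL_rel_inv (SL_gen_rel E) ab ba. Qed.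

(** An antimorphism S' with S'(b) = a reverses the products in b a = 1, so the transpose of S'(a)
    must be the inverse c of a^T. *)
Lemma SL_rel_antiV : SL_rel E (c^T : 'M[SLE^c]_n).
Proof. exact: SL_rel_tr (SL_rel_inv (SL_rel_tr (SL_gen_rel E)) ac ca). Qed.

Let S : SLE -> SLE := SL_anti SL_rel_anti.
Let S' : SLE -> SLE := SL_anti SL_rel_antiV.

Lemma SL_antiV_inv i j : S' (b i j) = a i j.
Proof.
pose Y : 'M[SLE]_n := \matrix_(j, i) S' (b i j).
suff /matrixP/(_ j i) : Y = a^T by rewrite mxE [RHS]mxE.
rewrite -[LHS]mul1mx -ac -mulmxA (_ : c *m Y = 1%:M) ?mulmx1 //.
apply/matrixP => p q; rewrite !mxE.
transitivity (S' ((b *m a) q p)); last by rewrite ba mxE [LHS]SL_anti_nat eq_sym.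
rewrite mxE [RHS]SL_anti_sum; apply: eq_bigr => l _.
rewrite [RHS]SL_antiM -/(S' _) -/(S' (b q l)) [Y _ _]mxE; congr (_ * _).
by rewrite /S' SL_anti_gen mxE.
Qed.

Lemma SL_anti_inv i j : S (c j i) = a i j.
Proof.
pose Y : 'M[SLE]_n := \matrix_(i, j) S (c j i).
suff /matrixP/(_ i j) : Y = a by rewrite mxE.
rewrite -[LHS]mulmx1 -ba mulmxA (_ : Y *m b = 1%:M) ?mul1mx //.
apply/matrixP => p q; rewrite !mxE.
transitivity (S ((a^T *m c) q p)); last by rewrite ac mxE [LHS]SL_anti_nat eq_sym.
rewrite mxE [RHS]SL_anti_sum; apply: eq_bigr => l _.
rewrite [a^T _ _]mxE [RHS]SL_antiM -/(S _) -/(S (a l q)) [Y _ _]mxE.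
by congr (_ * _); rewrite /S SL_anti_gen.
Qed.

Lemma SL_antiK : cancel S S'.
Proof.
apply: SL_linear_ext => //.
- move=> z x y; rewrite /S (SL_anti_linear SL_rel_anti).
  exact: (SL_anti_linear SL_rel_antiV).
- by rewrite /S SL_anti1; exact: SL_anti1.
move=> i j x ih; rewrite /S SL_antiM [LHS]SL_antiM [X in _ * X]ih.
by rewrite SL_anti_gen [X in X * _]SL_antiV_inv.
Qed.

Lemma SL_antiVK : cancel S' S.
Proof.
apply: SL_linear_ext => //.
- move=> z x y; rewrite /S' (SL_anti_linear SL_rel_antiV).
  exact: (SL_anti_linear SL_rel_anti).
- by rewrite /S' SL_anti1; exact: SL_anti1.
move=> i j x ih; rewrite /S' SL_antiM [LHS]SL_antiM [X in _ * X]ih.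
by rewrite SL_anti_gen mxE [X in X * _]SL_anti_inv.
Qed.

End InverseAntipode.

Lemma SL_hopf_exists (k : fieldType) (n m : nat) (E : m.+1.-tuple 'I_n -> k) :
  left_nondegenerate E -> right_nondegenerate E ->
  exists H : hopfAlgebra (SL E), SL_hopf H /\ bijective (antipode H).
Proof.
move=> lE rE.
have [b [ab ba]] := ex_inverse (SL_gen_rel E) lE rE.
have [c [ac ca]] := ex_inverse (SL_rel_tr (SL_gen_rel E)) lE rE.
exists (SL_hopfAlgebra ab ba); split; first exact: SL_hopfAlgebraP.
exists (SL_anti (SL_rel_antiV ac ca)).
- exact: (SL_antiK ab ba ac ca).
- exact: (SL_antiVK ab ba ac ca).
Qed.

Section HopfUnique.
Variables (k : fieldType) (n N : nat) (E : N.-tuple 'I_n -> k).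
Local Notation SLE := (SL E).
Local Notation a := (SL_mx E).
Variables (H : hopfAlgebra SLE) (HE : SL_hopf H).

(** The statements on sovereignty, cosemisimplicity and CQG structures concern every Hopf structure
    with the prescribed values on generators; this lemma, [counit_SL] and [antipode_SL] identify it
    with the one constructed. *)
Lemma comul_SL : comul H =1 SL_comul E.
Proof.
have [c1 cM] := comul_mul H.
apply: SL_linear_ext => [|||i j x ih]; [exact: linearP|exact: linearP| |].
  by rewrite c1 rmorph1.
by rewrite cM [RHS]rmorphM /= ih SL_comul_gen (HE i j).1.
Qed.

Lemma counit_SL : counit H =1 SL_counit E.
Proof.
apply: SL_linear_ext => [|||i j x ih]; [exact: linearP|exact: linearP| |].
  by rewrite !rmorph1.
by rewrite !rmorphM /= ih (HE i j).2 SL_counit_gen.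
Qed.

Lemma tlift_comul (W : lmodType k) (f : SLE -> SLE -> W) i j x : bilin f ->
  tlift f (comul H (a i j * x)) =
  \sum_l tlift (fun y z => f (a i l * y) (a l j * z)) (comul H x).
Proof. by move=> bf; rewrite !comul_SL tlift_comul_gen. Qed.

Section AntipodeUnique.
Variables (b : 'M[SLE]_n) (ab : a *m b = 1%:M) (ba : b *m a = 1%:M).

(** Uniqueness of convolution inverses: both maps invert the identity. *)
Lemma antipode_SL x : antipode H x = SL_anti (SL_rel_anti ab ba) x.
Proof.
pose S : {linear SLE -> SLE} := mk_linear (SL_anti_linear (SL_rel_anti ab ba)).
rewrite -[RHS]/(S x).
have [_ S2] := SL_anti_conv ab ba.
have idS y : conv H idfun S y = (counit H y)%:A.
  by rewrite /conv comul_SL counit_SL -S2.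
have Sid y : conv H (antipode H) idfun y = (counit H y)%:A by exact: antipodel.
transitivity (conv H (antipode H) (conv H idfun S) x).
  rewrite -[in LHS](comul_counitr H x) linear_sum; apply: eq_bigr => q _.
  by rewrite idS linearZ /= -scalerAr mulr1.
rewrite -convA -[in RHS](comul_counitl H x) [RHS]linear_sum.
apply: eq_bigr => q _.
by rewrite Sid [RHS]linearZ /= -scalerAl mul1r.
Qed.

End AntipodeUnique.
End HopfUnique.

(** * The sovereign character *)

Section Sovereign.
Variables (k : fieldType) (n m : nat) (E : m.+1.-tuple 'I_n -> k).
Local Notation SLE := (SL E).
Local Notation a := (SL_mx E).

Definition scalar_diag (g : 'I_n -> k) : 'M[k^o]_n := \matrix_(i, j) ((i == j)%:R * g i).

Lemma tpow_diag (g : 'I_n -> k) N (i j : N.-tuple 'I_n) :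
  tpow (scalar_diag g) i j = (i == j)%:R * \prod_(l < N) g (tnth i l).
Proof.
have [->|neq] := eqVneq i j.
  by rewrite mul1r; apply: eq_bigr => l _; rewrite mxE eqxx mul1r.
have [l hl] : exists l, tnth i l != tnth j l.
  apply/existsP; apply: contraNT neq; rewrite negb_exists => /forallP e.
  by apply/eqP/eq_from_tnth => l; apply/eqP; have := e l; rewrite negbK.
by rewrite mul0r /tpow (bigD1 l) //= mxE (negPf hl) !mul0r.
Qed.

Lemma SL_rel_diag (g : 'I_n -> k) :
  (forall i, \prod_(l < m.+1) g (tnth i l) * E i = E i) -> SL_rel E (scalar_diag g).
Proof.
move=> hg; apply/SL_relE; split=> i; rewrite (bigD1 i) //= tpow_diag eqxx mul1r;
  rewrite [X in _ + X]big1 ?addr0.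
- by rewrite [LHS]mulrC hg [RHS]mulr1.
- by move=> j /negPf ji; rewrite tpow_diag ji mul0r scaler0.
- by rewrite [LHS]mulrC hg [RHS]mulr1.
- by move=> j /negPf ji; rewrite tpow_diag eq_sym ji mul0r scaler0.
Qed.

Variable beta : 'I_n -> k.
Hypothesis beta0 : forall i, beta i != 0.
Hypothesis betaE : forall (i : 'I_n) (j : m.-tuple 'I_n),
  E [tuple of rcons j i] = beta i * E [tuple of i :: j].

(** Each letter moved from the end to the front costs its beta. A full rotation returns to the same
    tuple, which gives [prod_beta], the condition for diag(beta) to satisfy the relations. *)
Lemma rotate_form (s1 s2 : seq 'I_n) (t t' : m.+1.-tuple 'I_n) :
  val t = s1 ++ s2 -> val t' = s2 ++ s1 -> E t = \prod_(x <- s2) beta x * E t'.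
Proof.
elim/last_ind: s2 s1 t t' => [|s2 c ih] s1 t t' tE t'E.
  rewrite big_nil mul1r; congr E; apply: val_inj.
  by rewrite tE t'E cats0.
have [t0 [d tE0]] := tuple_lastP t.
have [ds t0E] : d = c /\ val t0 = s1 ++ s2.
  move: tE; rewrite tE0 /= -rcons_cat => /eqP; rewrite eqseq_rcons.
  by case/andP => /eqP -> /eqP ->.
rewrite tE0 betaE ds (ih (c :: s1) [tuple of c :: t0] t') /= ?t0E //; last first.
  by rewrite t'E cat_rcons.
by rewrite -cats1 big_cat big_seq1 /= mulrA [beta c * _]mulrC.
Qed.

Lemma prod_beta i : \prod_(l < m.+1) beta (tnth i l) * E i = E i.
Proof.
rewrite [RHS](@rotate_form [::] i i i) ?cats0 //; congr (_ * _).
by rewrite big_tuple.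
Qed.

Lemma prod_betaV i : \prod_(l < m.+1) (beta (tnth i l))^-1 * E i = E i.
Proof.
rewrite prodfV -[in LHS](prod_beta i) mulKf //.
by apply/prodf_neq0 => l _.
Qed.

(** The factor beta d rescales the left dual family into a right dual one; the inverse of beta c
    comes from moving c from the last to the first slot of E. *)
Lemma linv_rinv (x : 'I_n -> {ffun m.-tuple 'I_n -> k}) (d c : 'I_n) :
  rinv E a^T (fun d => [ffun i => beta d * x d i]) c d =
  (beta d * (beta c)^-1) *: linv E a x d c.
Proof.
rewrite !mxE scaler_sumr; apply: eq_bigr => i _; rewrite ffunE !scalerA.
rewrite scaler_sumr [RHS]scaler_sumr; apply: eq_bigr => j _; rewrite !scalerA betaE.
congr (_ *: _); last by apply: eq_bigr => l _; rewrite mxE.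
rewrite [beta d / beta c]mulrC -!mulrA [x d i * (beta c * _)]mulrCA.
by rewrite [beta d * (beta c * _)]mulrCA mulKf.
Qed.

Hypotheses (lE : left_nondegenerate E) (rE : right_nondegenerate E).

Lemma ex_inverses_beta : exists b c : 'M[SLE]_n,
  [/\ a *m b = 1%:M, b *m a = 1%:M, a^T *m c = 1%:M, c *m a^T = 1%:M &
   forall i j, c j i = (beta i * (beta j)^-1) *: b i j].
Proof.
have [b [ab ba]] := ex_inverse (SL_gen_rel E) lE rE.
have [c [ac ca]] := ex_inverse (SL_rel_tr (SL_gen_rel E)) lE rE.
exists b, c; split=> // i j.
have [x hx] := boolp.choice (fun d => lE (delta_mx 0 d)).
have := linvP (SL_gen_rel E) hx => xa.
have -> : b = linv E a x by rewrite -[RHS]mulmx1 -ab mulmxA xa mul1mx.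
rewrite -linv_rinv; set y := (fun d => _).
have hy : right_dual E y.
  move=> d; apply/rowP => e; have /rowP/(_ e) := hx d; rewrite !mxE eqxx /= => xE.
  transitivity (beta d / beta e * (e == d)%:R); last first.
    by have [->|_] := eqVneq e d; rewrite ?mulr0 // mulr1 divff.
  rewrite -xE mulr_sumr; apply: eq_bigr => t _; rewrite ffunE betaE.
  rewrite [beta d / beta e]mulrC -!mulrA [x d t * (beta e * _)]mulrCA.
  by rewrite [beta d * (beta e * _)]mulrCA mulKf.
have ay := rinvP (SL_rel_tr (SL_gen_rel E)) hy.
have -> : c = rinv E a^T y by rewrite -[LHS]mulmx1 -ay mulmxA ca mul1mx.
by [].
Qed.

Lemma SL_sovereign (H : hopfAlgebra SLE) : SL_hopf H ->
  exists Phi : {lrmorphism SLE -> k^o},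
    is_sovereign H Phi /\ forall i j, Phi (a i j) = (i == j)%:R * beta i.
Proof.
move=> HE; have [b [c [ab ba ac ca cE]]] := ex_inverses_beta.
pose Phi : {lrmorphism SLE -> k^o} := SL_ext (SL_rel_diag prod_beta).
pose Psi : {lrmorphism SLE -> k^o} := 
    SL_ext (@SL_rel_diag (fun i => (beta i)^-1) prod_betaV).
have PhiE i j : Phi (a i j) = (i == j)%:R * beta i.
  by rewrite [LHS]SL_extE mxE.
have PsiE i j : Psi (a i j) = (i == j)%:R * (beta i)^-1.
  by rewrite [LHS]SL_extE mxE.
exists Phi; split=> //.
exists (SL_anti (SL_rel_antiV ac ca)), Psi.
have conv_chars (F G : {lrmorphism SLE -> k^o}) (f g : 'I_n -> k) :
    (forall i j, F (a i j) = (i == j)%:R * f i) ->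
    (forall i j, G (a i j) = (i == j)%:R * g i) -> (forall i, f i * g i = 1) ->
    conv H F G =1 counit H.
  move=> FE GE fg; have bFG := mul_bilin F G.
  apply: SL_linear_ext => [||| i j x ih]; first exact: (conv_linear H F G).
  - exact: linearP.
  - by rewrite /conv (comul_mul H).1 (tlift_pure bFG) !rmorph1 mulr1.
  rewrite /conv (tlift_comul HE _ _ _ bFG) (bigD1 i) //= [X in _ + X]big1 ?addr0.
    rewrite rmorphM /= (HE i j).2 -ih [RHS]mulr_sumr; apply: eq_bigr => q _.
    by rewrite !rmorphM /= FE GE eqxx mul1r mulrACA [f i * _]mulrCA fg mulr1.
  move=> l li; apply: big1 => q _.
  by rewrite rmorphM /= FE eq_sym (negPf li) !mul0r.
split.
- by split=> x; rewrite !(antipode_SL HE ab ba); [exact: SL_antiK|exact: SL_antiVK].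
- by apply: conv_chars PhiE PsiE _ => i; rewrite divff.
- by apply: conv_chars PsiE PhiE _ => i; rewrite mulVf.
have l1 (F : {linear SLE -> k^o}) : linear (fun x : SLE => (F x : k)%:A : SLE).
  by move=> z x y; rewrite linearP scalerDl scalerA.
pose F1 : {linear SLE -> SLE} := mk_linear (l1 Phi).
pose G1 : {linear SLE -> SLE} := mk_linear (l1 Psi).
pose S := antipode H.
have bFS := mul_bilin F1 S.
pose FS : {linear SLE -> SLE} := mk_linear (conv_linear H F1 S).
have bFSG := mul_bilin FS G1.
have SM i j y : S (a i j * y) = S y * b i j.
  by rewrite /S !(antipode_SL HE ab ba) SL_antiM SL_anti_gen.
have S1 : S 1 = 1 by rewrite /S (antipode_SL HE ab ba) SL_anti1.
(* Characters diagonal on the generators keep one term of the coproduct, so the triple convolution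
   sends a_ij to beta_i b_ij / beta_j, which is c_ji, the value of the inverse antipode. *)
have FSM i j x : FS (a i j * x) = beta i *: (FS x * b i j).
  rewrite [LHS](tlift_comul HE _ _ _ bFS) (bigD1 i) //= [X in _ + X]big1 ?addr0.
    rewrite [in RHS]mulr_suml scaler_sumr; apply: eq_bigr => q _.
    rewrite /F1 /mk_linear rmorphM /= PhiE eqxx mul1r.
    by rewrite SM -!scalerAl !mul1r scalerA.
  move=> l li; apply: big1 => q _; rewrite /F1 /mk_linear rmorphM /= PhiE.
  by rewrite eq_sym (negPf li) !mul0r scale0r mul0r.
have F11 : F1 1 = 1.
  transitivity ((1 : k)%:A : SLE); last exact: scale1r.
  by congr (_ *: _); exact: (rmorph1 Phi).
have G1M i j x : G1 (a i j * x) = ((i == j)%:R * (beta i)^-1) *: G1 x.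
  rewrite scalerA -PsiE; congr (_ *: _); exact: (rmorphM Psi).
have G11 : G1 1 = 1.
  transitivity ((1 : k)%:A : SLE); last exact: scale1r.
  by congr (_ *: _); exact: (rmorph1 Psi).
have FS1 : FS 1 = 1.
  rewrite /FS /= /mk_linear /conv (comul_mul H).1 (tlift_pure bFS).
  by rewrite [F1 1]F11 S1 mulr1.
apply: SL_linear_ext => [||| i j x ih].
- exact: (SL_anti_linear (SL_rel_antiV ac ca)).
- exact: (conv_linear H FS G1).
- rewrite SL_anti1 [RHS](_ : _ = FS 1 * G1 1).
    by rewrite FS1 G11 mulr1.
  rewrite -[LHS]/(tlift (fun y z => FS y * G1 z) (comul H 1)) (comul_mul H).1.
  exact: (tlift_pure bFSG).
rewrite SL_antiM SL_anti_gen mxE ih cE.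
rewrite [RHS](_ : _ = tlift (fun y z => FS y * G1 z) (comul H (a i j * x))) //.
rewrite (tlift_comul HE _ _ _ bFSG) (bigD1 j) //= [X in _ + X]big1 ?addr0.
  rewrite [LHS]mulr_suml; apply: eq_bigr => q _; rewrite FSM G1M eqxx mul1r.
  rewrite -[conv H _ _ q.1]/(FS q.1) -[(Psi q.2)%:A]/(G1 q.2).
  have -> : G1 q.2 = (Psi q.2 : k)%:A by [].
  rewrite -!(scalerAl, scalerAr) !mulr1 !scalerA; congr (_ *: _).
  by rewrite mulrA.
move=> l lj; apply: big1 => q _; rewrite -[mk_linear _ (a l j * _)]/(G1 (a l j * q.2)).
by rewrite G1M (negPf lj) mul0r scale0r mulr0.
Qed.

End Sovereign.

(** * Tensor powers of the fundamental comodule *)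

Section Corepresentations.
Variables (k : fieldType) (n N : nat) (E : N.-tuple 'I_n -> k).
Local Notation SLE := (SL E).
Local Notation a := (SL_mx E).

(** Arbitrary finite index types spare any renumbering in direct sums and tensor products;
    [family_mx] renumbers once. *)
Definition sum_family (I J : finType) (u : I -> I -> SLE) (v : J -> J -> SLE)
  (x y : I + J) : SLE :=
  match x, y with
  | inl i, inl j => u i j
  | inr i, inr j => v i j
  | _, _ => 0
  end.

Definition prod_family (I J : finType) (u : I -> I -> SLE) (v : J -> J -> SLE)
  (x y : I * J) : SLE := u x.1 y.1 * v x.2 y.2.

(* Direct sums of tensor powers of the fundamental comodule *)
Inductive tensorial : forall I : finType, (I -> I -> SLE) -> Prop :=
| tensorial_unit : @tensorial unit (fun _ _ => 1)
| tensorial_gen : @tensorial 'I_n (fun i j => a i j)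
| tensorial_sum (I J : finType) (u : I -> I -> SLE) (v : J -> J -> SLE) :
    tensorial u -> tensorial v -> tensorial (sum_family u v)
| tensorial_prod (I J : finType) (u : I -> I -> SLE) (v : J -> J -> SLE) :
    tensorial u -> tensorial v -> tensorial (prod_family u v).

Lemma tensorial_mult (H : hopfAlgebra SLE) (I : finType) (u : I -> I -> SLE) :
  SL_hopf H -> tensorial u -> forall i j,
  comul H (u i j) = \sum_l u i l ⊗ u l j /\ counit H (u i j) = (i == j)%:R.
Proof.
move=> HE; have [c1 cM] := comul_mul H.
elim=> {I u} [i j|i j|I J u v _ ihu _ ihv|I J u v _ ihu _ ihv].
- rewrite (big_pred1 tt) => [|[]//]; rewrite c1 rmorph1.
  by case: i j => [] [].
- by have [-> ->] := HE i j.
- move=> [i|i] [j|j] /=; rewrite big_sumType /= ?linear0;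
    under eq_bigr do rewrite ?tpure0l ?tpure0r;
    under [X in _ = _ + X /\ _]eq_bigr do rewrite ?tpure0l ?tpure0r;
    rewrite ?sumr_const ?mul0rn ?big1_eq ?addr0 ?add0r.
  + exact: ihu.
  + by [].
  + by [].
  + exact: ihv.
- move=> [i i'] [j j']; rewrite /prod_family /= cM rmorphM /=.
  have [-> ->] := ihu i j; have [-> ->] := ihv i' j'; split; last first.
    by rewrite xpair_eqE -mulnb natrM.
  rewrite big_distrlr pair_big.
  by apply: eq_bigr => -[l l'] _; exact: tpureM.
Qed.

(** Stated for ring morphisms in order to cover x |-> 1 (x) x into a scalar extension, which is
    linear over the subfield only. *)
Lemma tensorial_ext (I : finType) (u : I -> I -> SLE) (B : nzRingType)
  (f g : {rmorphism SLE -> B}) : tensorial u ->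
  (forall i j, f (a i j) = g (a i j)) -> forall i j, f (u i j) = g (u i j).
Proof.
move=> tu fg; elim: tu => {I u} [i j|i j|I J u v _ ihu _ ihv|I J u v _ ihu _ ihv].
- by rewrite !rmorph1.
- exact: fg.
- by move=> [i|i] [j|j] /=; rewrite ?rmorph0.
- by move=> i j; rewrite /prod_family !rmorphM /= ihu ihv.
Qed.

Lemma tensorial_tr (I : finType) (u : I -> I -> SLE) (f : {rmorphism SLE -> SLE}) :
  tensorial u ->
  (forall i j, f (a i j) = a j i) -> forall i j, f (u i j) = u j i.
Proof.
move=> tu fg; elim: tu => {I u} [i j|i j|I J u v _ ihu _ ihv|I J u v _ ihu _ ihv].
- by rewrite !rmorph1.
- exact: fg.
- by move=> [i|i] [j|j] /=; rewrite ?rmorph0.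
- by move=> i j; rewrite /prod_family !rmorphM /= ihu ihv.
Qed.

Definition spans (I : finType) (u : I -> I -> SLE) (x : SLE) :=
  exists r : I -> I -> k, x = \sum_i \sum_j r i j *: u i j.

Lemma spans_suml (I J : finType) (u : I -> I -> SLE) (v : J -> J -> SLE) x :
  spans u x -> spans (sum_family u v) x.
Proof.
move=> [r ->].
exists (fun i j => match i, j with inl i, inl j => r i j | _, _ => 0 end).
rewrite big_sumType /= [X in _ + X]big1 ?addr0 => [|i _].
  apply: eq_bigr => i _; rewrite big_sumType /= [X in _ + X]big1 ?addr0 // => j _.
  by rewrite scale0r.
by rewrite big_sumType /= !big1 ?addr0 // => j _; rewrite scale0r.
Qed.

Lemma spans_sumr (I J : finType) (u : I -> I -> SLE) (v : J -> J -> SLE) x :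
  spans v x -> spans (sum_family u v) x.
Proof.
move=> [r ->].
exists (fun i j => match i, j with inr i, inr j => r i j | _, _ => 0 end).
rewrite big_sumType /= [X in X + _]big1 ?add0r => [|i _].
  apply: eq_bigr => i _; rewrite big_sumType /= [X in X + _]big1 ?add0r // => j _.
  by rewrite scale0r.
by rewrite big_sumType /= !big1 ?addr0 // => j _; rewrite scale0r.
Qed.

Lemma spansP (I : finType) (u : I -> I -> SLE) c x y :
  spans u x -> spans u y -> spans u (c *: x + y).
Proof.
move=> [r ->] [r' ->]; exists (fun i j => c * r i j + r' i j).
rewrite scaler_sumr -big_split; apply: eq_bigr => i _.
rewrite scaler_sumr -big_split; apply: eq_bigr => j _ /=.
by rewrite scalerDl scalerA.
Qed.

(** Multiplication by a generator is matched by tensoring with the fundamental comodule, and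
    addition by a direct sum. *)
Lemma ex_spans x : exists (I : finType) (u : I -> I -> SLE), tensorial u /\ spans u x.
Proof.
move: x; apply: SL_ind => [|i j x [I [u [tu [r ->]]]]|c x y [I [u [tu ux]]] [J [v [tv vy]]]].
- exists unit, (fun _ _ => 1); split; first exact: tensorial_unit.
  exists (fun _ _ => 1); rewrite (big_pred1 tt) => [|[]//].
  by rewrite (big_pred1 tt) => [|[]//]; rewrite scale1r.
- exists ('I_n * I)%type, (prod_family (fun i j => a i j) u); split.
    exact: tensorial_prod tensorial_gen tu.
  exists (fun p q => (p.1 == i)%:R * (q.1 == j)%:R * r p.2 q.2).
  rewrite -(pair_big predT predT (fun i' p => \sum_q
    ((i' == i)%:R * (q.1 == j)%:R * r p q.2) *: prod_family (fun i j => a i j) u (i', p) q)) /=.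
  rewrite [RHS](bigD1 i) //= [X in _ + X]big1 ?addr0 => [|i' /negPf i'i].
    rewrite mulr_sumr; apply: eq_bigr => p _.
    rewrite -(pair_big predT predT (fun j' q =>
      ((i == i)%:R * (j' == j)%:R * r p q) *: prod_family (fun i j => a i j) u (i, p) (j', q))) /=.
    rewrite [RHS](bigD1 j) //= [X in _ + X]big1 ?addr0 => [|j' /negPf j'j].
      by rewrite mulr_sumr; apply: eq_bigr => q _; rewrite !eqxx !mul1r scalerAr.
    by apply: big1 => q _; rewrite j'j mulr0 mul0r scale0r.
  by apply: big1 => p _; apply: big1 => q _; rewrite i'i !mul0r scale0r.
- exists (I + J)%type, (sum_family u v); split; first exact: tensorial_sum.
  by apply: spansP; [exact: spans_suml|exact: spans_sumr].
Qed.

Definition family_mx (I : finType) (u : I -> I -> SLE) : 'M[SLE]_#|I| :=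
  \matrix_(i, j) u (enum_val i) (enum_val j).

Lemma spans_coefs (I : finType) (u : I -> I -> SLE) x :
  spans u x -> x \in coefs (family_mx u).
Proof.
move=> [r ->]; apply/asboolP; exists (\matrix_(i, j) r (enum_val i) (enum_val j)).
rewrite (reindex (@enum_val I I)) /=; last exact/onW_bij/enum_val_bij.
apply: eq_bigr => i _; rewrite (reindex (@enum_val I I)) /=; last exact/onW_bij/enum_val_bij.
by apply: eq_bigr => j _; rewrite !mxE.
Qed.

Lemma family_mult (H : hopfAlgebra SLE) (I : finType) (u : I -> I -> SLE) :
  SL_hopf H -> tensorial u -> multiplicative_matrix H (family_mx u).
Proof.
move=> HE tu i j; rewrite mxE; have [-> ->] := tensorial_mult HE tu (enum_val i) (enum_val j).
rewrite (inj_eq enum_val_inj); split=> //.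
rewrite (reindex (@enum_val I I)) /=; last exact/onW_bij/enum_val_bij.
by apply: eq_bigr => l _; rewrite !mxE.
Qed.

Lemma ex_tensorial (s : seq SLE) : exists (I : finType) (u : I -> I -> SLE),
  tensorial u /\ {subset s <= coefs (family_mx u)}.
Proof.
suff [I [u [tu us]]] : exists (I : finType) (u : I -> I -> SLE),
    tensorial u /\ forall x, x \in s -> spans u x.
  by exists I, u; split=> // x /us; exact: spans_coefs.
elim: s => [|x s [I [u [tu us]]]].
  by exists unit, (fun _ _ => 1); split; first exact: tensorial_unit.
have [J [v [tv vx]]] := ex_spans x.
exists (I + J)%type, (sum_family u v); split; first exact: tensorial_sum.
move=> y; rewrite inE => /orP[/eqP->|/us]; first exact: spans_sumr.
exact: spans_suml.
Qed.

Section Transposition.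
Variables (sigma : {rmorphism k -> k}) (sigmaE : forall j, sigma (E j) = E j).

(** Twisting the scalars of the target makes the resulting morphism sigma-semilinear. It serves with
    sigma the identity for cosemisimplicity and with complex conjugation for the star. *)
Lemma SL_rel_restr_tr : SL_rel E (a^T : 'M[restr sigma SLE]_n).
Proof.
have [r1 r2] := SL_rel_tr (SL_gen_rel E).
split=> i; [rewrite [RHS]restrE sigmaE -[RHS]r1|rewrite [RHS]restrE sigmaE -[RHS]r2];
  by apply: eq_bigr => j _; rewrite [LHS]restrE sigmaE.
Qed.

Definition SL_tr : SLE -> SLE := SL_ext SL_rel_restr_tr.

Lemma SL_tr_rmorphism : monoid_morphism SL_tr.
Proof.
split; first exact: (rmorph1 (SL_ext SL_rel_restr_tr)).
exact: (rmorphM (SL_ext SL_rel_restr_tr)).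
Qed.

Lemma SL_tr_additive : zmod_morphism SL_tr.
Proof. exact: (raddfB (SL_ext SL_rel_restr_tr)). Qed.

HB.instance Definition _ := GRing.isZmodMorphism.Build SLE SLE SL_tr SL_tr_additive.
HB.instance Definition _ := GRing.isMonoidMorphism.Build SLE SLE SL_tr SL_tr_rmorphism.

Lemma SL_tr_gen i j : SL_tr (a i j) = a j i.
Proof. by rewrite [LHS]SL_extE mxE. Qed.

Lemma SL_trZ c x : SL_tr (c *: x) = sigma c *: SL_tr x.
Proof. exact: (SL_eval_scale SL_rel_restr_tr). Qed.

End Transposition.

End Corepresentations.

(** * Base change from a subfield *)

(* k ⊗_F B, as a k-algebra *)
Definition extend (F k : fieldType) (iota : {rmorphism F -> k}) (B : algType F) :
  Type := tens (restr iota k^o) B.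

Section Extension.
Variables (F k : fieldType) (iota : {rmorphism F -> k}) (B : algType F).
Local Notation T := (extend iota B).
Local Notation kF := (restr iota k^o).

HB.instance Definition _ := GRing.NzRing.copy T (tens kF B).

Definition ext_scalar (c : k) : T := (c : kF) ⊗ (1 : B).
Definition ext_scale (c : k) (t : T) : T := ext_scalar c * t.

Lemma ext_scaleA c d t : ext_scale c (ext_scale d t) = ext_scale (c * d) t.
Proof.
rewrite /ext_scale mulrA; congr (_ * t).
by rewrite [LHS]tpureM mulr1.
Qed.

Lemma ext_scale1 : left_id 1 ext_scale.
Proof. by move=> t; rewrite /ext_scale [ext_scalar 1](_ : _ = 1) ?mul1r. Qed.

Lemma ext_scaleDr : right_distributive ext_scale +%R.
Proof. by move=> c s t; rewrite /ext_scale mulrDr. Qed.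

Lemma ext_scaleDl t : {morph ext_scale^~ t : c d / c + d}.
Proof.
move=> c d; rewrite /ext_scale -mulrDl; congr (_ * t).
exact: tpureDl.
Qed.

HB.instance Definition _ := GRing.Zmodule_isLmodule.Build k T
  ext_scaleA ext_scale1 ext_scaleDr ext_scaleDl.

Lemma ext_scaleAl (c : k) (s t : T) : c *: (s * t) = (c *: s) * t.
Proof. exact: mulrA. Qed.

HB.instance Definition _ := GRing.Lmodule_isLalgebra.Build k T ext_scaleAl.

Lemma ext_scalar_comm (c : kF) (t : tens kF B) : (c ⊗ 1) * t = t * (c ⊗ 1).
Proof.
rewrite [t]tens_sum mulr_sumr mulr_suml; apply: eq_bigr => p _.
by rewrite !tpureM mul1r mulr1 [c * _]mulrC.
Qed.

Lemma ext_scaleAr (c : k) (s t : T) : c *: (s * t) = s * (c *: t).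
Proof.
rewrite -[LHS]/(ext_scalar c * (s * t)) -[c *: t]/(ext_scalar c * t).
by rewrite !mulrA [_ * s]ext_scalar_comm.
Qed.

HB.instance Definition _ := GRing.Lalgebra_isAlgebra.Build k T ext_scaleAr.

Definition ext_incl (x : B) : T := (1 : kF) ⊗ x.

Lemma ext_incl_additive : zmod_morphism ext_incl.
Proof.
move=> x y; by rewrite /ext_incl -scaleN1r tpureDr tpureZr scaleN1r.
Qed.

Lemma ext_incl_monoid : monoid_morphism ext_incl.
Proof. by split=> // x y; rewrite [RHS]tpureM mul1r. Qed.

HB.instance Definition _ := GRing.isZmodMorphism.Build B T ext_incl ext_incl_additive.
HB.instance Definition _ := GRing.isMonoidMorphism.Build B T ext_incl ext_incl_monoid.

Lemma ext_inclZ c x : ext_incl (c *: x) = iota c *: ext_incl x.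
Proof.
rewrite -[RHS]/(ext_scalar (iota c) * ext_incl x) [RHS]tpureM mulr1 mul1r.
rewrite [LHS]tpureZr -[LHS]tpureZl.
by congr (_ ⊗ _); rewrite restrE [LHS]mulr1.
Qed.

Section ExtFunctional.
Variable phi : {linear B -> F^o}.

(** The k-linear extension of the F-linear functional phi. *)
Definition ext_functional (t : T) : k^o :=
  tlift (fun (c : kF) (x : B) => (c * iota (phi x) : kF)) t.

Lemma ext_bilin : bilin (fun (c : kF) (x : B) => (c * iota (phi x) : kF)).
Proof.
apply: bilinI => [x|c] d u v /=.
- by rewrite mulrDl scalerAl.
- by rewrite linearP rmorphD rmorphM mulrDr; congr (_ + _); rewrite mulrCA.
Qed.

Lemma ext_functional_linear : linear ext_functional.
Proof.
move=> c s t; rewrite /ext_functional.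
transitivity (tlift (fun (c : kF) (x : B) => (c * iota (phi x) : kF)) (c *: s) +
   tlift (fun (c : kF) (x : B) => (c * iota (phi x) : kF)) t).
  exact: (tliftD ext_bilin).
congr (_ + _); rewrite -[c *: s]/((c : kF) ⊗ (1 : B) * (s : tens kF B)).
rewrite (tlift_pureM _ _ _ ext_bilin) [RHS]mulr_sumr; apply: eq_bigr => p _.
by rewrite mul1r mulrA.
Qed.

Lemma ext_functional_incl x : ext_functional (ext_incl x) = iota (phi x).
Proof. by rewrite /ext_functional [LHS](tlift_pure ext_bilin) mul1r. Qed.

End ExtFunctional.
End Extension.

Section BaseChange.
Variables (F k : fieldType) (iota : {rmorphism F -> k}).
Variables (n N : nat) (E : N.-tuple 'I_n -> k) (EF : N.-tuple 'I_n -> F).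
Hypothesis EFE : forall j, iota (EF j) = E j.
Local Notation SLE := (SL E).
Local Notation a := (SL_mx E).
Local Notation T := (extend iota (restr iota SLE)).

Definition ext_mx : 'M[T]_n := \matrix_(i, j) ext_incl iota (a i j : restr iota SLE).

Lemma tpow_ext_mx (i j : N.-tuple 'I_n) :
  tpow ext_mx i j = ext_incl iota (tpow a i j : restr iota SLE).
Proof. by rewrite [RHS]rmorph_prod; apply: eq_bigr => l _; rewrite mxE. Qed.

(** The coefficients of E come from F, so they move across the tensor sign. *)
Lemma ext_mx_rel : SL_rel E ext_mx.
Proof.
have [r1 r2] := (SL_relE E a).1 (SL_gen_rel E).
pose incl : {rmorphism restr iota SLE -> T} := @ext_incl F k iota (restr iota SLE).
have inclZ c (x : restr iota SLE) : iota c *: (incl x : T) = incl (c *: x).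
  by rewrite -ext_inclZ.
have one i : E i *: (1 : T) = incl (E i *: (1 : SLE)).
  by rewrite -[1 in LHS](rmorph1 incl) -EFE inclZ restrE.
apply/SL_relE; split=> i; [rewrite one -r1|rewrite one -r2];
  rewrite [RHS](rmorph_sum incl); apply: eq_bigr => j _;
  by rewrite tpow_ext_mx -EFE inclZ.
Qed.

(* Applying lambda to the coefficients of the relations over k between the
   entries of u gives relations again. *)
Lemma base_change_functional (lambda : {linear restr iota k^o -> F^o})
    (g : {linear SLE -> k^o}) :
  exists f : {linear SLE -> k^o}, forall (I : finType) (u : I -> I -> SLE),
    tensorial u -> forall i j, f (u i j) = iota (lambda (g (u i j))).
Proof.
have lphi : linear (fun x : restr iota SLE => lambda (g x : restr iota k^o) : F^o).
  by move=> c x y; rewrite restrE linearP -[_ *: g x]/(c *: (g x : restr iota k^o)) linearP.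
pose phi : {linear restr iota SLE -> F^o} := mk_linear lphi.
(* This k-linear morphism and the F-linear inclusion x |-> 1 (x) x agree on the generators, hence on
   the entries of u. *)
pose beta : {lrmorphism SLE -> T} := SL_ext ext_mx_rel.
have lf : linear (fun x : SLE => ext_functional phi (beta x)).
  by move=> c x y; rewrite linearP ext_functional_linear.
exists (mk_linear lf : {linear SLE -> k^o}) => I u tu i j; rewrite /mk_linear.
pose incl0 : {rmorphism restr iota SLE -> T} := @ext_incl F k iota (restr iota SLE).
pose incl : {rmorphism SLE -> T} := incl0.
transitivity (ext_functional phi (incl (u i j))); last exact: ext_functional_incl.
congr (ext_functional _ _); apply: (tensorial_ext (f := beta) (g := incl) tu) => p q.
by rewrite [LHS]SL_extE mxE.
Qed.

End BaseChange.

(** * Separability over an ordered field *)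

Lemma mxvec_dot (R : comPzRingType) d (x y : 'M[R]_d) :
  (mxvec x *m (mxvec y)^T) 0 0 = \tr (x *m y^T).
Proof.
rewrite mxE (reindex _ (curry_mxvec_bij d d)) /=.
under [RHS]eq_bigr do rewrite mxE.
rewrite pair_bigA; apply: eq_bigr => -[i j] _ /=.
by rewrite [(mxvec y)^T _ _]mxE [y^T _ _]mxE !mxvecE.
Qed.

Lemma row_dot0 (F : realFieldType) d (x : 'rV[F]_d) : (x *m x^T) 0 0 = 0 -> x = 0.
Proof.
rewrite mxE => x0; apply/rowP => j; rewrite mxE.
have s0 : \sum_j x 0 j ^+ 2 = 0.
  by rewrite -[RHS]x0; apply: eq_bigr => i _; rewrite mxE.
have /(_ j isT)/eqP := psumr_eq0P (fun i _ => sqr_ge0 (x 0 i)) s0.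
by rewrite sqrf_eq0 => /eqP.
Qed.

Section GramSeparability.
Variables (F : realFieldType) (d : nat) (S : {pred 'M[F]_d}).
Hypotheses (Ssub : submod_closed S) (S1 : 1%:M \in S).
Hypothesis SM : forall x y, x \in S -> y \in S -> x *m y \in S.
Hypothesis ST : forall x, x \in S -> x^T \in S.

Lemma Ssum (I : finType) (G : I -> 'M[F]_d) (c : I -> F) :
  (forall i, G i \in S) -> \sum_i c i *: G i \in S.
Proof.
move=> h; elim/big_rec: _ => [|i x _ Sx]; first by case: Ssub.
by case: Ssub => _; apply.
Qed.

(** The rows of K give a basis e of S, f is its dual basis for tr(x y^T), and e' is f transposed;
    positivity makes the Gram matrix invertible. The last sum is the Casimir element. *)
Lemma gram_dual_bases : exists r (e e' : 'I_r -> 'M[F]_d),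
  [/\ forall s, e s \in S, forall s, e' s \in S,
      forall b, b \in S -> b = \sum_s \tr (b *m e' s) *: e s,
      forall b, b \in S -> b = \sum_s \tr (e s *m b) *: e' s &
      \sum_s e' s *m e s \in unitmx].
Proof.
have [|A0 A0E] := @ex_rowspace F (d * d) [pred v | vec_mx v \in S].
  case: Ssub => S0 Sl; split=> [|c v w]; rewrite !inE ?linear0 //.
  by rewrite linearP; exact: Sl.
have [r [K [Kfree KE]]] : exists r (K : 'M[F]_(r, d * d)),
    row_free K /\ forall v, (v <= K)%MS = (vec_mx v \in S).
  exists (\rank A0), (row_base A0); split; first exact: row_base_free.
  by move=> v; rewrite eq_row_base A0E.
pose G := K *m K^T.
have Gunit : G \in unitmx.
  rewrite -row_free_unit; apply: inj_row_free => v; rewrite mulmxA => vG.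
  apply: (row_free_inj Kfree); rewrite mul0mx; apply: row_dot0.
  by rewrite trmx_mul mulmxA vG mul0mx mxE.
have GT : G^T = G by rewrite trmx_mul trmxK.
pose L := invmx G *m K.
have LE : (L <= K)%MS by exact: submxMl.
pose e s := vec_mx (row s K); pose f s := vec_mx (row s L).
have eS s : e s \in S by rewrite -KE row_sub.
have fS s : f s \in S by rewrite -KE (submx_trans _ LE) // row_sub.
have KL : K^T *m L = L^T *m K by rewrite [L^T]trmx_mul trmx_inv GT mulmxA.
have KLid b : b \in S -> mxvec b *m (K^T *m L) = mxvec b.
  move=> bS; have /submxP[x ->] : (mxvec b <= K)%MS by rewrite KE mxvecK.
  by rewrite /L -!mulmxA (mulmxA K) (mulmxA G) mulmxV // mul1mx.
have expand (A C : 'M[F]_(r, d * d)) b : mxvec b *m (C^T *m A) = mxvec b ->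
    b = \sum_s \tr (b *m (vec_mx (row s C))^T) *: vec_mx (row s A).
  move=> bE; rewrite -[LHS]mxvecK -bE mulmxA mulmx_sum_row linear_sum.
  apply: eq_bigr => s _; rewrite linearZ /=; congr (_ *: _).
  rewrite -mxvec_dot vec_mxK !mxE; apply: eq_bigr => j _.
  by rewrite !mxE.
have exp1 b : b \in S -> b = \sum_s \tr (b *m (f s)^T) *: e s.
  by move=> bS; apply: expand; rewrite -KL KLid.
have exp2 b : b \in S -> b = \sum_s \tr (b *m (e s)^T) *: f s.
  by move=> bS; apply: expand; rewrite KLid.
exists r, e, (fun s => (f s)^T); split=> //.
- by move=> s; exact/ST/fS.
- move=> b bS; rewrite -[LHS]trmxK (exp2 _ (ST bS)) linear_sum.
  apply: eq_bigr => s _; rewrite linearZ /=; congr (_ *: _).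
  by rewrite -trmx_mul mxtrace_tr.
rewrite -row_free_unit; apply: inj_row_free => v vz.
pose c := v^T.
pose y i : 'rV[F]_r := \row_s (f s *m c) i 0.
have eE s : e s *m c = \sum_t G s t *: (f t *m c).
  have -> : e s = \sum_t G s t *: f t.
    rewrite /e (_ : K = G *m L); last by rewrite /L mulmxA mulmxV ?mul1mx.
    rewrite row_mul mulmx_sum_row linear_sum; apply: eq_bigr => t _.
    by rewrite linearZ mxE.
  by rewrite mulmx_suml; apply: eq_bigr => t _; rewrite scalemxAl.
(* v z v^T is a sum of squares, which all vanish. *)
have sum0 : \sum_i ((y i *m K) *m (y i *m K)^T) 0 0 = 0.
  transitivity ((v *m (\sum_s (f s)^T *m e s) *m c) 0 0); last first.
    by rewrite vz mul0mx mxE.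
  rewrite mulmx_sumr mulmx_suml summxE.
  transitivity (\sum_i \sum_s y i 0 s * (e s *m c) i 0).
    apply: eq_bigr => i _; rewrite trmx_mul mulmxA -(mulmxA _ K) -/G -mulmxA mxE.
    apply: eq_bigr => s _; congr (_ * _); rewrite eE summxE mxE.
    by apply: eq_bigr => t _; rewrite !mxE.
  rewrite exchange_big; apply: eq_bigr => s _ /=.
  rewrite !mulmxA -[v]trmxK -/c -trmx_mul -mulmxA mxE.
  by apply: eq_bigr => i _; rewrite !mxE.
have y0 i : y i = 0.
  apply: (row_free_inj Kfree); rewrite mul0mx; apply: row_dot0.
  apply: (psumr_eq0P _ sum0) => // j _; rewrite mxE; apply: sumr_ge0 => l _.
  by rewrite [_^T _ _]mxE -expr2 sqr_ge0.
have fc s : f s *m c = 0.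
  apply/colP => i; have /rowP/(_ s) := y0 i; rewrite !mxE => ->.
  by [].
(* The identity is a combination of the f s, all of which kill c. *)
apply: trmx_inj; rewrite -/c linear0 -[c]mul1mx (exp2 _ S1) mulmx_suml.
by rewrite big1 // => s _; rewrite -scalemxAl fc scaler0.
Qed.

(** Right multiplication by z is injective on the finite-dimensional S, hence onto, so 1 = x z with
    x in S. *)
Lemma submod_inv (z : 'M[F]_d) : z \in S -> z \in unitmx -> invmx z \in S.
Proof.
move=> zS zu; have [|A0 A0E] := @ex_rowspace F (d * d) [pred v | vec_mx v \in S].
  case: Ssub => S0 Sl; split=> [|c v w]; rewrite !inE ?linear0 //.
  by rewrite linearP; exact: Sl.
have A0L : (A0 *m lin_mulmxr z <= A0)%MS.
  apply/row_subP => i; rewrite A0E inE row_mul.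
  have := row_sub i A0; rewrite A0E inE => h.
  by rewrite -[row i A0]vec_mxK mul_vec_lin mxvecK /=; exact: SM.
have Lfree : row_free (lin_mulmxr z : 'M_(d * d)).
  apply: inj_row_free => v; rewrite -[v]vec_mxK mul_vec_lin /= => h.
  have := congr1 vec_mx h; rewrite mxvecK linear0 => /(congr1 (mulmxr (invmx z))).
  by rewrite /= mulmxK // mul0mx => ->; rewrite linear0.
have : (mxvec 1%:M <= A0 *m lin_mulmxr z)%MS.
  apply: (submx_trans (_ : (mxvec 1%:M <= A0)%MS)); first by rewrite A0E inE mxvecK.
  have := mxrank_leqif_sup A0L; rewrite mxrankMfree // => -[_].
  by rewrite eqxx => <-.
case/submxP => x; rewrite mulmxA -[x *m A0]vec_mxK mul_vec_lin => /(can_inj mxvecK) /= xz.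
have : vec_mx (x *m A0) \in S by have := submxMl x A0; rewrite A0E.
by rewrite -[vec_mx _](mulmxK zu) -xz mul1mx.
Qed.

(** Sharing M between the two expansions says that the sum of the h s (x) e s commutes with g,
    without forming a tensor product of algebras. *)
Definition separability_mx (k : fieldType) (P : {pred 'M[k]_d}) (r : nat)
    (e h : 'I_r -> 'M[k]_d) : Prop :=
  (forall g, g \in P -> exists M : 'M[k]_r,
     (forall s, e s *m g = \sum_t M s t *: e t) /\
     (forall t, g *m h t = \sum_s M s t *: h s)) /\
  \sum_s h s *m e s = 1%:M.

(** Dual bases give both expansions the coefficients tr(e_s g f_t). The Casimir element z commutes
    with S, so multiplying the f_s by its inverse keeps them and normalises the sum to 1. *)
Lemma gram_separability : exists r (e h : 'I_r -> 'M[F]_d),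
  [/\ forall s, e s \in S, forall s, h s \in S & separability_mx S e h].
Proof.
have [r [e [f [eS fS exp1 exp2 zu]]]] := gram_dual_bases.
set z := \sum_s _ in zu.
have zS : z \in S.
  rewrite /z; under eq_bigr do rewrite -[_ *m _]scale1r.
  by apply: Ssum => s; exact: SM.
pose M g : 'M[F]_r := \matrix_(s, t) \tr (e s *m g *m f t).
have eM g s : g \in S -> e s *m g = \sum_t M g s t *: e t.
  by move=> gS; rewrite [LHS]exp1 ?SM //; apply: eq_bigr => t _; rewrite mxE.
have fM g t : g \in S -> g *m f t = \sum_s M g s t *: f s.
  by move=> gS; rewrite [LHS]exp2 ?SM //; apply: eq_bigr => s _; rewrite mxE mulmxA.
have zC g : g \in S -> g *m z = z *m g.
  move=> gS; rewrite /z mulmx_sumr mulmx_suml.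
  under eq_bigr do rewrite mulmxA fM // mulmx_suml.
  under [RHS]eq_bigr do rewrite -mulmxA eM // mulmx_sumr.
  rewrite exchange_big; apply: eq_bigr => s _; apply: eq_bigr => t _.
  by rewrite -scalemxAl -scalemxAr.
have zVC g : g \in S -> g *m invmx z = invmx z *m g.
  by move=> gS; rewrite -[RHS](mulmxK zu) -(mulmxA _ g) zC // mulmxA mulVmx // mul1mx.
exists r, e, (fun s => invmx z *m f s); split=> //.
  by move=> s; apply: SM => //; exact: submod_inv.
split=> [g gS|]; last first.
  under eq_bigr do rewrite -mulmxA.
  by rewrite -mulmx_sumr mulVmx.
exists (M g); split=> [s|t]; first exact: eM.
rewrite mulmxA zVC // -mulmxA fM // mulmx_sumr; apply: eq_bigr => s _.
by rewrite scalemxAr.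
Qed.

End GramSeparability.

(** A finite-rank operator fixing the vectors met so far is corrected by its error at x times a
    functional equal to 1 at x and 0 on the fixed vectors. With V = k it resolves a matrix over k
    into matrices over F. *)
Lemma finite_dual_family (F : fieldType) (V : lmodType F) (s : seq V) :
  exists l : seq (V * {linear V -> F^o}),
    forall x, x \in s -> x = \sum_(p <- l) (p.2 x : F) *: p.1.
Proof.
elim: s => [|x s [l ls]]; first by exists [::].
pose D : {pred V} := [pred z | z == \sum_(p <- l) (p.2 z : F) *: p.1].
have Dsub : submod_closed D.
  split=> [|c y z]; rewrite !inE; first by rewrite big1 // => p _; rewrite linear0 scale0r.
  move=> /eqP yE /eqP zE; apply/eqP; rewrite {1}yE {1}zE scaler_sumr -big_split.
  by apply: eq_bigr => p _ /=; rewrite linearP scalerDl scalerA.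
have [Dx|Dx] := boolP (x \in D).
  by exists l => y; rewrite inE => /orP[/eqP->|/ls //]; apply/eqP.
have [f [fx fD]] := ex_functional Dsub Dx.
exists ((x - \sum_(p <- l) (p.2 x : F) *: p.1, f) :: l) => y.
rewrite inE big_cons /= => /orP[/eqP->|ys]; first by rewrite fx scale1r subrK.
by rewrite fD ?scale0r ?add0r; [exact: ls|apply/eqP; exact: ls].
Qed.

Section Lifting.
Variables (F : realFieldType) (k : fieldType) (iota : {rmorphism F -> k}).
Variables (d : nat) (B : {pred 'M[k]_d}).
Hypotheses (Bsub : submod_closed B) (B1 : 1%:M \in B).
Hypothesis BM : forall x y, x \in B -> y \in B -> x *m y \in B.
Hypothesis BT : forall x, x \in B -> x^T \in B.
Hypothesis BF : forall (lambda : {linear restr iota k^o -> F^o}) x,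
  x \in B -> map_mx (fun c : k => iota (lambda c)) x \in B.

(** A family for the F-matrices of B serves B: by [BF] each g in B is a k-combination of such
    matrices, and the condition on M is linear in g. *)
Lemma separability_lift : exists r (e h : 'I_r -> 'M[k]_d),
  [/\ forall s, e s \in B, forall s, h s \in B & separability_mx B e h].
Proof.
pose S : {pred 'M[F]_d} := [pred x | map_mx iota x \in B].
have Ssub : submod_closed S.
  case: Bsub => B0 Bl; split=> [|c x y]; rewrite !inE ?map_mx0 //.
  by rewrite map_mxD map_mxZ; exact: Bl.
have [|||r [e [h [eS hS [eh1 eh2]]]]] := gram_separability Ssub.
- by rewrite inE map_scalar_mx rmorph1.
- by move=> x y; rewrite !inE map_mxM; exact: BM.
- by move=> x; rewrite !inE -map_trmx; exact: BT.
exists r, (fun s => map_mx iota (e s)), (fun s => map_mx iota (h s)); split=> //.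
split=> [g gB|]; last first.
  rewrite -[1 in RHS](rmorph1 iota) -map_scalar_mx -eh2 raddf_sum.
  by apply: eq_bigr => s _; rewrite -map_mxM.
have [l lE] := finite_dual_family [seq (g i j : restr iota k^o) | i <- enum 'I_d, j <- enum 'I_d].
have gE : g = \sum_(p <- l) (p.1 : k) *: map_mx iota (map_mx (fun c : k => p.2 c) g).
  apply/matrixP => i j; rewrite summxE.
  rewrite [LHS](lE (g i j)); last by apply/allpairsP; exists (i, j); rewrite !mem_enum.
  by apply: eq_bigr => p _; rewrite !mxE mulrC.
rewrite gE {gE}.
elim: l {lE} => [|p l [M [M1 M2]]].
  by exists 0; split=> s; rewrite big_nil ?mulmx0 ?mul0mx big1 // => t _; rewrite mxE scale0r.
have [|N [N1 N2]] := eh1 (map_mx (fun c : k => p.2 c) g).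
  rewrite inE -map_mx_comp; exact: BF.
exists ((p.1 : k) *: map_mx iota N + M); split=> s; rewrite big_cons ?mulmxDl ?mulmxDr ?M1 ?M2.
  rewrite -scalemxAr -map_mxM N1 raddf_sum scaler_sumr -big_split; apply: eq_bigr => t _.
  by rewrite /= map_mxZ !mxE scalerDl scalerA.
rewrite -scalemxAl -map_mxM N2 raddf_sum scaler_sumr -big_split; apply: eq_bigr => t _.
by rewrite /= map_mxZ !mxE scalerDl scalerA.
Qed.

End Lifting.

(** * The algebra of functional values and cosemisimplicity *)

Section FunctionalMatrices.
Variables (k : fieldType) (A : algType k) (d : nat) (u : 'M[A]_d).

Definition functional_mx : {pred 'M[k]_d} :=
  [pred b | `[< exists f : {linear A -> k^o}, b = fmx u f >]].

Lemma mem_functional_mx f : fmx u f \in functional_mx.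
Proof. by apply/asboolP; exists f. Qed.

Lemma functional_mx_sub : submod_closed functional_mx.
Proof.
split.
  have l0 : linear (fun _ : A => 0 : k^o) by move=> c x y; rewrite scaler0 addr0.
  apply/asboolP; exists (mk_linear l0 : {linear A -> k^o}).
  by apply/matrixP => i j; rewrite !mxE.
move=> c _ _ /asboolP[f ->] /asboolP[g ->].
have lfg : linear (fun x : A => c * f x + g x : k^o).
  move=> e x y; rewrite (linearP f) (linearP g) mulrDr addrACA; congr (_ + _).
  by rewrite [RHS]mulrDr; congr (_ + _); exact: mulrCA.
apply/asboolP; exists (mk_linear lfg : {linear A -> k^o}).
by apply/matrixP => i j; rewrite !mxE.
Qed.

Variable H : hopfAlgebra A.
Hypothesis um : multiplicative_matrix H u.

Lemma functional_mx_mul x y :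
  x \in functional_mx -> y \in functional_mx -> x *m y \in functional_mx.
Proof.
move=> /asboolP[f ->] /asboolP[g ->]; apply/asboolP.
by exists (conv H f g : {linear A -> k^o}); rewrite fmx_conv.
Qed.

Lemma functional_mx1 : 1%:M \in functional_mx.
Proof.
apply/asboolP; exists (counit H : {linear A -> k^o}).
by rewrite (fmx_counit um).
Qed.

End FunctionalMatrices.

Section SLcosemisimple.
Variables (k : fieldType) (n N : nat) (E : N.-tuple 'I_n -> k).
Local Notation SLE := (SL E).
Variables (H : hopfAlgebra SLE) (HE : SL_hopf H).

Lemma SL_cosemisimple : coef_field_orderable E -> cosemisimple H.
Proof.
move=> [F [iota coefE]]; apply: cosemisimple_simple_sum => x.
have [EF EFE] : exists EF : N.-tuple 'I_n -> F, forall j, iota (EF j) = E j.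
  have ex j : exists y, iota y = E j.
    by apply/(coefE (E j)) => S _ SE; exact: SE.
  by have [EF EFE] := boolp.choice ex; exists EF.
have [I [u [tu /(_ x (mem_head _ _)) xu]]] := ex_tensorial [:: x].
have um := family_mult HE tu; set U := family_mx u in xu um.
have [||||r [e [h [eB hB [eh1 eh2]]]]] := @separability_lift F k iota _ (functional_mx U)
    (functional_mx_sub U).
- exact: functional_mx1 um.
- exact: functional_mx_mul um.
- move=> _ /asboolP[f ->].
  have trE (j : N.-tuple 'I_n) : (idfun : {rmorphism k -> k}) (E j) = E j by [].
  have lf : linear (fun y : SLE => f (SL_tr trE y) : k^o).
    by move=> c y z; rewrite rmorphD /= SL_trZ linearP.
  apply/asboolP; exists (mk_linear lf : {linear SLE -> k^o}).
  apply/matrixP => i j; rewrite !mxE /mk_linear.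
  by congr (f _); exact/esym/(tensorial_tr (f := SL_tr trE) tu (SL_tr_gen trE)).
- move=> lambda _ /asboolP[g ->].
  have [f fE] := base_change_functional EFE lambda g.
  by apply/asboolP; exists f; apply/matrixP => i j; rewrite !mxE fE.
have [e' e'E] := boolp.choice (fun s => asboolW (eB s)).
have [h' h'E] := boolp.choice (fun s => asboolW (hB s)).
apply: (@coefs_simple_sum _ _ H _ U um r e' h' _ x xu); split; last first.
  by rewrite -eh2; apply: eq_bigr => s _; rewrite e'E h'E.
move=> g; have [M [M1 M2]] := eh1 _ (mem_functional_mx U g).
exists M; split=> s; rewrite -?e'E -?h'E ?M1 ?M2; apply: eq_bigr => t _.
  by rewrite e'E.
by rewrite h'E.
Qed.

End SLcosemisimple.

(** * Unitarizability *)

Section Unitarization.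
Variable C : numClosedFieldType.

Definition adj m p (M : 'M[C]_(m, p)) : 'M[C]_(p, m) := map_mx Num.conj M^T.

Lemma adjE m p (M : 'M[C]_(m, p)) i j : adj M i j = (M j i)^*.
Proof. by rewrite !mxE. Qed.

Lemma adjK m p (M : 'M[C]_(m, p)) : adj (adj M) = M.
Proof. by apply/matrixP => i j; rewrite !adjE conjCK. Qed.

Lemma adj_mul m p q (M : 'M[C]_(m, p)) (M' : 'M[C]_(p, q)) :
  adj (M *m M') = adj M' *m adj M.
Proof. by rewrite /adj trmx_mul map_mxM. Qed.

Lemma adj1 m : adj (1%:M : 'M[C]_m) = 1%:M.
Proof. by rewrite /adj trmx1 map_mx1. Qed.

Lemma adj_sumZ (I : finType) m p (c : I -> C) (M : I -> 'M[C]_(m, p)) :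
  adj (\sum_i c i *: M i) = \sum_i (c i)^* *: adj (M i).
Proof.
apply/matrixP => i j; rewrite adjE !summxE rmorph_sum; apply: eq_bigr => l _.
by rewrite !mxE rmorphM.
Qed.

Lemma mxtrace_adj m (M : 'M[C]_m) : \tr (adj M) = (\tr M)^*.
Proof. by rewrite /mxtrace rmorph_sum; apply: eq_bigr => i _; rewrite adjE. Qed.

Lemma orthonormal_basis d (B : {pred 'M[C]_d}) : submod_closed B ->
  exists r (e : 'I_r -> 'M[C]_d), (forall s, e s \in B) /\
    forall b, b \in B -> b = \sum_s \tr (adj (e s) *m b) *: e s.
Proof.
move=> Bsub; have [|A0 A0E] := @ex_rowspace C (d * d) [pred v | vec_mx v \in B].
  case: Bsub => S0 Sl; split=> [|c v w]; rewrite !inE ?linear0 //.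
  by rewrite linearP; exact: Sl.
have [r [Q [QE QQ]]] : exists r (Q : 'M[C]_(r, d * d)),
    (forall v, (v <= Q)%MS = (vec_mx v \in B)) /\ Q *m adj Q = 1%:M.
  exists (\rank A0), (schmidt (row_base A0)); split.
    by move=> v; rewrite eqmx_schmidt_free ?row_base_free // eq_row_base A0E.
  exact/unitarymxP/schmidt_unitarymx/rank_leq_col.
exists r, (fun s => vec_mx (row s Q)); split=> [s|b bB]; first by rewrite -QE row_sub.
have bE : mxvec b *m (adj Q *m Q) = mxvec b.
  have /submxP[x ->] : (mxvec b <= Q)%MS by rewrite QE mxvecK.
  by rewrite -!mulmxA (mulmxA Q) QQ mul1mx.
rewrite -[LHS]mxvecK -bE mulmxA mulmx_sum_row linear_sum.
apply: eq_bigr => s _; rewrite linearZ /=; congr (_ *: _).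
have -> : \tr (adj (vec_mx (row s Q)) *m b) =
    \tr (b *m (map_mx Num.conj (vec_mx (row s Q)))^T).
  rewrite mxtrace_mulC; congr (\tr (_ *m _)).
  by apply/matrixP => i j; rewrite !mxE.
rewrite -mxvec_dot -map_mxvec vec_mxK !mxE; apply: eq_bigr => j _.
by congr (_ * _); rewrite !mxE.
Qed.

(** Stack the rho s into X and orthonormalise: X = L Q with Q having orthonormal rows, so F can be
    the adjoint of L. The trivial common kernel makes L invertible. *)
Lemma gram_factor r m (rho : 'I_r -> 'M[C]_m) :
  (forall v : 'cV[C]_m, (forall s, rho s *m v = 0) -> v = 0) ->
  exists2 F : 'M[C]_m, F \in unitmx & adj F *m F = \sum_s adj (rho s) *m rho s.
Proof.
move=> rho0; set G := \sum_s _.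
pose T : finType := ('I_r * 'I_m)%type.
pose X : 'M[C]_(m, #|T|) :=
  \matrix_(i, p) (rho (enum_val p).1 (enum_val p).2 i)^*.
have XX : X *m adj X = G.
  apply/matrixP => i j; rewrite mxE summxE.
  transitivity (\sum_(p : T) (rho p.1 p.2 i)^* * rho p.1 p.2 j).
    rewrite [RHS](reindex (@enum_val T T)) /=; last exact/onW_bij/enum_val_bij.
    by apply: eq_bigr => p _; rewrite adjE !mxE conjCK.
  rewrite -(pair_bigA _ (fun s q => (rho s q i)^* * rho s q j)) /=.
  by apply: eq_bigr => s _; rewrite mxE; apply: eq_bigr => q _; rewrite adjE.
have Xfree : row_free X.
  apply: inj_row_free => v vX; apply: (can_inj (@adjK _ _)).
  rewrite [RHS](_ : _ = 0); last by apply/matrixP => i j; rewrite adjE !mxE conjC0.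
  apply: rho0 => s; apply/colP => q; rewrite !mxE.
  have /rowP/(_ (enum_rank (s, q))) := vX; rewrite !mxE => /(congr1 Num.conj).
  rewrite conjC0 rmorph_sum => h; rewrite -[RHS]h; apply: eq_bigr => i _.
  by rewrite adjE !mxE rmorphM /= conjCK enum_rankK mulrC.
(* Orthonormal rows require at least as many columns as rows. *)
have Xrank : (m <= #|T|)%N.
  by move: Xfree; rewrite -row_leq_rank => /leq_trans; apply; exact: rank_leq_col.
pose Q := schmidt X.
have QQ : Q *m adj Q = 1%:M by exact/unitarymxP/schmidt_unitarymx.
have /submxP[L XL] : (X <= Q)%MS by exact: schmidt_sub.
exists (adj L); last by rewrite adjK -XX XL adj_mul mulmxA -(mulmxA L) QQ mulmx1.
have Lu : L \in unitmx.
  rewrite -row_free_unit; apply: inj_row_free => v vL.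
  by apply: (row_free_inj Xfree); rewrite XL mulmxA vL !mul0mx.
have [L' LL'] : exists L', L *m L' = 1%:M by exists (invmx L); rewrite mulmxV.
suff /mulmx1_unit[] : adj L' *m adj L = 1%:M by [].
by rewrite -adj_mul LL' adj1.
Qed.

End Unitarization.

(** * The star structure *)

Section CQGstructure.
Variables (R : realType) (n m : nat) (E : m.+1.-tuple 'I_n -> R[i]).
Local Notation C := (R[i] : numClosedFieldType).
Local Notation SLE := (SL E).
Local Notation a := (SL_mx E).
Hypothesis realE : forall j, E j \is Num.real.
Variables (H : hopfAlgebra SLE) (HE : SL_hopf H).

Let conjR : {rmorphism R[i] -> R[i]} := @Num.conj C.

Lemma conj_form j : conjR (E j) = E j.
Proof. exact/CrealP/realE. Qed.

Definition SL_star (x : SLE) : SLE := antipode H (SL_tr conj_form x).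

Variable b : 'M[SLE]_n.
Hypotheses (ab : a *m b = 1%:M) (ba : b *m a = 1%:M).

Lemma SL_starM x y : SL_star (x * y) = SL_star y * SL_star x.
Proof. by rewrite /SL_star rmorphM !(antipode_SL HE ab ba) SL_antiM. Qed.

Lemma SL_star1 : SL_star 1 = 1.
Proof. by rewrite /SL_star rmorph1 (antipode_SL HE ab ba) SL_anti1. Qed.

Lemma SL_starP c x y : SL_star (c *: x + y) = c^* *: SL_star x + SL_star y.
Proof. by rewrite /SL_star rmorphD /= SL_trZ linearP. Qed.

Lemma SL_star_gen i j : SL_star (a i j) = b j i.
Proof. by rewrite /SL_star SL_tr_gen (antipode_SL HE ab ba) SL_anti_gen. Qed.

Lemma SL_star_linear : linear (SL_star : SLE -> restr conjR SLE).
Proof. exact: SL_starP. Qed.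

Lemma SL_star_sum (I : finType) (F : I -> SLE) :
  SL_star (\sum_i F i) = \sum_i SL_star (F i).
Proof.
exact: (linear_sum (mk_linear SL_star_linear : {linear SLE -> restr conjR SLE})).
Qed.

Lemma SL_star_b i j : SL_star (b j i) = a i j.
Proof.
pose X : 'M[SLE]_n := \matrix_(i, j) SL_star (b j i).
suff /matrixP/(_ i j) : X = a by rewrite mxE.
rewrite -[LHS]mul1mx -ab -mulmxA (_ : b *m X = 1%:M) ?mulmx1 //.
apply/matrixP => p q; rewrite mxE [RHS]mxE.
transitivity (SL_star ((b *m a) q p)); last first.
  rewrite ba mxE eq_sym; case: (p == q); first exact: SL_star1.
  by rewrite /SL_star rmorph0 linear0.
rewrite [(b *m a) q p]mxE SL_star_sum; apply: eq_bigr => l _.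
by rewrite [X l q]mxE SL_starM SL_star_gen.
Qed.

Lemma SL_starK : involutive SL_star.
Proof.
apply: SL_linear_ext => //.
- by move=> c x y; rewrite !SL_starP conjCK.
- by rewrite !SL_star1.
by move=> i j x ih; rewrite !SL_starM ih SL_star_gen SL_star_b.
Qed.

(** Both sides are inverse to the matrix of the Delta(a_ij): the left one by multiplicativity of
    Delta, the right one by cancelling a against b in each leg. *)
Lemma comul_b i j : comul H (b i j) = \sum_l b l j ⊗ b i l.
Proof.
have [D1 DM] := comul_mul H.
pose Da : 'M[tens SLE SLE]_n := \matrix_(i, j) comul H (a i j).
pose Db : 'M[tens SLE SLE]_n := \matrix_(i, j) comul H (b i j).
pose Y : 'M[tens SLE SLE]_n := \matrix_(i, j) \sum_l b l j ⊗ b i l.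
suff /matrixP/(_ i j) : Db = Y by rewrite !mxE.
have DbDa : Db *m Da = 1%:M.
  apply/matrixP => p q; rewrite mxE.
  transitivity (comul H ((b *m a) p q)).
    rewrite [(b *m a) p q]mxE linear_sum; apply: eq_bigr => l _.
    by rewrite [Db p l]mxE [Da l q]mxE DM.
  by rewrite ba !mxE; case: (p == q); rewrite ?D1 ?linear0.
have abE p q : \sum_l a p l * b l q = (p == q)%:R.
  by have /matrixP/(_ p q) := ab; rewrite mxE [RHS]mxE.
suff DaY : Da *m Y = 1%:M by rewrite -[LHS]mulmx1 -DaY mulmxA DbDa mul1mx.
apply/esym/matrixP => p q; rewrite mxE [RHS]mxE.
transitivity (\sum_j \sum_(l : 'I_n * 'I_n) (a p l.1 * b l.2 q) ⊗ (a l.1 j * b j l.2)).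
  rewrite exchange_big /=.
  rewrite -(pair_bigA _ (fun l1 l2 => \sum_i (a p l1 * b l2 q) ⊗ (a l1 i * b i l2))) /=.
  transitivity (\sum_l (a p l * b l q) ⊗ (1 : SLE)).
    rewrite -tpure_suml abE; case: (p == q); first by exact: erefl.
    by rewrite tpure0l.
  apply: eq_bigr => l1 _; rewrite (bigD1 l1) //= [X in _ + X]big1 => [|l2 l21].
    by rewrite addr0 -tpure_sumr abE eqxx.
  rewrite -tpure_sumr abE eq_sym (negPf l21).
  exact: tpure0r.
apply: eq_bigr => j' _; rewrite [Da _ _]mxE [Y _ _]mxE (HE p j').1 big_distrlr pair_bigA.
by apply: eq_bigr => l _ /=; rewrite [RHS]tpureM.
Qed.

Lemma SL_star_comul x (s : seq (SLE * SLE)) : comul H x = \sum_(p <- s) p.1 ⊗ p.2 ->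
  comul H (SL_star x) = \sum_(p <- s) SL_star p.1 ⊗ SL_star p.2.
Proof.
(* Both sides are antilinear in x; restricting scalars along conjugation makes them linear, so that
   induction on words applies. *)
pose W := restr conjR (tens SLE SLE).
pose f (x y : SLE) : W := SL_star x ⊗ SL_star y.
have bf : bilin f.
  apply: bilinI => [y|z] c u v; rewrite /f SL_starP.
  - by rewrite [LHS]tpureDl [X in X + _]tpureZl.
  - by rewrite [LHS]tpureDr [X in X + _]tpureZr.
have [D1 DM] := comul_mul H.
have key : (fun x : SLE => comul H (SL_star x) : W) =1 (fun x => tlift f (comul H x)).
  apply: SL_linear_ext => [c y z|c y z||i j y ih].
  - by rewrite SL_starP linearP.
  - by rewrite linearP (tlift_linear bf).
  - by rewrite SL_star1 !D1 (tlift_pure bf) /f SL_star1.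
  rewrite SL_starM SL_star_gen DM [X in X * _]ih comul_b (tlift_comul HE _ _ _ bf).
  rewrite mulr_sumr; apply: eq_bigr => l _; rewrite [LHS]mulr_suml.
  apply: eq_bigr => q _; rewrite /f !SL_starM !SL_star_gen.
  by rewrite [LHS]tpureM.
move=> xE; rewrite [LHS]key xE tlift_bigsum //.
by apply: eq_bigr => p _; rewrite tlift_pure.
Qed.

Lemma SL_hopf_star : hopf_star H SL_star.
Proof.
by split; [exact: SL_starP|exact: SL_starM|exact: SL_starK|exact: SL_star_comul].
Qed.

End CQGstructure.

Lemma conj_mx_inverse (A : nzRingType) p (X Y v s : 'M[A]_p) :
  X *m Y = 1%:M -> Y *m X = 1%:M -> v *m s = 1%:M ->
  (X *m v *m Y) *m (X *m s *m Y) = 1%:M.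
Proof.
move=> XY YX vs; rewrite -!mulmxA (mulmxA Y) YX mul1mx (mulmxA v) vs mul1mx.
exact: XY.
Qed.

Section ScalarMatrices.
Variables (R : realType) (A : algType R[i]) (p : nat).
Implicit Types M : 'M[R[i]]_p.

Lemma scal_mxM M M' : scal_mx A (M *m M') = scal_mx A M *m scal_mx A M'.
Proof.
apply/matrixP => i j; rewrite !mxE scaler_suml; apply: eq_bigr => l _.
by rewrite !mxE -scalerAl mul1r scalerA.
Qed.

Lemma scal_mx1 : scal_mx A (1%:M : 'M_p) = 1%:M.
Proof. by apply/matrixP => i j; rewrite !mxE scaler_nat. Qed.

Lemma scal_mx_sandwich M M' (v : 'M[A]_p) i j :
  (scal_mx A M *m v *m scal_mx A M') i j =
  \sum_l \sum_q (M i l * M' q j) *: v l q.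
Proof.
rewrite mxE exchange_big; apply: eq_bigr => q _; rewrite !mxE mulr_suml.
apply: eq_bigr => l _; rewrite !mxE -scalerAl mul1r -scalerAr mulr1 scalerA.
by rewrite mulrC.
Qed.

(** Meant for Fa the adjoint of F and K the conjugate transpose of v, primes being inverses: if the
    form Fa F intertwines v and K, then the conjugate of v by F is its own conjugate transpose. *)
Lemma sandwich_invariant (F F' Fa F'a : 'M[R[i]]_p) (v K : 'M[A]_p) :
  F *m F' = 1%:M -> F'a *m (Fa *m F) = F ->
  scal_mx A (Fa *m F) *m v = K *m scal_mx A (Fa *m F) ->
  scal_mx A F'a *m K *m scal_mx A Fa = scal_mx A F *m v *m scal_mx A F'.
Proof.
move=> FF' F'aF vK.
have -> : scal_mx A Fa = scal_mx A (Fa *m F) *m scal_mx A F'.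
  by rewrite -scal_mxM -mulmxA FF' mulmx1.
by rewrite mulmxA -[_ *m K *m _]mulmxA -vK mulmxA -scal_mxM F'aF.
Qed.

End ScalarMatrices.

Section Unitarizable.
Variables (R : realType) (n m : nat) (E : m.+1.-tuple 'I_n -> R[i]).
Local Notation C := (R[i] : numClosedFieldType).
Local Notation SLE := (SL E).
Local Notation a := (SL_mx E).
Hypothesis realE : forall j, E j \is Num.real.
Variables (H : hopfAlgebra SLE) (HE : SL_hopf H).
Variables (p : nat) (v : 'M[SLE]_p).
Hypothesis vm : multiplicative_matrix H v.

Local Notation tr := (SL_tr (conj_form realE)).

(* Averaging the standard inner product over an orthonormal basis of the
   *-algebra dual to the coefficient coalgebra of an orthogonal comodule that
   contains the coefficients of v. *)
Lemma ex_invariant_form : exists2 F : 'M[R[i]]_p, F \in unitmx &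
  scal_mx SLE (adj (C := C) F *m F) *m v =
  (\matrix_(i, j) tr (v j i)) *m scal_mx SLE (adj (C := C) F *m F).
Proof.
have [I [u [tu us]]] := ex_tensorial [seq v i j | i <- enum 'I_p, j <- enum 'I_p].
have um := family_mult HE tu; set U := family_mx u in us um.
have vU i j : v i j \in coefs U.
  by apply: us; apply/allpairsP; exists (i, j); rewrite !mem_enum.
have [r [e [eB eE]]] := @orthonormal_basis C _ _ (functional_mx_sub U).
have [f fE] := boolp.choice (fun s => asboolW (eB s)).
pose rho s : 'M[C]_p := fmx v (f s).
(* The coefficients of v lie among those of U, so the expansion of g(U) in the orthonormal basis
   carries over to v. *)
have agree g : fmx v g = \sum_s \tr (adj (C := C) (e s) *m fmx U g) *: rho s.
  apply/matrixP => i j; rewrite mxE summxE.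
  rewrite (@fmx_agree _ _ _ U _ (fun s => \tr (adj (C := C) (e s) *m fmx U g)) g f) ?vU //.
    by apply: eq_bigr => s _; rewrite !mxE.
  rewrite [LHS](eE _ (mem_functional_mx U g)); apply: eq_bigr => s _.
  by rewrite -fE.
(* The counit sends v to the identity, which is therefore a combination of the rho s. *)
have rho0 (w : 'cV[C]_p) : (forall s, rho s *m w = 0) -> w = 0.
  move=> hw; rewrite -[LHS]mul1mx -(fmx_counit vm) agree mulmx_suml.
  by rewrite big1 // => s _; rewrite -scalemxAl hw scaler0.
have [F Fu FG] := gram_factor rho0.
exists F => //; rewrite FG; set G := \sum_s _.
have lstar (g : {linear SLE -> R[i]^o}) : linear (fun x : SLE => (g (tr x) : R[i])^* : R[i]^o).
  by move=> c x y; rewrite rmorphD /= SL_trZ linearP rmorphD rmorphM /= conjCK.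
pose gs (g : {linear SLE -> R[i]^o}) : {linear SLE -> R[i]^o} := mk_linear (lstar g).
have Ugs g : fmx U (gs g) = adj (C := C) (fmx U g).
  apply/matrixP => i j; rewrite !mxE /gs /= /mk_linear; congr (_^*).
  by congr (g _); exact: (tensorial_tr (f := tr) tu (SL_tr_gen _)).
pose K : 'M[SLE]_p := \matrix_(i, j) tr (v j i).
have Kg g : fmx K g = adj (C := C) (fmx v (gs g)).
  by apply/matrixP => i j; rewrite !mxE /gs /= /mk_linear conjCK.
(* For the trace inner product, right multiplication by the adjoint of g(U) is adjoint to right
   multiplication by g(U); so both sides expand into the same double sum over s and t. *)
have GE g : G *m fmx v g = fmx K g *m G.
  transitivity (\sum_s \sum_t \tr (adj (C := C) (e t) *m (e s *m fmx U g)) *: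
      (adj (C := C) (rho s) *m rho t)).
    rewrite mulmx_suml; apply: eq_bigr => s _.
    rewrite -mulmxA -(fmx_conv vm) agree mulmx_sumr; apply: eq_bigr => t _.
    by rewrite (fmx_conv um) -fE -scalemxAr.
  rewrite exchange_big Kg mulmx_sumr; apply: eq_bigr => t _ /=.
  rewrite mulmxA -adj_mul -(fmx_conv vm) agree adj_sumZ mulmx_suml.
  apply: eq_bigr => s _; rewrite -scalemxAl; congr (_ *: _).
  rewrite (fmx_conv um) -fE Ugs -mxtrace_adj !adj_mul !adjK.
  by rewrite -[in RHS]mulmxA [RHS]mxtrace_mulC -[in RHS]mulmxA.
apply/matrixP => i j; apply: functional_inj => g; rewrite !mxE !linear_sum.
have /matrixP/(_ i j) := GE g; rewrite !mxE => e0.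
transitivity (\sum_l G i l * (fmx v g) l j).
  by apply: eq_bigr => l _; rewrite !mxE -scalerAl mul1r linearZ.
rewrite e0; apply: eq_bigr => l _.
by rewrite !mxE -scalerAr mulr1 linearZ /= mulrC.
Qed.

Definition cadj (M : 'M[R[i]]_p) : 'M[R[i]]_p := adj (C := C) M.

Lemma tr_sandwich (M M' : 'M[R[i]]_p) :
  (\matrix_(i, j) tr ((scal_mx SLE M *m v *m scal_mx SLE M') j i)) =
  scal_mx SLE (cadj M') *m (\matrix_(i, j) tr (v j i)) *m
    scal_mx SLE (cadj M).
Proof.
apply/matrixP => i j.
transitivity (\sum_l \sum_q (cadj M' i q * cadj M l j) *: tr (v l q)); last first.
  rewrite scal_mx_sandwich exchange_big; apply: eq_bigr => l _.
  by apply: eq_bigr => q _; congr (_ *: _); rewrite mxE.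
transitivity (tr (\sum_l \sum_q (M j l * M' q i) *: v l q)).
  by rewrite -scal_mx_sandwich mxE.
rewrite rmorph_sum; apply: eq_bigr => l _; rewrite rmorph_sum; apply: eq_bigr => q _.
rewrite [LHS]SL_trZ [X in X *: _]rmorphM !adjE.
by rewrite [X in X *: _]mulrC.
Qed.

Lemma SL_unitarizable : unitarizable (SL_star realE H) v.
Proof.
have [F Fu FE] := ex_invariant_form; exists F => //.
set F' := invmx F; set w := _ *m scal_mx _ F'.
pose sv := map_mx (antipode H) v.
have FF' : scal_mx SLE F *m scal_mx SLE F' = 1%:M.
  by rewrite -scal_mxM mulmxV // scal_mx1.
have F'F : scal_mx SLE F' *m scal_mx SLE F = 1%:M.
  by rewrite -scal_mxM mulVmx // scal_mx1.
have b1 := mul_bilin (idfun : {linear SLE -> SLE}) (antipode H).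
have b2 := mul_bilin (antipode H) (idfun : {linear SLE -> SLE}).
have vsv : v *m sv = 1%:M.
  apply/matrixP => i j; rewrite mxE [RHS]mxE.
  transitivity (tlift (fun y z => y * antipode H z) (comul H (v i j))).
    rewrite (vm i j).1 tlift_bigsum //; apply: eq_bigr => l _.
    by rewrite [sv l j]mxE tlift_pure.
  by rewrite antipoder (vm i j).2 scaler_nat.
have svv : sv *m v = 1%:M.
  apply/matrixP => i j; rewrite mxE [RHS]mxE.
  transitivity (tlift (fun y z => antipode H y * z) (comul H (v i j))).
    rewrite (vm i j).1 tlift_bigsum //; apply: eq_bigr => l _.
    by rewrite [sv i l]mxE tlift_pure.
  by rewrite antipodel (vm i j).2 scaler_nat.
(* Since w is its own conjugate transpose, its star matrix is the antipode applied to w entrywise,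
   which is the inverse of w. *)
have trw : (\matrix_(i, j) tr (w j i)) = w.
  rewrite tr_sandwich; apply: sandwich_invariant FE; first by rewrite mulmxV.
  by rewrite mulmxA -adj_mul mulmxV // adj1 mul1mx.
have starw : star_mx (SL_star realE H) w = scal_mx SLE F *m sv *m scal_mx SLE F'.
  apply/matrixP => i j; rewrite mxE /SL_star.
  have /matrixP/(_ i j) := trw; rewrite mxE => ->.
  rewrite !scal_mx_sandwich linear_sum; apply: eq_bigr => l _.
  rewrite linear_sum; apply: eq_bigr => q _.
  by rewrite linearZ /= [in RHS]mxE.
split; rewrite starw.
  exact: (conj_mx_inverse FF' F'F vsv).
exact: (conj_mx_inverse FF' F'F svv).
Qed.

End Unitarizable.

(* E is a linear form on V^{(x) N} with N = m.+1. *)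
Theorem theorem5p3 (n m : nat) (hn : (1 <= n)%N) (hN : (2 <= m.+1)%N) :
  (forall (k : fieldType) (E : m.+1.-tuple 'I_n -> k),
     left_nondegenerate E -> right_nondegenerate E ->
     (exists H : hopfAlgebra (SL E), SL_hopf H /\ bijective (antipode H)) /\
     (forall H : hopfAlgebra (SL E), SL_hopf H ->
        (forall beta : 'I_n -> k,
           (forall i, beta i != 0) ->
           (forall (i : 'I_n) (j : m.-tuple 'I_n),
              E [tuple of rcons j i] = beta i * E [tuple of i :: j]) ->
           exists Phi : {lrmorphism SL E -> k^o},
             is_sovereign H Phi /\
             forall i j, Phi (SL_mx E i j) = (i == j)%:R * beta i) /\
        ([pchar k] =i pred0 -> coef_field_orderable E -> cosemisimple H))) /\
  (forall (R : realType) (E : m.+1.-tuple 'I_n -> R[i]),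
     left_nondegenerate E -> right_nondegenerate E ->
     (forall j, E j \is Num.real) ->
     forall H : hopfAlgebra (SL E), SL_hopf H -> admits_CQG H).
Proof.
split=> [k E lE rE|R E lE rE realE H HE].
  split=> [|H HE]; first exact: SL_hopf_exists.
  split=> [beta beta0 betaE|_ orderable]; first exact: SL_sovereign.
  exact: SL_cosemisimple.
have [b [ab ba]] := ex_inverse (SL_gen_rel E) lE rE.
exists (SL_star realE H); split; first exact: SL_hopf_star ab ba.
by move=> p v vm; exact: SL_unitarizable.
Qed.
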